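(* Let $M,N$ be pure $\lambda\mu$-terms. Then $M\equiv_{wxh}N$ if and only if $M\equiv_{wh}N$.
   Context: $\lambda\mu$-terms: $M ::= x\mid\lambda x.M\mid MN\mid\mu\alpha.[\beta]M$; $\lambda\mu x$-terms add $M\langle x:=N\rangle$ and $M\langle\alpha:=N\cdot\gamma\rangle$ (explicit substitutions, also attachable to commands $[\beta]M$). $M[N/x]$ substitution, $M[\beta/\gamma]$ renaming, $M[N\cdot\gamma/\alpha]$ replaces recursively each $[\alpha]M'$ by $[\gamma](M'[N\cdot\gamma/\alpha])N$. $\to_{\beta\mu}$: closure under all contexts of $(\lambda x.M)N\to M[N/x]$; $(\mu\alpha.[\beta]M)N\to\mu\gamma.(([\beta]M)[N\cdot\gamma/\alpha])$; $\mu\delta.[\beta]\mu\gamma.[\alpha]M\to\mu\delta.(([\alpha]M)[\beta/\gamma])$; $\mu\alpha.[\alpha]M\to M$ ($\alpha\notin\mathrm{fn}(M)$). $\to_{wh}$: $\to_{\beta\mu}$ without contextual rules $LM\to LN$, $\lambda x.M\to\lambda x.N$. WHNF: $W::=\lambda x.M\mid xM_1\cdots M_n\mid\mu\alpha.[\beta]W$ ($\alpha\ne\beta$ or $\alpha\in\mathrm{fn}(W)$, $W$ not of form $\mu\gamma.[\delta]W'$). $\equiv_{wh}$: largest symmetric relation with $M\equiv_{wh}N$ iff both have no WHNF, or $M\to^*_{wh}M'$, $N\to^*_{wh}N'$ ($\to_{wh}$-normal) and: $M'=xM_1\cdots M_n$, $N'=xN_1\cdots N_n$, $M_i\equiv_{wh}N_i$;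 or $M'=\lambda x.M''$, $N'=\lambda x.N''$, $M''\equiv_{wh}N''$; or $M'=\mu\alpha.[\beta]M''$, $N'=\mu\alpha.[\beta]N''$, $M''\equiv_{wh}N''$. $\lambda\mu x$ reduction rules: $(\lambda x.M)N\to M\langle x:=N\rangle$; $(\mu\alpha.C)N\to\mu\gamma.(C\langle\alpha:=N\cdot\gamma\rangle)$; $\mu\beta.[\beta]M\to M$ ($\beta\notin\mathrm{fn}(M)$); $[\beta]\mu\gamma.C\to C[\beta/\gamma]$; $x\langle x:=N\rangle\to N$; $M\langle x:=N\rangle\to M$ ($x\notin\mathrm{fv}(M)$); $M\langle\alpha:=N\cdot\gamma\rangle\to M$ ($\alpha\notin\mathrm{fn}(M)$). Head variable: $\mathrm{hv}(x)=x$, $\mathrm{hv}(MN)=\mathrm{hv}(M)$, $\mathrm{hv}(\lambda y.M)=\mathrm{hv}(M)$ if $\ne y$, $\mathrm{hv}(\mu\alpha.[\beta]M)=\mathrm{hv}(M)$, $\mathrm{hv}(M\langle x:=N\rangle)=\mathrm{hv}(M)$ if $\ne x$, $\mathrm{hv}(M\langle\alpha:=N\cdot\gamma\rangle)=\mathrm{hv}(M)$. Head name: $\mathrm{hn}(\mu\alpha.[\beta]M)=\beta$, $\mathrm{hn}(M\langle x:=N\rangle)=\mathrm{hn}(M)$, $\mathrm{hn}(M\langle\alpha:=N\cdot\gamma\rangle)=\mathrm{hn}(M)$ if $\ne\alpha$. Weak explicit head reduction $\to_{wxh}$ consists of the rules just listed together with: $(PQ)\langle x:=N\rangle\to(P\langle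 x:=N\rangle\,Q)\langle x:=N\rangle$ if $x=\mathrm{hv}(PQ)$; $(\mu\alpha.[\beta]M)\langle x:=N\rangle\to\mu\alpha.[\beta](M\langle x:=N\rangle)$ if $x=\mathrm{hv}(\mu\alpha.[\beta]M)$; $(\mu\beta.[\alpha]M)\langle\alpha:=N\cdot\gamma\rangle\to\mu\beta.[\gamma](M\langle\alpha:=N\cdot\gamma\rangle)N$; $M\langle x:=N\rangle\langle y:=L\rangle\to M\langle y:=L\rangle\langle x:=N\rangle\langle y:=L\rangle$ and $M\langle\alpha:=N\cdot\beta\rangle\langle y:=L\rangle\to M\langle y:=L\rangle\langle\alpha:=N\cdot\beta\rangle\langle y:=L\rangle$ if $y=\mathrm{hv}(M)$; $M\langle\alpha:=N\cdot\gamma\rangle\langle\beta:=L\cdot\delta\rangle\to M\langle\beta:=L\cdot\delta\rangle\langle\alpha:=N\cdot\gamma\rangle\langle\beta:=L\cdot\delta\rangle$ and $M\langle x:=N\rangle\langle\beta:=L\cdot\delta\rangle\to M\langle\beta:=L\cdot\delta\rangle\langle x:=N\rangle\langle\beta:=L\cdot\delta\rangle$ if $\beta=\mathrm{hn}(M)$; closed only under the contextual rules $M\to N\Rightarrow ML\to NL$, $\mu\alpha.[\beta]M\to\mu\alpha.[\beta]N$, $M\langle x:=L\rangle\to N\langle x:=L\rangle$, $M\langle\alpha:=L\cdot\gamma\rangle\to N\langle\alpha:=L\cdot\gamma\rangle$. Convention: reducts are written $M'\sigma$ with $\sigma$ the sequence of explicit substitutions collected at the outside; $x\in\sigma$ if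 $\sigma$ contains some $\langle x:=P\rangle$. $\equiv_{wxh}$ is the largest symmetric relation such that $M\equiv_{wxh}N$ iff both have no $\to_{wxh}$-normal form, or $M\to^*_{wxh}M'\sigma$ and $N\to^*_{wxh}N'\sigma'$ (both $\to_{wxh}$-normal forms) and: if $M'=xM_1\cdots M_n$ then $N'=xN_1\cdots N_n$ ($x\notin\sigma,\sigma'$) and $M_i\sigma\equiv_{wxh}N_i\sigma'$; if $M'=\lambda x.M''$ then $N'=\lambda x.N''$ and $M''\sigma\equiv_{wxh}N''\sigma'$; if $M'=\mu\alpha.[\beta]M''$ then $N'=\mu\alpha.[\beta]N''$ and $M''\sigma\equiv_{wxh}N''\sigma'$.
   Formalization: Weak explicit head reduction is taken modulo (M⟨..⟩)L = (ML)⟨..⟩ and [β](M⟨..⟩) = ([β]M)⟨..⟩, and the rule ([α]M)⟨α:=N·γ⟩ → [γ](M⟨α:=N·γ⟩)N on commands is added; with only the listed rules the claim fails, e.g. for (μα.[α]λx.x)z and z. *)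

(* Defs.v *)
From Stdlib Require Import List Relations.
Import ListNotations.

(* Terms are taken up to alpha-conversion via de Bruijn indices, with two
   independent index spaces: variables (x, y, ...) and names (alpha, ...). *)

Definition scons {A : Type} (a : A) (f : nat -> A) (n : nat) : A :=
  match n with 0 => a | S n => f n end.

Definition upr (f : nat -> nat) : nat -> nat := scons 0 (fun n => S (f n)).

Definition idr : nat -> nat := fun n => n.

(** * The pure lambda-mu-calculus *)

(* [LMu b M] is mu alpha.[b]M: alpha is name 0 both in [b] and in [M]. *)
Inductive lm : Type :=
| LVar (x : nat)
| LLam (M : lm)
| LApp (M N : lm)
| LMu (b : nat) (M : lm).

(* [lren f g M] renames variables by [f] and names by [g]. *)
Fixpoint lren (f g : nat -> nat) (M : lm) : lm :=
  match M with
  | LVar x => LVar (f x)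
  | LLam P => LLam (lren (upr f) g P)
  | LApp P Q => LApp (lren f g P) (lren f g Q)
  | LMu b P => LMu (upr g b) (lren f (upr g) P)
  end.

Definition lshiftv : lm -> lm := lren S idr.
Definition lshiftn : lm -> lm := lren idr S.

Fixpoint lsubst (s : nat -> lm) (M : lm) : lm :=
  match M with
  | LVar x => s x
  | LLam P => LLam (lsubst (scons (LVar 0) (fun n => lshiftv (s n))) P)
  | LApp P Q => LApp (lsubst s P) (lsubst s Q)
  | LMu b P => LMu b (lsubst (fun n => lshiftn (s n)) P)
  end.

(* A structural substitution maps each name a either to [(g, None)]: rename a
   to g; or to [(g, Some N)]: replace [a]P by [g](P' N), with P' the result of
   substituting in P. *)
Definition ssubst : Type := nat -> nat * option lm.

Definition smap (h : nat -> nat) (k : lm -> lm) (p : nat * option lm) :=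
  (h (fst p), option_map k (snd p)).

(* mu alpha.(([b]P)[t]), where [t] acts on the names in scope below the mu and
   [P'] is P[t]. *)
Definition smu (t : ssubst) (b : nat) (P' : lm) : lm :=
  match t b with
  | (g, None) => LMu g P'
  | (g, Some N) => LMu g (LApp P' N)
  end.

Fixpoint lstruct (t : ssubst) (M : lm) : lm :=
  match M with
  | LVar x => LVar x
  | LLam P => LLam (lstruct (fun a => smap idr lshiftv (t a)) P)
  | LApp P Q => LApp (lstruct t P) (lstruct t Q)
  | LMu b P =>
      let t' := scons (0, None) (fun a => smap S lshiftn (t a)) in
      smu t' b (lstruct t' P)
  end.

Fixpoint lfn (a : nat) (M : lm) : Prop :=
  match M with
  | LVar _ => False
  | LLam P => lfn a P
  | LApp P Q => lfn a P \/ lfn a Q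
  | LMu b P => b = S a \/ lfn (S a) P
  end.

Definition lapps (M : lm) (Ms : list lm) : lm := fold_left LApp Ms M.

(** ** Weak head reduction *)

(* [N . gamma / alpha] below the mu that rebinds gamma: gamma takes over the
   index 0 of alpha. *)
Definition push_arg (N : lm) : ssubst :=
  scons (0, Some (lshiftn N)) (fun a => (S a, None)).

(* Non-occurrence of the bound name is expressed by a shifted body. *)
Inductive wh : lm -> lm -> Prop :=
| wh_beta M N : wh (LApp (LLam M) N) (lsubst (scons N LVar) M)
| wh_mu b M N :
    wh (LApp (LMu b M) N) (smu (push_arg N) b (lstruct (push_arg N) M))
| wh_ren b a M :
    wh (LMu b (LMu a M)) (LMu (scons b idr a) (lren idr (scons b idr) M))
| wh_eta M : wh (LMu 0 (lshiftn M)) M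
| wh_appl M M' N : wh M M' -> wh (LApp M N) (LApp M' N)
| wh_mubody b M M' : wh M M' -> wh (LMu b M) (LMu b M').

Definition whs : relation lm := clos_refl_trans lm wh.

Definition wh_normal (M : lm) : Prop := forall M', ~ wh M M'.

Definition is_lmu (M : lm) : Prop := exists b P, M = LMu b P.

Inductive whnf : lm -> Prop :=
| whnf_lam M : whnf (LLam M)
| whnf_var x Ms : whnf (lapps (LVar x) Ms)
| whnf_mu b W :
    whnf W -> (b <> 0 \/ lfn 0 W) -> ~ is_lmu W -> whnf (LMu b W).

Definition has_whnf (M : lm) : Prop := exists W, whs M W /\ whnf W.

(** ** The induced equivalence *)

Definition largest_symmetric {A : Type} (F : relation A -> relation A)
    : relation A :=
  fun a b => exists R : relation A,
    symmetric A R /\ (forall c d, R c d <-> F R c d) /\ R a b.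

Definition wh_clause (R : relation lm) (M N : lm) : Prop :=
  (~ has_whnf M /\ ~ has_whnf N) \/
  (exists M' N', whs M M' /\ wh_normal M' /\ whs N N' /\ wh_normal N' /\
    ((exists x Ms Ns, M' = lapps (LVar x) Ms /\ N' = lapps (LVar x) Ns /\
        Forall2 R Ms Ns)
     \/ (exists M'' N'', M' = LLam M'' /\ N' = LLam N'' /\ R M'' N'')
     \/ (exists b M'' N'', M' = LMu b M'' /\ N' = LMu b N'' /\ R M'' N''))).

Definition wh_equiv : relation lm := largest_symmetric wh_clause.

(** * The calculus with explicit substitutions *)

(* [TSub M N] is M<x:=N>, binding variable 0 in [M]; [NSub M N g] is
   M<alpha:=N.g>, binding name 0 in [M]; [CTSub] and [CNSub] are the same
   substitutions attached to a command. *)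
Inductive tm : Type :=
| Var (x : nat)
| Lam (M : tm)
| App (M N : tm)
| Mu (C : cmd)
| TSub (M N : tm)
| NSub (M N : tm) (g : nat)
with cmd : Type :=
| Nam (b : nat) (M : tm)
| CTSub (C : cmd) (N : tm)
| CNSub (C : cmd) (N : tm) (g : nat).

Fixpoint emb (M : lm) : tm :=
  match M with
  | LVar x => Var x
  | LLam P => Lam (emb P)
  | LApp P Q => App (emb P) (emb Q)
  | LMu b P => Mu (Nam b (emb P))
  end.

Fixpoint ren (f g : nat -> nat) (M : tm) : tm :=
  match M with
  | Var x => Var (f x)
  | Lam P => Lam (ren (upr f) g P)
  | App P Q => App (ren f g P) (ren f g Q)
  | Mu C => Mu (cren f (upr g) C)
  | TSub P N => TSub (ren (upr f) g P) (ren f g N)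
  | NSub P N c => NSub (ren f (upr g) P) (ren f g N) (g c)
  end
with cren (f g : nat -> nat) (C : cmd) : cmd :=
  match C with
  | Nam b P => Nam (g b) (ren f g P)
  | CTSub D N => CTSub (cren (upr f) g D) (ren f g N)
  | CNSub D N c => CNSub (cren f (upr g) D) (ren f g N) (g c)
  end.

Definition shiftv : tm -> tm := ren S idr.
Definition shiftn : tm -> tm := ren idr S.

Definition swap01 (n : nat) : nat :=
  match n with 0 => 1 | 1 => 0 | n => n end.

(* Index 1 becomes bound by a new innermost binder; the other indices are
   shifted past that binder. *)
Definition pull1 (n : nat) : nat :=
  match n with 0 => 1 | 1 => 0 | n => S n end.

(** ** Head variable and head name ([None] when bound or undefined) *)

Definition unbind (o : option nat) : option nat :=
  match o with Some (S n) => Some n | _ => None end.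

Fixpoint hv (M : tm) : option nat :=
  match M with
  | Var x => Some x
  | Lam P => unbind (hv P)
  | App P _ => hv P
  | Mu C => chv C
  | TSub P _ => unbind (hv P)
  | NSub P _ _ => hv P
  end
with chv (C : cmd) : option nat :=
  match C with
  | Nam _ P => hv P
  | CTSub D _ => unbind (chv D)
  | CNSub D _ _ => chv D
  end.

Fixpoint chn (C : cmd) : option nat :=
  match C with
  | Nam b _ => Some b
  | CTSub D _ => chn D
  | CNSub D _ _ => unbind (chn D)
  end.

Fixpoint hn (M : tm) : option nat :=
  match M with
  | Var _ | Lam _ | App _ _ => None
  | Mu C => unbind (chn C)
  | TSub P _ => hn P
  | NSub P _ _ => unbind (hn P)
  end.

(** ** Collecting substitutions at the outside *)

(* Explicit substitutions are written outside the applications and namings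
   they do not interact with, so (M<..>)L and (ML)<..>, and likewise [b](M<..>)
   and ([b]M)<..>, are the same reduct. Without this (\x.\y.y x) z I would be
   stuck at ((\y.y x)<x:=z>) I. There is no such identification across mu:
   (mu a.[b]M)<x:=N> --> mu a.[b](M<x:=N>) is a reduction step. *)
Inductive scong : tm -> tm -> Prop :=
| sc_app_t M N L :
    scong (App (TSub M N) L) (TSub (App M (shiftv L)) N)
| sc_app_n M N g L :
    scong (App (NSub M N g) L) (NSub (App M (shiftn L)) N g)
| sc_refl M : scong M M
| sc_sym M N : scong M N -> scong N M
| sc_trans M N L : scong M N -> scong N L -> scong M L
| sc_appl M M' L : scong M M' -> scong (App M L) (App M' L)
| sc_mu C C' : cscong C C' -> scong (Mu C) (Mu C')
| sc_tsub M M' L : scong M M' -> scong (TSub M L) (TSub M' L)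
| sc_nsub M M' L g : scong M M' -> scong (NSub M L g) (NSub M' L g)
with cscong : cmd -> cmd -> Prop :=
| csc_t b M N :
    cscong (Nam b (TSub M N)) (CTSub (Nam b M) N)
| csc_n b M N g :
    cscong (Nam b (NSub M N g)) (CNSub (Nam (S b) M) N g)
| csc_refl C : cscong C C
| csc_sym C D : cscong C D -> cscong D C
| csc_trans C D E : cscong C D -> cscong D E -> cscong C E
| csc_nam b M M' : scong M M' -> cscong (Nam b M) (Nam b M')
| csc_tsub C C' L : cscong C C' -> cscong (CTSub C L) (CTSub C' L)
| csc_nsub C C' L g : cscong C C' -> cscong (CNSub C L g) (CNSub C' L g).

(** ** Weak explicit head reduction *)

Inductive step : tm -> tm -> Prop :=
| st_beta M N : step (App (Lam M) N) (TSub M N)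
  (* below the new mu, gamma is name 0; inside the substitution alpha is 0 and
     gamma is 1 *)
| st_mu C N :
    step (App (Mu C) N) (Mu (CNSub (cren idr (upr S) C) (shiftn N) 0))
| st_eta M : step (Mu (Nam 0 (shiftn M))) M
| st_var N : step (TSub (Var 0) N) N
| st_gc_t M N : step (TSub (shiftv M) N) M
| st_gc_n M N g : step (NSub (shiftn M) N g) M
| st_app_t P Q N :
    hv (App P Q) = Some 0 ->
    step (TSub (App P Q) N)
         (TSub (App (TSub (ren (upr S) idr P) (shiftv N)) Q) N)
| st_mu_t b M N :
    hv (Mu (Nam b M)) = Some 0 ->
    step (TSub (Mu (Nam b M)) N) (Mu (Nam b (TSub M (shiftn N))))
| st_mu_n M N g :
    step (NSub (Mu (Nam 1 M)) N g)
         (Mu (Nam (S g)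
            (App (NSub (ren idr swap01 M) (shiftn N) (S g)) (shiftn N))))
| st_tt M N L :
    hv M = Some 1 ->
    step (TSub (TSub M N) L)
         (TSub (TSub (TSub (ren pull1 idr M) (shiftv (shiftv L))) N) L)
| st_nt M N b L :
    hv M = Some 0 ->
    step (TSub (NSub M N b) L)
         (TSub (NSub (TSub (ren (upr S) idr M) (shiftv (shiftn L))) N b) L)
| st_nn M N g L d :
    hn M = Some 1 ->
    step (NSub (NSub M N g) L d)
         (NSub (NSub (NSub (ren idr pull1 M) (shiftn (shiftn L)) (S (S d)))
                     N g) L d)
| st_tn M N L d :
    hn M = Some 0 ->
    step (NSub (TSub M N) L d)
         (NSub (TSub (NSub (ren idr (upr S) M) (shiftv (shiftn L)) (S d)) N)
               L d)
| st_appl M M' L : step M M' -> step (App M L) (App M' L)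
| st_mubody C C' : cstep C C' -> step (Mu C) (Mu C')
| st_tsub M M' L : step M M' -> step (TSub M L) (TSub M' L)
| st_nsub M M' L g : step M M' -> step (NSub M L g) (NSub M' L g)
with cstep : cmd -> cmd -> Prop :=
| cst_ren b C : cstep (Nam b (Mu C)) (cren idr (scons b idr) C)
  (* [st_mu_n] for a substitution attached to the command below the mu, which
     is where [st_mu] puts it *)
| cst_n M N g : cstep (CNSub (Nam 0 M) N g) (Nam g (App (NSub M N g) N))
| cst_nam b M M' : step M M' -> cstep (Nam b M) (Nam b M')
| cst_tsub C C' L : cstep C C' -> cstep (CTSub C L) (CTSub C' L)
| cst_nsub C C' L g : cstep C C' -> cstep (CNSub C L g) (CNSub C' L g).

Definition wxh (M N : tm) : Prop :=
  exists M' N', scong M M' /\ step M' N' /\ scong N' N.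

Definition wxhs : relation tm := clos_refl_trans tm wxh.

Definition wxh_normal (M : tm) : Prop := forall M', ~ wxh M M'.

Definition has_wxhnf (M : tm) : Prop :=
  exists M', wxhs M M' /\ wxh_normal M'.

(** ** The induced equivalence *)

Inductive esub : Type :=
| ET (N : tm)
| EN (N : tm) (g : nat).

(* M sigma; the head of the list is the innermost substitution. *)
Fixpoint subs (M : tm) (s : list esub) : tm :=
  match s with
  | [] => M
  | ET N :: s => subs (TSub M N) s
  | EN N g :: s => subs (NSub M N g) s
  end.

(* [outv s x], [outn s a]: the index, below [s], of the variable x or name a
   of the context of [s]. In particular it is not bound by [s]. *)
Fixpoint outv (s : list esub) (x : nat) : nat :=
  match s with
  | [] => x
  | ET _ :: s => S (outv s x)
  | EN _ _ :: s => outv s x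
  end.

Fixpoint outn (s : list esub) (a : nat) : nat :=
  match s with
  | [] => a
  | ET _ :: s => outn s a
  | EN _ _ :: s => S (outn s a)
  end.

(* For (\x.M) sigma: the term M sigma with x (index 0) free in it, so that the
   binder x has to be moved across those of sigma. *)
Fixpoint lam_subs (M : tm) (s : list esub) : tm :=
  match s with
  | [] => M
  | ET N :: s => lam_subs (TSub (ren swap01 idr M) (shiftv N)) s
  | EN N g :: s => lam_subs (NSub M (shiftv N) g) s
  end.

(* The same for (mu alpha.[b]M) sigma. *)
Fixpoint mu_subs (M : tm) (s : list esub) : tm :=
  match s with
  | [] => M
  | ET N :: s => mu_subs (TSub M (shiftn N)) s
  | EN N g :: s => mu_subs (NSub (ren idr swap01 M) (shiftn N) (S g)) s
  end.

(* [b] counted below the mu alone; the result counts it below the mu and [s]. *)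
Definition mu_outn (s : list esub) (b : nat) : nat := upr (outn s) b.

Definition wxh_nf_of (M M' : tm) (s : list esub) : Prop :=
  exists P, wxhs M P /\ wxh_normal P /\ scong P (subs M' s).

Definition apps (M : tm) (Ms : list tm) : tm := fold_left App Ms M.

Definition wxh_clause (R : relation tm) (M N : tm) : Prop :=
  (~ has_wxhnf M /\ ~ has_wxhnf N) \/
  (exists M' s N' s', wxh_nf_of M M' s /\ wxh_nf_of N N' s' /\
    ((exists x Ms Ns,
        M' = apps (Var (outv s x)) Ms /\ N' = apps (Var (outv s' x)) Ns /\
        Forall2 (fun Mi Ni => R (subs Mi s) (subs Ni s')) Ms Ns)
     \/ (exists M'' N'', M' = Lam M'' /\ N' = Lam N'' /\
           R (lam_subs M'' s) (lam_subs N'' s'))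
     \/ (exists b M'' N'',
           M' = Mu (Nam (mu_outn s b) M'') /\
           N' = Mu (Nam (mu_outn s' b) N'') /\
           R (mu_subs M'' s) (mu_subs N'' s')))).

Definition wxh_equiv : relation tm := largest_symmetric wxh_clause.

(* Main.v *)
(* A pure term M, read as the command [0]M under a fresh mu, has a head triple
   (name, head, arguments) in which all mu-redexes, renamings and eta-redexes
   are resolved ([hdt]).  Weak head steps other than beta leave the head triple
   unchanged and beta acts on it deterministically ([bt]); so M has a whnf iff
   [bt] terminates on its triple, and the wh-normal form is determined by the
   final triple.  Unfolding the explicit substitutions ([tr]) makes every
   explicit step the identity or a [bt] step on head triples, which gives one
   half of the comparison.

   For the other half, explicit normal forms are characterised by a predicate
   [NF] on terms that is invariant under collecting substitutions.  It shows
   that they unfold to wh-normal forms.  Conversely, if [bt] terminates on the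
   unfolding then a normal form exists: in a state "pure head in an evaluation
   context" the non-beta steps can be organised so that the number of
   substitutions to the right of the one for the head variable decreases.  Both
   equivalences can then be transported along [tr]. *)

(* The obstacle on the pure side is that [wh] is not deterministic: eta, renaming and mu overlap.
   For instance [(mu a.[a]M) N], with a not in M, goes to [M N] by eta and to [mu g.[g](M N)] by mu.
   Reading a term under a fresh mu turns mu, renaming and eta into equations between substitutions
   for names, so a single composition law does the work of a confluence proof.

   On the explicit side it is enough to find one normal form. Neither termination of the non-beta
   steps nor uniqueness of explicit normal forms is claimed: any normal form unfolds to the unique
   wh-normal form of the unfolding, and that is all the clauses of the equivalence observe.

   The terms compared after the first round, such as [subs Mi s], are no longer pure. The
   coinductive relations are therefore built on the class [sp], which is closed under reduction and
   under the passage to subterms in the clauses. *)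
From Stdlib Require Import List Relations Lia Arith FunctionalExtensionality Classical.
Require Import Defs.
Import ListNotations.

(** * Simultaneous substitution for variables and names *)

(* Sending the name a to (g, [N1; ..; Nk]) replaces [a]P by [g](P' N1 .. Nk).
   With lists instead of options, these substitutions compose. *)
Definition nsubst : Type := nat -> nat * list lm.
Definition idt : nsubst := fun a => (a, []).
Definition upvs (s : nat -> lm) := scons (LVar 0) (fun n => lshiftv (s n)).
Definition upvt (t : nsubst) : nsubst := fun a => (fst (t a), map lshiftv (snd (t a))).
Definition upnt (t : nsubst) : nsubst :=
  scons (0, []) (fun a => (S (fst (t a)), map lshiftn (snd (t a)))).

(** Variable substitution, structural substitution and renaming are all instances ([lsubst_gs],
    [lstruct_gs], [gs_ren]), so [gs_gs] replaces their mixed commutation lemmas. *)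
Fixpoint gs (s : nat -> lm) (t : nsubst) (M : lm) : lm :=
  match M with
  | LVar x => s x
  | LLam P => LLam (gs (upvs s) (upvt t) P)
  | LApp P Q => LApp (gs s t P) (gs s t Q)
  | LMu b P =>
      LMu (fst (upnt t b))
          (lapps (gs (fun n => lshiftn (s n)) (upnt t) P) (snd (upnt t b)))
  end.

Ltac fext := let x := fresh "x" in apply functional_extensionality; intro x.
Ltac fcase := let x := fresh "x" in
  apply functional_extensionality; intros [|x]; simpl.

Lemma upr_comp f g : (fun n => upr f (upr g n)) = upr (fun n => f (g n)).
Proof. fcase; reflexivity. Qed.

Lemma upr_id : upr (fun n => n) = fun n => n.
Proof. fcase; reflexivity. Qed.

Lemma lren_lren M : forall f g f' g',
  lren f g (lren f' g' M) = lren (fun n => f (f' n)) (fun n => g (g' n)) M.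
Proof.
  induction M; intros; simpl; f_equal; auto.
  - rewrite IHM, upr_comp. reflexivity.
  - apply (equal_f (upr_comp g g')).
  - rewrite IHM, upr_comp. reflexivity.
Qed.

Lemma lren_id M : lren (fun n => n) (fun n => n) M = M.
Proof. induction M; simpl; rewrite ?upr_id; congruence. Qed.

Lemma lapps_app M l l' : lapps M (l ++ l') = lapps (lapps M l) l'.
Proof. apply fold_left_app. Qed.

Lemma lren_lapps f g l : forall M,
  lren f g (lapps M l) = lapps (lren f g M) (map (lren f g) l).
Proof. induction l; simpl; intros; auto. Qed.

Lemma gs_lapps s t l : forall M,
  gs s t (lapps M l) = lapps (gs s t M) (map (gs s t) l).
Proof. induction l; simpl; intros; auto. Qed.

Lemma upnt_upr t g : (fun a => upnt t (upr g a)) = upnt (fun a => t (g a)).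
Proof. fcase; reflexivity. Qed.

Lemma gs_lren M : forall s t f g,
  gs s t (lren f g M) = gs (fun x => s (f x)) (fun a => t (g a)) M.
Proof.
  induction M; intros; simpl; auto.
  - f_equal. rewrite IHM. f_equal. fcase; reflexivity.
  - f_equal; auto.
  - rewrite IHM, upnt_upr.
    change (upnt t (upr g b)) with ((fun a => upnt t (upr g a)) b).
    rewrite upnt_upr. reflexivity.
Qed.

Definition rent (f g : nat -> nat) (t : nsubst) : nsubst :=
  fun a => (g (fst (t a)), map (lren f g) (snd (t a))).

Lemma lren_gs M : forall s t f g,
  lren f g (gs s t M) = gs (fun x => lren f g (s x)) (rent f g t) M.
Proof.
  induction M; intros; simpl; auto.
  - f_equal. rewrite IHM. f_equal.
    + fcase; auto. unfold lshiftv. rewrite !lren_lren. reflexivity.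
    + fext. unfold rent, upvt; simpl. f_equal. rewrite !map_map.
      apply map_ext; intro. unfold lshiftv. rewrite !lren_lren. reflexivity.
  - f_equal; auto.
  - assert (E : rent f (upr g) (upnt t) = upnt (rent f g t)).
    { fcase; auto. unfold rent; simpl. f_equal. rewrite !map_map.
      apply map_ext; intro. unfold lshiftn. rewrite !lren_lren. reflexivity. }
    rewrite lren_lapps, IHM. rewrite <- E. f_equal.
    f_equal. f_equal. fext. unfold lshiftn. rewrite !lren_lren. reflexivity.
Qed.

(** The argument lists concatenate: [t] supplies its arguments first, [t'] then acts on them and
    appends those it holds for the new name. *)
Definition compt (s : nat -> lm) (t t' : nsubst) : nsubst :=
  fun a => (fst (t' (fst (t a))), map (gs s t') (snd (t a)) ++ snd (t' (fst (t a)))).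

Lemma gs_gs M : forall s t s' t',
  gs s' t' (gs s t M) = gs (fun x => gs s' t' (s x)) (compt s' t t') M.
Proof.
  induction M; intros; simpl; auto.
  - f_equal. rewrite IHM. f_equal.
    + fcase; auto. unfold lshiftv. rewrite gs_lren, lren_gs. f_equal.
    + fext. unfold compt, upvt; simpl. f_equal.
      rewrite map_app, !map_map. f_equal. apply map_ext; intro.
      unfold lshiftv. rewrite gs_lren, lren_gs. f_equal.
  - f_equal; auto.
  - assert (E : compt (fun n => lshiftn (s' n)) (upnt t) (upnt t') =
                upnt (compt s' t t')).
    { fcase; auto. unfold compt; simpl. f_equal.
      rewrite map_app, !map_map. f_equal. apply map_ext; intro.
      unfold lshiftn. rewrite gs_lren, lren_gs. f_equal. }
    rewrite <- E, gs_lapps, <- lapps_app, IHM. simpl. f_equal. f_equal. f_equal.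
    fext. unfold lshiftn. rewrite gs_lren, lren_gs. f_equal.
Qed.

Lemma gs_ren M : forall f g,
  gs (fun x => LVar (f x)) (fun a => (g a, [])) M = lren f g M.
Proof.
  induction M; intros; simpl; auto.
  - f_equal. rewrite <- IHM. f_equal. fcase; reflexivity.
  - f_equal; auto.
  - assert (E : upnt (fun a => (g a, [])) = fun a => (upr g a, []))
      by (fcase; reflexivity).
    rewrite E; simpl. f_equal. apply IHM.
Qed.

Lemma gs_id M : gs LVar idt M = M.
Proof. rewrite <- (lren_id M) at 2. rewrite <- gs_ren. reflexivity. Qed.

Lemma lsubst_gs M : forall s, lsubst s M = gs s idt M.
Proof.
  induction M; intros; simpl; auto.
  - f_equal. rewrite IHM. reflexivity.
  - f_equal; auto.
  - assert (E : upnt idt = idt) by (fcase; reflexivity).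
    rewrite E; simpl. f_equal. apply IHM.
Qed.

Definition nst (t : ssubst) : nsubst :=
  fun a => (fst (t a), match snd (t a) with Some N => [N] | None => [] end).

Lemma lstruct_gs M : forall t, lstruct t M = gs LVar (nst t) M.
Proof.
  induction M; intros; simpl; auto.
  - f_equal. rewrite IHM. f_equal.
    + fcase; reflexivity.
    + fext. unfold nst, upvt, smap; simpl. destruct (snd (t x)); reflexivity.
  - f_equal; auto.
  - set (t' := scons _ _). unfold smu.
    assert (E : nst t' = upnt (nst t)).
    { fcase; auto. unfold nst, smap; simpl. destruct (snd (t x)); reflexivity. }
    rewrite IHM, E, <- E. unfold nst at 3 4. simpl.
    destruct (t' b) as [g [N|]]; reflexivity.
Qed.

(** * Head triples *)

Definition triple : Type := (nat * lm * list lm)%type.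

(** Acting on names only leaves a value at the head a value, so no new head has to be computed.
    Substitution for variables is the task of [sact]. *)
Definition tact (t : nsubst) (T : triple) : triple :=
  let '(b, h, l) := T in
  (fst (t b), gs LVar t h, map (gs LVar t) l ++ snd (t b)).

(* [push Q] supplies the argument [Q] to the top name 0, [plug b l] plugs the
   stack [l] and the name [b] in for it. *)
Definition push (Q : lm) : nsubst := scons (0, [lshiftn Q]) (fun a => (S a, [])).
Definition plug (b : nat) (l : list lm) : nsubst := scons (b, l) idt.

(* In a triple, name 0 is the fresh top name and the names of [M] are shifted. *)
Fixpoint hdt (M : lm) : triple :=
  match M with
  | LVar x => (0, LVar x, [])
  | LLam P => (0, lshiftn (LLam P), [])
  | LApp P Q => tact (push Q) (hdt P)
  | LMu c P => tact (plug c []) (hdt P)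
  end.

Definition value (M : lm) : Prop :=
  match M with LVar _ | LLam _ => True | _ => False end.

Definition vtriple (T : triple) : Prop := value (snd (fst T)).

Lemma vtriple_tact t T : vtriple T -> vtriple (tact t T).
Proof. destruct T as [[b h] l]; unfold vtriple; simpl. destruct h; simpl; auto. Qed.

Lemma vtriple_H M : vtriple (hdt M).
Proof. induction M; simpl; try exact I; apply vtriple_tact; auto. Qed.

Lemma gsL_gs s t t' h :
  gs s t' (gs LVar t h) = gs s (compt s t t') h.
Proof. apply gs_gs. Qed.

Lemma tact_tact t t' T : tact t' (tact t T) = tact (compt LVar t t') T.
Proof.
  destruct T as [[b h] l]; unfold tact. rewrite gsL_gs.
  f_equal. rewrite map_app, <- app_assoc, map_map. f_equal.
  apply map_ext; intro; apply gsL_gs.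
Qed.

Lemma tact_id T : tact idt T = T.
Proof.
  destruct T as [[b h] l]; unfold tact. rewrite gs_id; simpl.
  rewrite app_nil_r. f_equal. rewrite <- (map_id l) at 2.
  apply map_ext, gs_id.
Qed.

Lemma gsL_lshiftn t N :
  gs LVar (upnt t) (lshiftn N) = lshiftn (gs LVar t N).
Proof. unfold lshiftn. rewrite gs_lren, lren_gs. reflexivity. Qed.

Lemma gs_lshiftn s b l N : gs s (scons (b,l) idt) (lshiftn N) = gs s idt N.
Proof. unfold lshiftn. rewrite gs_lren. reflexivity. Qed.

Lemma gs_plug_shift b l N : gs LVar (plug b l) (lshiftn N) = N.
Proof. unfold plug. rewrite gs_lshiftn. apply gs_id. Qed.

Lemma gs_push_shift Q N : gs LVar (push Q) (lshiftn N) = lshiftn N.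
Proof.
  unfold lshiftn. rewrite gs_lren. unfold push; simpl.
  apply (gs_ren N idr S).
Qed.

Lemma hdt_lapps l : forall c N,
  tact (plug c []) (hdt (lapps N l)) = tact (plug c l) (hdt N).
Proof.
  induction l as [|Q l IH]; intros; auto.
  simpl lapps. rewrite IH. simpl. rewrite tact_tact. f_equal.
  fcase; unfold compt; simpl.
  - rewrite gs_plug_shift. reflexivity.
  - reflexivity.
Qed.

Lemma hdt_gsL M : forall t, hdt (gs LVar t M) = tact (upnt t) (hdt M).
Proof.
  induction M; intros.
  - reflexivity.
  - change (gs LVar t (LLam M)) with (LLam (gs (upvs LVar) (upvt t) M)).
    simpl hdt. unfold tact.
    change (LLam (lren (upr idr) S M)) with (lshiftn (LLam M)).
    rewrite gsL_lshiftn. reflexivity.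
  - simpl. rewrite IHM1, !tact_tact. f_equal. fcase; unfold compt; simpl.
    + rewrite gsL_lshiftn. reflexivity.
    + f_equal. rewrite map_map, !app_nil_r. apply map_ext; intro.
      apply gs_push_shift.
  - simpl. rewrite hdt_lapps.
    change (fun n => lshiftn (LVar n)) with LVar.
    rewrite IHM, !tact_tact. f_equal. fcase; unfold compt; simpl.
    + reflexivity.
    + destruct (upnt t x) as [g l]; simpl. rewrite !app_nil_r. f_equal.
      rewrite map_map. rewrite <- (map_id l) at 2. apply map_ext; intro.
      apply gs_plug_shift.
Qed.

(** A variable at the head may be replaced by an arbitrary term, so the head triple of the new head
    is computed and the stack is plugged into it. *)
Definition sact (s : nat -> lm) (t : nsubst) (T : triple) : triple :=
  let '(b, h, l) := T in
  tact (plug (fst (t b)) (map (gs s t) l ++ snd (t b))) (hdt (gs s t h)).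

Lemma hdt_lam P : hdt (LLam P) = (0, lshiftn (LLam P), []).
Proof. reflexivity. Qed.

Lemma gs_lam s t P : gs s t (LLam P) = LLam (gs (upvs s) (upvt t) P).
Proof. reflexivity. Qed.

Lemma sact_lam s t b P l :
  sact s t (b, LLam P, l) = (fst (t b), gs s t (LLam P), map (gs s t) l ++ snd (t b)).
Proof.
  unfold sact. rewrite gs_lam, hdt_lam. unfold tact.
  rewrite gs_plug_shift. reflexivity.
Qed.

(** For a value head the recomputation in [sact] changes nothing when variables are fixed. This lets
    [bt_tact] follow from [bt_sact]. *)
Lemma tact_sact t T : vtriple T -> tact t T = sact LVar t T.
Proof.
  destruct T as [[b h] l]; unfold vtriple; simpl fst; simpl snd.
  destruct h; simpl value; intros V; try contradiction.
  - reflexivity.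
  - rewrite sact_lam. reflexivity.
Qed.

Lemma tact_sact_comp s t t' T : vtriple T ->
  tact t' (sact s t T) = sact (fun x => gs LVar t' (s x)) (compt LVar t t') T.
Proof.
  destruct T as [[b h] l]; unfold vtriple; destruct h; simpl fst; simpl snd;
    simpl value; intros V; try contradiction.
  - unfold sact. simpl gs. rewrite hdt_gsL, !tact_tact. f_equal.
    fcase; unfold compt; simpl.
    + f_equal. rewrite map_app, map_map, <- app_assoc. f_equal.
      apply map_ext; intro. rewrite gs_gs. reflexivity.
    + destruct (t' x0) as [g m]; simpl. rewrite app_nil_r. f_equal.
      rewrite map_map. rewrite <- (map_id m) at 1. apply map_ext; intro.
      symmetry; apply gs_plug_shift.
  - rewrite !sact_lam. unfold tact. rewrite gs_gs. f_equal.
    rewrite map_app, map_map, <- app_assoc. simpl. f_equal.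
    apply map_ext; intro. rewrite gs_gs. reflexivity.
Qed.

Lemma sact_tact_comp s t t' T : vtriple T ->
  sact s t' (tact t T) = sact s (compt s t t') T.
Proof.
  destruct T as [[b h] l]; unfold vtriple.
  assert (E : map (gs s t') (map (gs LVar t) l ++ snd (t b)) ++ snd (t' (fst (t b)))
    = map (gs s (compt s t t')) l ++ snd (compt s t t' b)).
  { rewrite map_app, map_map, <- app_assoc. unfold compt; simpl. f_equal.
    apply map_ext; intro. rewrite gs_gs. reflexivity. }
  destruct h; simpl fst; simpl snd; simpl value; intros V; try contradiction.
  - unfold sact, tact. rewrite E. reflexivity.
  - unfold tact. rewrite gs_lam, !sact_lam, E. f_equal. f_equal.
    rewrite <- gs_lam, gs_gs. reflexivity.
Qed.

Lemma gs_LVar_shiftn s t Q :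
  gs (fun n => lshiftn (s n)) (upnt t) (lshiftn Q) = lshiftn (gs s t Q).
Proof. unfold lshiftn. rewrite gs_lren, lren_gs. reflexivity. Qed.

(** The triple of a substituted term depends on the original term only through its triple. Hence
    steps below an explicit substitution can be followed on triples after unfolding. *)
Lemma hdt_gs M : forall s t,
  hdt (gs s t M) = sact (fun x => lshiftn (s x)) (upnt t) (hdt M).
Proof.
  induction M; intros.
  - simpl. unfold lshiftn. rewrite <- gs_ren, hdt_gsL, tact_tact.
    rewrite <- (tact_id (hdt (s x))) at 1. f_equal. fcase; reflexivity.
  - rewrite hdt_lam. change (lshiftn (LLam M)) with (LLam (lren (upr idr) S M)).
    rewrite sact_lam. change (LLam (lren (upr idr) S M)) with (lshiftn (LLam M)).
    rewrite gs_LVar_shiftn, gs_lam, hdt_lam. reflexivity.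
  - simpl hdt. rewrite IHM1, tact_sact_comp, sact_tact_comp by apply vtriple_H.
    f_equal.
    + fext. apply gs_push_shift.
    + fcase; unfold compt; simpl.
      * rewrite gs_LVar_shiftn. reflexivity.
      * f_equal. rewrite map_map, !app_nil_r. apply map_ext; intro.
        apply gs_push_shift.
  - simpl gs. simpl hdt. rewrite hdt_lapps, IHM, tact_sact_comp, sact_tact_comp
      by apply vtriple_H.
    f_equal.
    + fext. apply gs_plug_shift.
    + fcase; unfold compt; simpl.
      * reflexivity.
      * destruct (upnt t x) as [g l]; simpl. rewrite !app_nil_r. f_equal.
        rewrite map_map. rewrite <- (map_id l) at 2. apply map_ext; intro.
        apply gs_plug_shift.
Qed.

(** * Beta reduction of head triples *)

(** The contracted body may begin with applications or mus, so its triple is computed afresh;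
    plugging in [b] and [l] restores the command that the redex was the head of. *)
Inductive bt : triple -> triple -> Prop :=
| bt_beta b P Q l :
    bt (b, LLam P, Q :: l) (tact (plug b l) (hdt (gs (scons Q LVar) idt P))).

Lemma bt_vtriple T T' : bt T T' -> vtriple T /\ vtriple T'.
Proof. intros []; split; [exact I|]. apply vtriple_tact, vtriple_H. Qed.

Lemma gs_beta s t P Q :
  gs (scons (gs s t Q) LVar) idt (gs (upvs s) (upvt t) P) =
  gs s t (gs (scons Q LVar) idt P).
Proof.
  rewrite !gs_gs. f_equal.
  - fcase; auto. unfold lshiftv. rewrite gs_lren. apply gs_id.
  - fext. unfold compt; simpl. rewrite app_nil_r. destruct (t x) as [g m]; simpl.
    f_equal. rewrite map_map. rewrite <- (map_id m) at 2. apply map_ext; intro.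
    unfold lshiftv. rewrite gs_lren. apply gs_id.
Qed.

(** An abstraction at the head stays one under substitution, and the appended arguments come after
    the one that is consumed; the rest is the substitution lemma [gs_beta]. *)
Lemma bt_sact s t T T' : bt T T' -> bt (sact s t T) (sact s t T').
Proof.
  intros [b P Q l]. rewrite sact_lam, gs_lam. simpl map. simpl app.
  rewrite sact_tact_comp by apply vtriple_H.
  match goal with |- bt _ ?X => replace X with
    (tact (plug (fst (t b)) (map (gs s t) l ++ snd (t b)))
       (hdt (gs (scons (gs s t Q) LVar) idt (gs (upvs s) (upvt t) P)))) end.
  { constructor. }
  rewrite gs_beta, hdt_gs, tact_sact_comp by apply vtriple_H. f_equal.
  - fext. apply gs_plug_shift.
  - fcase; unfold compt; simpl.
    + reflexivity.
    + destruct (t x) as [g m]; simpl. rewrite app_nil_r. f_equal.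
      rewrite map_map. rewrite <- (map_id m) at 2. apply map_ext; intro.
      apply gs_plug_shift.
Qed.

Lemma bt_tact t T T' : bt T T' -> bt (tact t T) (tact t T').
Proof.
  intros B. destruct (bt_vtriple _ _ B). rewrite !tact_sact by auto.
  apply bt_sact; auto.
Qed.

Lemma bt_det T T1 T2 : bt T T1 -> bt T T2 -> T1 = T2.
Proof. intros [] B2. inversion B2; reflexivity. Qed.

Definition bts := clos_refl_trans triple bt.
Definition bt0 T T' := T = T' \/ bt T T'.

Lemma tact_plug0 T : tact (plug 0 []) (tact (upnt (fun a => (S a, []))) T) = T.
Proof. rewrite tact_tact. rewrite <- (tact_id T) at 2. f_equal. fcase; reflexivity. Qed.

(** Plugging the top name into itself undoes the shift. The left-hand side is the triple of
    [LMu 0 (lshiftn M)], so this is the eta rule on triples. *)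
Lemma hdt_shift M : tact (plug 0 []) (hdt (lshiftn M)) = hdt M.
Proof.
  unfold lshiftn. rewrite <- gs_ren, hdt_gsL. apply tact_plug0.
Qed.

Lemma nst_push N : nst (push_arg N) = push N.
Proof. fcase; reflexivity. Qed.

Lemma hdt_smu t b M : hdt (smu t b M) = tact (plug (fst (nst t b)) (snd (nst t b))) (hdt M).
Proof.
  unfold smu, nst. destruct (t b) as [g [N|]]; simpl; auto.
  rewrite tact_tact. f_equal. fcase; unfold compt; simpl; auto.
  rewrite gs_plug_shift. reflexivity.
Qed.

Lemma lshiftn_beta Q P :
  lshiftn (gs (scons Q LVar) idt P) =
  gs (scons (lshiftn Q) LVar) idt (lren (upr idr) S P).
Proof.
  unfold lshiftn. rewrite gs_lren, lren_gs. f_equal. fcase; reflexivity.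
Qed.

Lemma bt_hdt_beta P Q : bt (hdt (LApp (LLam P) Q)) (hdt (gs (scons Q LVar) idt P)).
Proof.
  change (hdt (LApp (LLam P) Q)) with (tact (push Q) (0, lshiftn (LLam P), [])).
  unfold tact. rewrite gs_push_shift.
  replace (hdt (gs _ _ _)) with
    (tact (plug 0 []) (hdt (gs (scons (lshiftn Q) LVar) idt (lren (upr idr) S P)))).
  - apply bt_beta.
  - rewrite <- (hdt_shift (gs (scons Q LVar) idt P)), lshiftn_beta. reflexivity.
Qed.

Lemma wh_bt M M' : wh M M' -> bt0 (hdt M) (hdt M').
Proof.
  induction 1.
  - right. rewrite lsubst_gs. apply bt_hdt_beta.
  - left. rewrite hdt_smu, lstruct_gs, nst_push, hdt_gsL. simpl hdt.
    rewrite !tact_tact. f_equal. fcase; unfold compt; simpl.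
    + reflexivity.
    + destruct x; simpl; rewrite ?gs_plug_shift; reflexivity.
  - left. simpl. rewrite <- gs_ren, hdt_gsL, !tact_tact. f_equal.
    fcase; unfold compt; simpl.
    + destruct a; reflexivity.
    + destruct b, x; reflexivity.
  - left. simpl. apply hdt_shift.
  - simpl. destruct IHwh as [->|]; [left|right; apply bt_tact]; auto.
  - simpl. destruct IHwh as [->|]; [left|right; apply bt_tact]; auto.
Qed.

(** * Realising head triples by weak head reduction *)

Lemma whs_app M M' N : whs M M' -> whs (LApp M N) (LApp M' N).
Proof.
  induction 1; [apply rt_step; constructor; auto|apply rt_refl|].
  eapply rt_trans; eauto.
Qed.

Lemma whs_mu b M M' : whs M M' -> whs (LMu b M) (LMu b M').
Proof.
  induction 1; [apply rt_step; constructor; auto|apply rt_refl|].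
  eapply rt_trans; eauto.
Qed.

Lemma wh_lapps l : forall M M', wh M M' -> wh (lapps M l) (lapps M' l).
Proof. induction l; simpl; auto. intros; apply IHl; constructor; auto. Qed.

Lemma whs_bts M M' : whs M M' -> bts (hdt M) (hdt M').
Proof.
  induction 1.
  - destruct (wh_bt _ _ H) as [->|]; [apply rt_refl|apply rt_step; auto].
  - apply rt_refl.
  - eapply rt_trans; eauto.
Qed.

Lemma smu_nst t b M : smu t b M = LMu (fst (nst t b)) (lapps M (snd (nst t b))).
Proof. unfold smu, nst. destruct (t b) as [g [N|]]; reflexivity. Qed.

Lemma lshiftn_lapps h l : lshiftn (lapps h l) = lapps (lshiftn h) (map lshiftn l).
Proof. apply lren_lapps. Qed.

(** The triple always pretends that there is an outer mu. The first case is that of a term without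
    one at its head: no reduction creates the mu, but then the triple is just the shifted term.
    Otherwise the mu rule moves arguments inward, renaming merges nested mus, and a single mu
    remains. *)
Lemma whs_head M : forall b h l, hdt M = (b, h, l) ->
  (exists h' l', value h' /\ M = lapps h' l' /\ b = 0 /\ h = lshiftn h' /\
     l = map lshiftn l') \/ whs M (LMu b (lapps h l)).
Proof.
  induction M; intros b0 h l E.
  - left. exists (LVar x), []. inversion E; subst. simpl; auto.
  - left. exists (LLam M), []. inversion E; subst. simpl; auto.
  - simpl in E. destruct (hdt M1) as [[b1 h1] l1] eqn:E1. simpl in E.
    destruct (IHM1 _ _ _ eq_refl) as [(h'&l'&V&->&->&->&->)|W].
    + left. exists h', (l' ++ [M2]). rewrite lapps_app. inversion E; subst.
      rewrite gs_push_shift, map_app, map_map. repeat split; auto.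
      f_equal. apply map_ext; intro; apply gs_push_shift.
    + right. inversion E; subst.
      eapply rt_trans; [apply whs_app; eauto|].
      eapply rt_trans; [apply rt_step, wh_mu|].
      rewrite smu_nst, nst_push, lstruct_gs, nst_push, gs_lapps, lapps_app.
      apply rt_refl.
  - simpl in E. destruct (hdt M) as [[b1 h1] l1] eqn:E1. simpl in E.
    right. destruct (IHM _ _ _ eq_refl) as [(h'&l'&V&->&->&->&->)|W].
    + inversion E; subst. rewrite gs_plug_shift, app_nil_r, map_map.
      rewrite (map_ext _ (fun x => x)) by (intro; apply gs_plug_shift).
      rewrite map_id. apply rt_refl.
    + inversion E; subst.
      eapply rt_trans; [apply whs_mu; eauto|].
      eapply rt_trans; [apply rt_step, wh_ren|].
      rewrite lren_lapps.
      replace (lren idr (scons b idr)) with (gs LVar (plug b [])).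
      2:{ fext. rewrite <- gs_ren. f_equal. fcase; reflexivity. }
      destruct b1; simpl; rewrite app_nil_r; apply rt_refl.
Qed.

Definition body (T : triple) : lm := let '(_, h, l) := T in lapps h l.
Definition etable (T : triple) (W : lm) : Prop :=
  fst (fst T) = 0 /\ body T = lshiftn W.
(** The triple read back as a mu, with the outer eta-redex contracted if there is one. *)
Definition reifies (T : triple) (W : lm) : Prop :=
  etable T W \/ ((forall X, ~ etable T X) /\ W = LMu (fst (fst T)) (body T)).

Lemma lshiftn_inj M N : lshiftn M = lshiftn N -> M = N.
Proof.
  intros E. rewrite <- (gs_plug_shift 0 [] M), <- (gs_plug_shift 0 [] N).
  congruence.
Qed.

Lemma reifies_ex T : exists W, reifies T W.
Proof.
  destruct (classic (exists W, etable T W)) as [[W E]|N].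
  - exists W; left; auto.
  - exists (LMu (fst (fst T)) (body T)). right; split; eauto.
Qed.

Lemma reifies_fun T W W' : reifies T W -> reifies T W' -> W = W'.
Proof.
  intros [E|[E ->]] [E'|[E' ->]].
  - apply lshiftn_inj. destruct E, E'. congruence.
  - destruct (E' _ E).
  - destruct (E _ E').
  - auto.
Qed.

Lemma whs_reifies M W : reifies (hdt M) W -> whs M W.
Proof.
  destruct (hdt M) as [[b h] l] eqn:E. intros R.
  destruct (whs_head M _ _ _ E) as [(h'&l'&V&->&->&->&->)|K].
  - destruct R as [[_ R]|[N _]].
    + simpl in R. rewrite <- lshiftn_lapps in R. apply lshiftn_inj in R.
      subst; apply rt_refl.
    + destruct (N (lapps h' l')). split; auto. simpl. symmetry; apply lshiftn_lapps.
  - eapply rt_trans; [exact K|]. destruct R as [[R1 R2]|[N ->]].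
    + simpl in R1, R2. subst. rewrite R2. apply rt_step, wh_eta.
    + apply rt_refl.
Qed.

Lemma wh_normal_whs W W' : wh_normal W -> whs W W' -> W' = W.
Proof.
  intros N S. apply clos_rt_rt1n in S. destruct S; auto. destruct (N _ H).
Qed.

Lemma wh_normal_reifies W : wh_normal W -> reifies (hdt W) W.
Proof.
  intros N. destruct (reifies_ex (hdt W)) as [X R].
  rewrite <- (wh_normal_whs W X N (whs_reifies _ _ R)) at 2. auto.
Qed.

(** Together with determinism of [bt] this stands in for confluence of [wh]: it reduces uniqueness
    of normal forms to uniqueness of normal triples. *)
Lemma wh_normal_hdt_inj W W' : wh_normal W -> wh_normal W' -> hdt W = hdt W' -> W = W'.
Proof.
  intros N N' E. apply wh_normal_reifies in N, N'. rewrite E in N.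
  eapply reifies_fun; eauto.
Qed.

(** The redex seen in the triple may be hidden behind mus in the term; [whs_head] brings it to the
    surface, where beta contracts it. *)
Lemma whs_bt M T' : bt (hdt M) T' -> exists M', whs M M' /\ hdt M' = T'.
Proof.
  intros B. destruct (hdt M) as [[b h] l] eqn:E.
  inversion B; subst.
  destruct (whs_head M _ _ _ E) as [(h'&l'&V&->&->&Eh&El)|K].
  - destruct h'; try contradiction; try discriminate Eh.
    destruct l' as [|Q' l']; try discriminate El.
    exists (lapps (lsubst (scons Q' LVar) h') l').
    split.
    + apply rt_step. simpl. apply wh_lapps. constructor.
    + rewrite <- hdt_shift, lshiftn_lapps, lsubst_gs, lshiftn_beta, hdt_lapps.
      inversion Eh; inversion El; subst. reflexivity.
  - exists (LMu b (lapps (gs (scons Q LVar) idt P) l0)). split.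
    + eapply rt_trans; [exact K|]. apply rt_step. constructor. simpl.
      apply wh_lapps. rewrite <- lsubst_gs. constructor.
    + simpl. apply hdt_lapps.
Qed.

(** * Occurrences of free variables and names in pure terms *)

(* [k = true] for variables and [k = false] for names. *)
Definition bindv (k : bool) (n : nat) := if k then S n else n.
Definition bindn (k : bool) (n : nat) := if k then n else S n.

Fixpoint locc (k : bool) (n : nat) (M : lm) : Prop :=
  match M with
  | LVar x => k = true /\ n = x
  | LLam P => locc k (bindv k n) P
  | LApp P Q => locc k n P \/ locc k n Q
  | LMu b P => k = false /\ b = S n \/ locc k (bindn k n) P
  end.

Lemma lfn_locc M : forall a, lfn a M <-> locc false a M.
Proof.
  induction M; intros; simpl.
  - split; [tauto|intros []; discriminate].
  - apply IHM.
  - rewrite IHM1, IHM2; tauto.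
  - rewrite IHM; tauto.
Qed.

Lemma locc_lapps_hd k n l : forall M, locc k n M -> locc k n (lapps M l).
Proof. induction l; simpl; auto. intros; apply IHl; left; auto. Qed.

Lemma locc_lapps_arg k n l : forall M N,
  In N l -> locc k n N -> locc k n (lapps M l).
Proof.
  induction l; simpl; [tauto|]. intros M N [->|I] O; eauto.
  apply locc_lapps_hd; right; auto.
Qed.

Lemma locc_ren M : forall k n f g,
  locc k n M -> locc k (if k then f n else g n) (lren f g M).
Proof.
  induction M; simpl; intros k n f g O.
  - destruct O as [-> ->]; auto.
  - apply IHM with (f := upr f) (g := g) in O. destruct k; auto.
  - destruct O; auto.
  - destruct O as [[-> ->]|O]; auto.
    apply IHM with (f := f) (g := upr g) in O. destruct k; auto.
Qed.

Lemma locc_gs M : forall k n s t,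
  ((exists x, locc true x M /\ locc k n (s x)) \/
   (exists c, locc false c M /\
      (k = false /\ n = fst (t c) \/ exists N, In N (snd (t c)) /\ locc k n N))) ->
  locc k n (gs s t M).
Proof.
  induction M; intros k n s t O.
  - simpl in *. destruct O as [(y&[_ ->]&O)|(c&[]&_)]; [auto|discriminate].
  - simpl. apply IHM. destruct O as [(y&Oy&O)|(c&Oc&O)]; simpl in *.
    + left. exists (S y); split; auto.
      apply (locc_ren _ _ _ S idr) in O. destruct k; auto.
    + right. exists c; split; auto. destruct O as [[-> ->]|(N&I&O)]; [left; auto|].
      right. exists (lshiftv N); split; [apply in_map; auto|].
      apply (locc_ren _ _ _ S idr) in O. destruct k; auto.
  - simpl in *. destruct O as [(y&[Oy|Oy]&O)|(c&[Oc|Oc]&O)];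
      [left; apply IHM1|right; apply IHM2|left; apply IHM1|right; apply IHM2];
      eauto.
  - assert (G : forall c, k = false /\ n = fst (t c) \/
              (exists N, In N (snd (t c)) /\ locc k n N) ->
        k = false /\ fst (upnt t (S c)) = S n \/ exists N, In N (snd (upnt t (S c))) /\ locc k (bindn k n) N).
    { intros c [[-> ->]|(N&I&O')]; [left; auto|right].
      exists (lshiftn N); split; [apply in_map; auto|].
      apply (locc_ren _ _ _ idr S) in O'. destruct k; auto. }
    simpl gs. simpl locc.
    destruct O as [(y&Oy&O)|(c&Oc&O)]; simpl in *.
    + right. apply locc_lapps_hd, IHM. left. exists y. split.
      * destruct Oy as [[E _]|Oy]; [discriminate|auto].
      * apply (locc_ren _ _ _ idr S) in O. destruct k; auto.
    + destruct Oc as [[_ ->]|Oc].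
      * destruct (G _ O) as [[-> E]|(N&I&O')]; [left; auto|right].
        eapply locc_lapps_arg; eauto.
      * right. apply locc_lapps_hd, IHM. right. exists (S c). split; auto.
        destruct (G _ O) as [[-> E]|(N&I&O')]; [left; auto|right].
        exists N; auto.
Qed.

Lemma lren_ext M : forall f g f' g',
  (forall x, locc true x M -> f x = f' x) ->
  (forall a, locc false a M -> g a = g' a) ->
  lren f g M = lren f' g' M.
Proof.
  induction M; intros f g f' g' F G; simpl in *.
  - f_equal; auto.
  - f_equal. apply IHM; auto. intros [|x] O; simpl; auto.
  - f_equal; auto.
  - f_equal.
    + destruct b; simpl; auto.
    + apply IHM; auto. intros [|x] O; simpl; auto.
Qed.

Lemma unshiftn M : ~ lfn 0 M -> exists X, M = lshiftn X.
Proof.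
  intros N. exists (lren idr pred M). unfold lshiftn. rewrite lren_lren.
  rewrite <- (lren_id M) at 1. apply lren_ext; auto.
  intros [|a] O; auto. apply lfn_locc in O. tauto.
Qed.

Lemma locc_lren_inv M : forall f g n,
  (forall a, g a <> n) -> ~ locc false n (lren f g M).
Proof.
  induction M; intros f g n F; simpl.
  - intros []; discriminate.
  - apply IHM; auto.
  - intros [?|?]; [eapply IHM1|eapply IHM2]; eauto.
  - intros [[_ E]|O].
    + destruct b; simpl in E; [discriminate|]. injection E as E. eapply F; eauto.
    + revert O. apply IHM. intros [|a]; simpl; [discriminate|].
      intros E; injection E as E. eapply F; eauto.
Qed.

Lemma lfn_lshiftn M : ~ lfn 0 (lshiftn M).
Proof. rewrite lfn_locc. apply locc_lren_inv. discriminate. Qed.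

(** * Weak head normal forms *)

Definition nfbody (B : lm) : Prop :=
  (exists x l, B = lapps (LVar x) l) \/ (exists P, B = LLam P).

Lemma lapps_var_no_step l : forall x M', ~ wh (lapps (LVar x) l) M'.
Proof.
  induction l using rev_ind; intros y M' S.
  - inversion S.
  - rewrite lapps_app in S; simpl in S. inversion S; subst.
    + destruct l using rev_ind; [discriminate|rewrite lapps_app in *; discriminate].
    + destruct l using rev_ind; [discriminate|rewrite lapps_app in *; discriminate].
    + eapply IHl; eauto.
Qed.

Lemma lapps_var_not_mu l x b B : lapps (LVar x) l <> LMu b B.
Proof.
  destruct l using rev_ind; [discriminate|rewrite lapps_app; discriminate].
Qed.

Lemma lapps_var_not_lam l x B : lapps (LVar x) l <> LLam B.
Proof.
  destruct l using rev_ind; [discriminate|rewrite lapps_app; discriminate].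
Qed.

Lemma nfbody_normal B : nfbody B -> wh_normal B.
Proof.
  intros [(x&l&->)|(P&->)] M' S; [eapply lapps_var_no_step; eauto|inversion S].
Qed.

Lemma nfbody_not_mu B : nfbody B -> ~ is_lmu B.
Proof.
  intros [(x&l&->)|(P&->)] (b&Q&E); [eapply lapps_var_not_mu; eauto|discriminate].
Qed.

Lemma nfmu_normal b B : nfbody B -> b <> 0 \/ lfn 0 B -> wh_normal (LMu b B).
Proof.
  intros N E M' S. inversion S; subst.
  - apply (nfbody_not_mu _ N). unfold is_lmu; eauto.
  - destruct E as [E|E]; [auto|]. eapply lfn_lshiftn; eauto.
  - eapply nfbody_normal; eauto.
Qed.

Lemma nfbody_lren f g B : nfbody B -> nfbody (lren f g B).
Proof.
  intros [(x&l&->)|(P&->)]; [left|right; simpl; eauto].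
  rewrite lren_lapps. simpl; eauto.
Qed.

(** The grammar [whnf] flattened: since the body of a mu must not be a mu, at most one mu occurs
    above the body. *)
Definition nform (W : lm) : Prop :=
  nfbody W \/ exists b B, W = LMu b B /\ nfbody B /\ (b <> 0 \/ lfn 0 B).

Lemma nform_normal W : nform W -> wh_normal W.
Proof.
  intros [N|(b&B&->&N&E)]; [apply nfbody_normal|apply nfmu_normal]; auto.
Qed.

Lemma nfbody_whnf W : nfbody W -> whnf W.
Proof. intros [(x&l&->)|(P&->)]; constructor. Qed.

Lemma nform_whnf W : nform W -> whnf W.
Proof.
  intros [N|(b&B&->&N&E)]; [apply nfbody_whnf; auto|].
  constructor; auto using nfbody_whnf, nfbody_not_mu.
Qed.

Lemma whnf_nform W : whnf W -> nform W.
Proof.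
  induction 1 as [M|x Ms|b W HW IH Hb Hm].
  - left; right; eauto.
  - left; left; eauto.
  - right. exists b, W. repeat split; auto. destruct IH as [|(c&B&->&_)]; auto.
    destruct Hm. unfold is_lmu; eauto.
Qed.

(** * Termination of beta on head triples and weak head normal forms *)

Definition tnormal (T : triple) : Prop := forall T', ~ bt T T'.
Definition nftriple (T : triple) : Prop :=
  let '(b, h, l) := T in
  match h with LVar _ => True | LLam _ => l = [] | _ => False end.

Lemma nftriple_tnormal T : nftriple T -> tnormal T.
Proof. intros N T' B. destruct B. discriminate N. Qed.

Lemma tnormal_nftriple T : vtriple T -> tnormal T -> nftriple T.
Proof.
  destruct T as [[b h] l]; unfold vtriple; simpl. intros V N.
  destruct h; auto. destruct l; auto.
  edestruct N. constructor.
Qed.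

Lemma nftriple_plug b T : nftriple T -> nftriple (tact (plug b []) T).
Proof.
  destruct T as [[c h] l]; simpl. destruct h; simpl; auto.
  intros ->. destruct c; auto.
Qed.

Lemma hdt_var_apps l : forall x, exists b l', hdt (lapps (LVar x) l) = (b, LVar x, l').
Proof.
  induction l using rev_ind; intros y.
  - simpl; eauto.
  - rewrite lapps_app. simpl. destruct (IHl y) as (b&l'&->). simpl. eauto.
Qed.

Lemma nfbody_nftriple W : nfbody W -> nftriple (hdt W).
Proof.
  intros [(x&l&->)|(P&->)].
  - destruct (hdt_var_apps l x) as (b&l'&->). exact I.
  - reflexivity.
Qed.

Lemma nform_tnormal W : nform W -> tnormal (hdt W).
Proof.
  intros [N|(b&B&->&N&E)]; apply nftriple_tnormal.
  - apply nfbody_nftriple; auto.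
  - apply nftriple_plug, nfbody_nftriple; auto.
Qed.

Lemma nftriple_body b h l : nftriple (b, h, l) -> nfbody (lapps h l).
Proof.
  simpl. destruct h; try tauto.
  - intros _; left; eauto.
  - intros ->; right; simpl; eauto.
Qed.

Lemma reifies_nform T W : nftriple T -> reifies T W -> nform W.
Proof.
  destruct T as [[b h] l]. intros N R. apply nftriple_body in N.
  destruct R as [[E B]|[E ->]]; simpl in *.
  - left. replace W with (lren idr pred (lapps h l)); [apply nfbody_lren; auto|].
    rewrite B. unfold lshiftn. rewrite lren_lren. apply lren_id.
  - right. exists b, (lapps h l). repeat split; auto.
    destruct (classic (b = 0)) as [->|]; auto.
    destruct (classic (lfn 0 (lapps h l))) as [|F]; auto.
    destruct (unshiftn _ F) as [X EX]. destruct (E X). split; auto.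
Qed.

Lemma bts_trans_det T T1 T2 : bts T T1 -> tnormal T1 -> bts T T2 -> bts T2 T1.
Proof.
  intros R. apply clos_rt_rt1n in R. intros N R2.
  revert T2 R2. induction R as [|T T' T1 B R IH]; intros.
  - apply clos_rt_rt1n in R2. inversion R2 as [|T3 T4 B3]; [apply rt_refl|destruct (N _ B3)].
  - apply clos_rt_rt1n in R2. destruct R2 as [|T3 T2 B2 R2].
    + eapply rt_trans; [apply rt_step; eauto|]. apply clos_rt1n_rt; auto.
    + apply IH; auto. rewrite (bt_det _ _ _ B B2). apply clos_rt1n_rt; auto.
Qed.

(** Accessibility supplies the well-founded induction behind both existence proofs, [bacc_nform] and
    [bacc_NF_of]. *)
Definition bacc : triple -> Prop := Acc (fun T' T => bt T T').

Lemma bts_bacc T T1 : bts T T1 -> tnormal T1 -> bacc T.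
Proof.
  intros R. apply clos_rt_rt1n in R. intros N. induction R as [T|T T' T1 B' R IH].
  - constructor. intros y B. destruct (N _ B).
  - constructor. intros y' B. rewrite (bt_det _ _ _ B B'). apply IH, N.
Qed.

Lemma bacc_nform M : bacc (hdt M) -> exists W, whs M W /\ nform W.
Proof.
  intros A. remember (hdt M) as T eqn:E. revert M E.
  induction A as [T _ IH]; intros M ->.
  destruct (classic (exists T', bt (hdt M) T')) as [[T' B]|N].
  - destruct (whs_bt _ _ B) as (M'&R&<-). destruct (IH _ B _ eq_refl) as (W&R'&N).
    exists W; split; auto. eapply rt_trans; eauto.
  - destruct (reifies_ex (hdt M)) as [W R]. exists W. split; [apply whs_reifies; auto|].
    eapply reifies_nform; eauto. apply tnormal_nftriple; [apply vtriple_H|].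
    intros T' B; eauto.
Qed.

Lemma has_whnf_bacc M : has_whnf M <-> bacc (hdt M).
Proof.
  split.
  - intros (W&R&N). apply bts_bacc with (hdt W); [apply whs_bts; auto|].
    apply nform_tnormal, whnf_nform; auto.
  - intros A. destruct (bacc_nform M A) as (W&R&N). exists W; split; auto.
    apply nform_whnf; auto.
Qed.

Lemma bts_whs M T : bts (hdt M) T -> exists M', whs M M' /\ hdt M' = T.
Proof.
  intros R. apply clos_rt_rt1n in R. remember (hdt M) as T0 eqn:E. revert M E.
  induction R as [T|T T' T1 B R IHR]; intros M ->.
  - exists M; split; auto. apply rt_refl.
  - destruct (whs_bt _ _ B) as (M'&R'&E). destruct (IHR M' (eq_sym E)) as (M2&R2&E2).
    exists M2; split; auto. eapply rt_trans; eauto.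
Qed.

(** Brings a simulation on triples back to terms: the path of triples is followed up to some term
    with the triple of [W], and reading that triple back yields [W] because [W] is normal. *)
Lemma bts_whs_normal M W : bts (hdt M) (hdt W) -> wh_normal W -> whs M W.
Proof.
  intros R N. destruct (bts_whs _ _ R) as (M'&R'&E).
  eapply rt_trans; [exact R'|]. apply whs_reifies. rewrite E.
  apply wh_normal_reifies; auto.
Qed.

(** Normality makes the reduction of [whs_head] trivial, so the term coincides with what its head
    triple describes and its shape can be read off there. *)
Lemma wh_normal_nform W : wh_normal W -> nform W.
Proof.
  intros N. destruct (hdt W) as [[b h] l] eqn:E.
  destruct (whs_head W _ _ _ E) as [(h'&l'&V&->&->&->&->)|K].
  - left. destruct h'; try contradiction.
    + left; eauto.
    + destruct l' as [|Q l']; [right; simpl; eauto|].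
      edestruct N. simpl. apply wh_lapps. constructor.
  - apply wh_normal_whs in K; auto. subst W. right. exists b, (lapps h l).
    pose proof (vtriple_H (LMu b (lapps h l))) as V. rewrite E in V.
    repeat split.
    + destruct h; try contradiction; [left; eauto|].
      destruct l as [|Q l']; [right; simpl; eauto|].
      edestruct N. simpl. constructor. apply wh_lapps. constructor.
    + destruct (classic (b = 0)) as [->|]; auto.
      destruct (classic (lfn 0 (lapps h l))) as [|F]; auto.
      destruct (unshiftn _ F) as [X EX]. rewrite EX in N. edestruct N. constructor.
Qed.

Lemma whs_normal_unique M W W' :
  whs M W -> wh_normal W -> whs M W' -> wh_normal W' -> W = W'.
Proof.
  intros R N R' N'. apply wh_normal_hdt_inj; auto.
  apply whs_bts in R, R'.
  pose proof (nform_tnormal _ (wh_normal_nform _ N)) as T.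
  pose proof (nform_tnormal _ (wh_normal_nform _ N')) as T'.
  pose proof (bts_trans_det _ _ _ R T R') as K.
  apply clos_rt_rt1n in K. inversion K as [|T1 T2 B]; auto. destruct (T' _ B).
Qed.

(** * Unfolding explicit substitutions *)

Scheme tm_mind := Induction for tm Sort Prop
  with cmd_mind := Induction for cmd Sort Prop.
Combined Scheme tm_cmd_ind from tm_mind, cmd_mind.

Scheme scong_mind := Minimality for scong Sort Prop
  with cscong_mind := Minimality for cscong Sort Prop.
Combined Scheme scong_cscong_ind from scong_mind, cscong_mind.

Scheme step_mind := Minimality for step Sort Prop
  with cstep_mind := Minimality for cstep Sort Prop.
Combined Scheme step_cstep_ind from step_mind, cstep_mind.

Definition tsb (N : lm) : lm -> lm := gs (scons N LVar) idt.
Definition nsb (N : lm) (g : nat) : lm -> lm := gs LVar (plug g [N]).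

Fixpoint tr (M : tm) : lm :=
  match M with
  | Var x => LVar x
  | Lam P => LLam (tr P)
  | App P Q => LApp (tr P) (tr Q)
  | Mu C => let (b, P) := ctr C in LMu b P
  | TSub P N => tsb (tr N) (tr P)
  | NSub P N g => nsb (tr N) g (tr P)
  end
with ctr (C : cmd) : nat * lm :=
  match C with
  | Nam b P => (b, tr P)
  | CTSub D N => let (b, P) := ctr D in (b, tsb (tr N) P)
  | CNSub D N g =>
      let (b, P) := ctr D in
      let t := plug g [tr N] in
      (fst (t b), lapps (nsb (tr N) g P) (snd (t b)))
  end.

Lemma tr_emb M : tr (emb M) = M.
Proof. induction M; simpl; congruence. Qed.

Lemma lren_tsb f g N P :
  lren f g (tsb N P) = tsb (lren f g N) (lren (upr f) g P).
Proof. unfold tsb. rewrite lren_gs, gs_lren. f_equal. fcase; reflexivity. Qed.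

Lemma lren_nsb f g N c P :
  lren f g (nsb N c P) = nsb (lren f g N) (g c) (lren f (upr g) P).
Proof. unfold nsb. rewrite lren_gs, gs_lren. f_equal. fcase; reflexivity. Qed.

Lemma tr_ctr_ren :
  (forall M f g, tr (ren f g M) = lren f g (tr M)) /\
  (forall C f g, ctr (cren f g C) =
     (g (fst (ctr C)), lren f g (snd (ctr C)))).
Proof.
  apply tm_cmd_ind; intros; simpl; rewrite ?lren_tsb, ?lren_nsb; try congruence.
  - rewrite H. destruct (ctr C); reflexivity.
  - rewrite H, H0. destruct (ctr C); simpl. rewrite lren_tsb. reflexivity.
  - rewrite H, H0. destruct (ctr C) as [b P]; simpl.
    rewrite lren_lapps, lren_nsb. destruct b; reflexivity.
Qed.

Lemma tr_ren M f g : tr (ren f g M) = lren f g (tr M).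
Proof. apply tr_ctr_ren. Qed.

Lemma ctr_cren C f g :
  ctr (cren f g C) = (g (fst (ctr C)), lren f g (snd (ctr C))).
Proof. apply tr_ctr_ren. Qed.

Lemma tr_shiftv M : tr (shiftv M) = lshiftv (tr M).
Proof. apply tr_ren. Qed.

Lemma tr_shiftn M : tr (shiftn M) = lshiftn (tr M).
Proof. apply tr_ren. Qed.

Lemma tsb_shiftv N P : tsb N (lshiftv P) = P.
Proof. unfold tsb, lshiftv. rewrite gs_lren. apply gs_id. Qed.

Lemma nsb_shiftn N g P : nsb N g (lshiftn P) = P.
Proof. apply gs_plug_shift. Qed.

Lemma tr_ctr_scong :
  (forall M N, scong M N -> tr M = tr N) /\
  (forall C D, cscong C D -> ctr C = ctr D).
Proof.
  apply scong_cscong_ind; intros; simpl; try congruence.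
  - rewrite tr_shiftv. unfold tsb at 2; simpl. fold (tsb (tr N) (lshiftv (tr L))).
    rewrite tsb_shiftv. reflexivity.
  - rewrite tr_shiftn. unfold nsb at 2; simpl. fold (nsb (tr N) g (lshiftn (tr L))).
    rewrite nsb_shiftn. reflexivity.
  - rewrite H0. reflexivity.
  - rewrite H0. reflexivity.
  - rewrite H0. reflexivity.
Qed.

Lemma tr_scong M N : scong M N -> tr M = tr N.
Proof. apply tr_ctr_scong. Qed.

(** Under this mu, name 0 of the command itself serves as the top name of the triple. Frames around
    a command therefore act by [tact] and [sact] without lifting. *)
Definition hdc (c : nat * lm) : triple := hdt (LMu (fst c) (snd c)).

Lemma hdc_tsub C N : hdc (ctr (CTSub C N)) = sact (scons (tr N) LVar) idt (hdc (ctr C)).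
Proof.
  simpl. destruct (ctr C) as [b P]. unfold hdc, tsb; simpl.
  rewrite hdt_gs, tact_sact_comp, sact_tact_comp by apply vtriple_H.
  f_equal.
  - fcase; [apply gs_plug_shift|reflexivity].
  - fcase; reflexivity.
Qed.

Lemma hdc_nsub C N g : hdc (ctr (CNSub C N g)) = tact (plug g [tr N]) (hdc (ctr C)).
Proof.
  simpl. destruct (ctr C) as [b P]. unfold hdc, nsb; simpl.
  rewrite hdt_lapps, hdt_gsL, !tact_tact. f_equal. fcase; unfold compt; simpl; auto.
  destruct x; simpl; auto. rewrite gs_plug_shift. reflexivity.
Qed.

Lemma hdt_tsub M N : hdt (tr (TSub M N)) =
  sact (fun x => lshiftn (scons (tr N) LVar x)) (upnt idt) (hdt (tr M)).
Proof. apply hdt_gs. Qed.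

Lemma hdt_nsub M N g : hdt (tr (NSub M N g)) = tact (upnt (plug g [tr N])) (hdt (tr M)).
Proof. apply hdt_gsL. Qed.

Lemma hdt_mu C : hdt (tr (Mu C)) = hdc (ctr C).
Proof. simpl. destruct (ctr C); reflexivity. Qed.

Lemma hdc_nam b M : hdc (ctr (Nam b M)) = tact (plug b []) (hdt (tr M)).
Proof. reflexivity. Qed.

Lemma bt0_tact t T T' : bt0 T T' -> bt0 (tact t T) (tact t T').
Proof. intros [->|B]; [left; auto|right; apply bt_tact; auto]. Qed.

Lemma bt0_sact s t T T' : bt0 T T' -> bt0 (sact s t T) (sact s t T').
Proof. intros [->|B]; [left; auto|right; apply bt_sact; auto]. Qed.

Ltac simp_sub :=
  rewrite ?tr_shiftv, ?tr_shiftn, ?tr_ren;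
  unfold tsb, nsb, lshiftv, lshiftn; rewrite ?gs_lren, ?gs_gs, ?lren_gs;
  rewrite ?gs_lren, ?gs_gs; rewrite ?gs_lren.
Ltac fcase3 := let x := fresh "x" in
  apply functional_extensionality; intros [|[|x]]; simpl.
Ltac fin_sub := unfold compt, rent; simpl; rewrite ?gs_lren;
  try reflexivity; try (rewrite <- gs_id at 1; f_equal); try (rewrite gs_ren).

Lemma upnt_idt : upnt idt = idt.
Proof. fcase; reflexivity. Qed.

Lemma tsb_mu N b P : tsb N (LMu b P) = LMu b (tsb (lshiftn N) P).
Proof.
  unfold tsb. simpl. rewrite upnt_idt. simpl. f_equal. f_equal. fcase; reflexivity.
Qed.

Lemma tsb_lam N P : tsb N (LLam P) = LLam (tsb (lshiftv N) (lren swap01 idr P)).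
Proof.
  unfold tsb. simpl. f_equal. rewrite gs_lren. f_equal. fcase3; reflexivity.
Qed.

Lemma nsb_mu N g b P : nsb N g (LMu b P) =
  LMu (fst (upnt (plug g [N]) b))
      (lapps (nsb (lshiftn N) (S g) (lren idr swap01 P)) (snd (upnt (plug g [N]) b))).
Proof.
  unfold nsb. simpl. f_equal. f_equal. rewrite gs_lren. f_equal. fcase3; reflexivity.
Qed.

Lemma nsb_lam N g P : nsb N g (LLam P) = LLam (nsb (lshiftv N) g P).
Proof.
  unfold nsb. simpl. f_equal. f_equal; fcase; reflexivity.
Qed.

Lemma step_bt0 :
  (forall M N, step M N -> bt0 (hdt (tr M)) (hdt (tr N))) /\
  (forall C D, cstep C D -> bt0 (hdc (ctr C)) (hdc (ctr D))).
Proof.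
  apply step_cstep_ind; intros.
  - apply wh_bt. simpl. unfold tsb. rewrite <- lsubst_gs. constructor.
  - left. change (hdt (tr (App (Mu C) N))) with (tact (push (tr N)) (hdt (tr (Mu C)))).
    rewrite !hdt_mu, hdc_nsub, ctr_cren. destruct (ctr C) as [b P]. unfold hdc; simpl.
    rewrite tr_shiftn, <- gs_ren, hdt_gsL, !tact_tact. f_equal.
    fcase3; [destruct b|..]; reflexivity.
  - left. simpl. rewrite tr_shiftn. apply hdt_shift.
  - left. reflexivity.
  - left. simpl. rewrite tr_shiftv, tsb_shiftv. reflexivity.
  - left. simpl. rewrite tr_shiftn, nsb_shiftn. reflexivity.
  - left. f_equal. simpl. unfold tsb at 1 2. simpl.
    f_equal. simp_sub. f_equal; fcase3; fin_sub.
  - left. f_equal. simpl. rewrite tsb_mu, tr_shiftn. reflexivity.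
  - left. f_equal. simpl. rewrite nsb_mu, tr_shiftn, tr_ren. reflexivity.
  - left. f_equal. simpl. simp_sub. f_equal; fcase3; fin_sub.
  - left. f_equal. simpl. simp_sub. f_equal; fcase3; fin_sub.
  - left. f_equal. simpl. simp_sub. f_equal; fcase3; fin_sub.
  - left. f_equal. simpl. simp_sub. f_equal; fcase3; fin_sub.
  - apply bt0_tact; auto.
  - rewrite !hdt_mu; auto.
  - rewrite !hdt_tsub. apply bt0_sact; auto.
  - rewrite !hdt_nsub. apply bt0_tact; auto.
  - left. rewrite hdc_nam, hdt_mu, ctr_cren. destruct (ctr C) as [c P].
    unfold hdc; simpl. rewrite <- gs_ren, hdt_gsL, !tact_tact. f_equal.
    fcase3; [destruct c| |]; reflexivity.
  - left. reflexivity.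
  - rewrite !hdc_nam. apply bt0_tact; auto.
  - rewrite !hdc_tsub. apply bt0_sact; auto.
  - rewrite !hdc_nsub. apply bt0_tact; auto.
Qed.

Lemma wxh_bt0 M N : wxh M N -> bt0 (hdt (tr M)) (hdt (tr N)).
Proof.
  intros (M'&N'&C&S&C'). rewrite (tr_scong _ _ C), <- (tr_scong _ _ C').
  apply step_bt0; auto.
Qed.

Lemma wxhs_bts M N : wxhs M N -> bts (hdt (tr M)) (hdt (tr N)).
Proof.
  induction 1 as [M N S| |].
  - destruct (wxh_bt0 _ _ S) as [->|]; [apply rt_refl|apply rt_step; auto].
  - apply rt_refl.
  - eapply rt_trans; eauto.
Qed.

(** * Terms with pure arguments *)

Fixpoint pure (M : tm) : Prop :=
  match M with
  | Var _ => True
  | Lam P => pure P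
  | App P Q => pure P /\ pure Q
  | Mu (Nam _ P) => pure P
  | _ => False
  end.

(* Explicit substitutions never enter arguments or abstractions, so the reducts
   of pure terms stay in this class. *)
Fixpoint sp (M : tm) : Prop :=
  match M with
  | Var _ => True
  | Lam P => pure P
  | App P Q => sp P /\ pure Q
  | Mu C => csp C
  | TSub P N => sp P /\ pure N
  | NSub P N _ => sp P /\ pure N
  end
with csp (C : cmd) : Prop :=
  match C with
  | Nam _ P => sp P
  | CTSub D N => csp D /\ pure N
  | CNSub D N _ => csp D /\ pure N
  end.

Lemma pure_emb M : pure (emb M).
Proof. induction M; simpl; auto. Qed.

Lemma pure_cpure :
  (forall M, (pure M -> M = emb (tr M) /\ sp M) /\ forall f g, pure (ren f g M) <-> pure M) /\
  (forall C, (pure (Mu C) -> Mu C = emb (tr (Mu C)) /\ csp C) /\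
     forall f g, pure (Mu (cren f g C)) <-> pure (Mu C)).
Proof.
  apply tm_cmd_ind; simpl.
  - repeat split; auto.
  - intros P [IP RP]; split; [|intros; apply RP].
    intros A; destruct (IP A); split; auto. congruence.
  - intros P [IP RP] Q [IQ RQ].
    split; [|intros; rewrite RP, RQ; tauto].
    intros [A B]. destruct (IP A), (IQ B). split; [congruence|auto].
  - intros C [IC RC]; split; auto.
  - intros; repeat split; tauto.
  - intros; repeat split; tauto.
  - intros b P [IP RP]; split; [|intros; apply RP].
    intros A; destruct (IP A); split; auto. congruence.
  - intros; repeat split; tauto.
  - intros; repeat split; tauto.
Qed.

Lemma pure_sp M : pure M -> sp M.
Proof. intros P; apply pure_cpure; auto. Qed.

Lemma pure_tr M : pure M -> M = emb (tr M).
Proof. intros P; apply pure_cpure; auto. Qed.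

Lemma pure_ren M f g : pure (ren f g M) <-> pure M.
Proof. apply pure_cpure. Qed.

Lemma pure_shiftv M : pure (shiftv M) <-> pure M.
Proof. apply pure_ren. Qed.
Lemma pure_shiftn M : pure (shiftn M) <-> pure M.
Proof. apply pure_ren. Qed.

Lemma sp_csp_ren :
  (forall M f g, sp (ren f g M) <-> sp M) /\
  (forall C f g, csp (cren f g C) <-> csp C).
Proof.
  apply tm_cmd_ind; simpl; intros; rewrite ?pure_ren; try tauto;
    rewrite ?H, ?H0; tauto.
Qed.

Lemma sp_ren M f g : sp (ren f g M) <-> sp M.
Proof. apply sp_csp_ren. Qed.

Lemma csp_cren M f g : csp (cren f g M) <-> csp M.
Proof. apply sp_csp_ren. Qed.

Lemma sp_shiftv M : sp (shiftv M) <-> sp M.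
Proof. apply sp_ren. Qed.
Lemma sp_shiftn M : sp (shiftn M) <-> sp M.
Proof. apply sp_ren. Qed.

Ltac sp_simp := simpl in *;
  rewrite ?pure_shiftv, ?pure_shiftn, ?pure_ren, ?sp_shiftv, ?sp_shiftn, ?sp_ren,
    ?csp_cren in *.

Lemma sp_scong_cscong :
  (forall M N, scong M N -> (sp M <-> sp N)) /\
  (forall C D, cscong C D -> (csp C <-> csp D)).
Proof. apply scong_cscong_ind; intros; sp_simp; tauto. Qed.

Lemma sp_scong M N : scong M N -> sp M <-> sp N.
Proof. apply sp_scong_cscong. Qed.

Lemma sp_step_cstep :
  (forall M N, step M N -> sp M -> sp N) /\
  (forall C D, cstep C D -> csp C -> csp D).
Proof.
  apply step_cstep_ind; intros; sp_simp; try tauto.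
  - split; [apply pure_sp|]; tauto.
  - apply pure_sp; tauto.
Qed.

Lemma sp_wxhs M N : wxhs M N -> sp M -> sp N.
Proof.
  induction 1 as [M N (M'&N'&C&S&C')| |]; auto. intros P.
  apply (sp_scong _ _ C'). eapply sp_step_cstep; eauto. apply (sp_scong _ _ C); auto.
Qed.

(** * Renaming and occurrences in terms with explicit substitutions *)

Lemma ren_cren_comp :
  (forall M f g f' g', ren f g (ren f' g' M) = ren (fun n => f (f' n)) (fun n => g (g' n)) M) /\
  (forall C f g f' g', cren f g (cren f' g' C) = cren (fun n => f (f' n)) (fun n => g (g' n)) C).
Proof.
  apply tm_cmd_ind; intros; simpl; f_equal; auto;
    try (rewrite H, upr_comp; reflexivity).
Qed.

Lemma ren_comp M f g f' g' :
  ren f g (ren f' g' M) = ren (fun n => f (f' n)) (fun n => g (g' n)) M.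
Proof. apply ren_cren_comp. Qed.

Lemma ren_cren_id :
  (forall M, ren (fun n => n) (fun n => n) M = M) /\
  (forall C, cren (fun n => n) (fun n => n) C = C).
Proof. apply tm_cmd_ind; intros; simpl; rewrite ?upr_id; congruence. Qed.

Lemma ren_id M : ren (fun n => n) (fun n => n) M = M.
Proof. apply ren_cren_id. Qed.

(* In [cocc] the name of the command itself does not count. *)
Fixpoint tocc (k : bool) (n : nat) (M : tm) : Prop :=
  match M with
  | Var x => k = true /\ n = x
  | Lam P => tocc k (bindv k n) P
  | App P Q => tocc k n P \/ tocc k n Q
  | Mu C => k = false /\ chn C = Some (S n) \/ cocc k (bindn k n) C
  | TSub P N => tocc k (bindv k n) P \/ tocc k n N
  | NSub P N g => tocc k (bindn k n) P \/ tocc k n N \/ k = false /\ g = n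
  end
with cocc (k : bool) (n : nat) (C : cmd) : Prop :=
  match C with
  | Nam _ P => tocc k n P
  | CTSub D N => cocc k (bindv k n) D \/ tocc k n N
  | CNSub D N g => cocc k (bindn k n) D \/ tocc k n N \/ k = false /\ g = n
  end.

Lemma ren_cren_ext :
  (forall M f g f' g',
    (forall x, tocc true x M -> f x = f' x) ->
    (forall a, tocc false a M -> g a = g' a) ->
    ren f g M = ren f' g' M) /\
  (forall C f g f' g',
    (forall x, cocc true x C -> f x = f' x) ->
    (forall a, chn C = Some a \/ cocc false a C -> g a = g' a) ->
    cren f g C = cren f' g' C).
Proof.
  apply tm_cmd_ind; simpl.
  - intros x f g f' g' F G. f_equal; auto.
  - intros P IP f g f' g' F G. f_equal. apply IP; auto.
    intros [|x] O; simpl; auto.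
  - intros P IP Q IQ f g f' g' F G. f_equal; auto.
  - intros C IC f g f' g' F G. f_equal. apply IC; auto.
    intros [|a] O; simpl; auto. f_equal. apply G. destruct O; auto.
  - intros P IP N IN f g f' g' F G. f_equal; auto. apply IP; auto.
    intros [|x] O; simpl; auto.
  - intros P IP N IN c f g f' g' F G. f_equal; auto. apply IP; auto.
    intros [|a] O; simpl; auto.
  - intros b P IP f g f' g' F G. f_equal; auto.
  - intros C IC N IN f g f' g' F G. f_equal; auto.
    + apply IC; auto.
      * intros [|x] O; simpl; auto.
      * intros a [O|O]; auto.

  - intros C IC N IN c f g f' g' F G. f_equal; auto.
    + apply IC; auto.
      intros [|a] O; simpl; auto. f_equal. apply G. destruct O as [->|]; auto.
    + apply IN; auto 6.
    + apply G; auto.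
Qed.

Lemma ren_ext M f g f' g' :
  (forall x, tocc true x M -> f x = f' x) ->
  (forall a, tocc false a M -> g a = g' a) ->
  ren f g M = ren f' g' M.
Proof. apply ren_cren_ext. Qed.

Lemma unshift_v M : ~ tocc true 0 M -> shiftv (ren pred idr M) = M.
Proof.
  intros N. unfold shiftv. rewrite ren_comp, <- (ren_id M) at 1.
  rewrite ren_id at 1. symmetry. rewrite <- (ren_id M) at 1.
  apply ren_ext; auto. intros [|x] O; [tauto|reflexivity].
Qed.

Lemma unshift_n M : ~ tocc false 0 M -> shiftn (ren idr pred M) = M.
Proof.
  intros N. unfold shiftn. rewrite ren_comp. symmetry. rewrite <- (ren_id M) at 1.
  apply ren_ext; auto. intros [|x] O; [tauto|reflexivity].
Qed.

Lemma unbind_map f o : unbind (option_map (upr f) o) = option_map f (unbind o).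
Proof. destruct o as [[|n]|]; reflexivity. Qed.

Lemma hv_chv_ren :
  (forall M f g, hv (ren f g M) = option_map f (hv M)) /\
  (forall C f g, chv (cren f g C) = option_map f (chv C)).
Proof.
  apply tm_cmd_ind; simpl; intros; auto; rewrite H, unbind_map; auto.
Qed.

Lemma hv_ren M f g : hv (ren f g M) = option_map f (hv M).
Proof. apply hv_chv_ren. Qed.

Lemma chn_cren C : forall f g, chn (cren f g C) = option_map g (chn C).
Proof.
  induction C; simpl; intros; auto. rewrite IHC, unbind_map; auto.
Qed.

Lemma hn_ren M : forall f g, hn (ren f g M) = option_map g (hn M).
Proof.
  induction M; simpl; intros; auto.
  - rewrite chn_cren, unbind_map; auto.
  - rewrite IHM1, unbind_map; auto.
Qed.

Lemma upr_inj f : (forall a b, f a = f b -> a = b) -> forall a b, upr f a = upr f b -> a = b.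
Proof. intros F [|a] [|b] E; simpl in E; try discriminate; auto. Qed.

Lemma tocc_cocc_ren :
  (forall M k n f g, (forall a b, f a = f b -> a = b) -> (forall a b, g a = g b -> a = b) ->
    tocc k (if k then f n else g n) (ren f g M) <-> tocc k n M) /\
  (forall C k n f g, (forall a b, f a = f b -> a = b) -> (forall a b, g a = g b -> a = b) ->
    cocc k (if k then f n else g n) (cren f g C) <-> cocc k n C).
Proof.
  assert (BV : forall k n f g, bindv k (if k then f n else g n) =
     if k then upr f (bindv k n) else g (bindv k n)) by (intros [] *; reflexivity).
  assert (BN : forall k n f g, bindn k (if k then f n else g n) =
     if k then f (bindn k n) else upr g (bindn k n)) by (intros [] *; reflexivity).
  assert (NM : forall (k : bool) n c (f g : nat -> nat), (forall a b, g a = g b -> a = b) ->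
     (k = false /\ g c = (if k then f n else g n)) <-> (k = false /\ c = n)).
  { intros [] n c f g G; split; intros [E E']; try discriminate; subst; auto. }
  apply tm_cmd_ind; simpl.
  - intros x k n f g F G. destruct k; split; intros [E E']; try discriminate; subst; auto.
  - intros P IP k n f g F G. rewrite BV, IP; eauto using upr_inj; tauto.
  - intros P IP Q IQ k n f g F G. rewrite IP, IQ; auto; tauto.
  - intros C IC k n f g F G. rewrite BN, IC, chn_cren; eauto using upr_inj.
    enough (K : k = false -> option_map (upr g) (chn C) = Some (S (if k then f n else g n))
              <-> chn C = Some (S n)) by (split; intros [[E1 E2]|]; auto; left; split; auto; apply K; auto).
    intros ->. destruct (chn C) as [[|c]|]; simpl; split; intros E; inversion E; auto.
  - intros P IP N IN k n f g F G. rewrite BV, IP, IN; eauto using upr_inj; tauto.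
  - intros P IP N IN c k n f g F G. rewrite BN, IP, IN, NM; eauto using upr_inj; tauto.
  - intros b P IP k n f g F G. apply IP; auto.
  - intros C IP N IN k n f g F G. rewrite BV, IP, IN; eauto using upr_inj; tauto.
  - intros C IP N IN c k n f g F G. rewrite BN, IP, IN, NM; eauto using upr_inj; tauto.
Qed.

Lemma tocc_shiftv k n M : tocc k (bindv k n) (shiftv M) <-> tocc k n M.
Proof.
  rewrite <- (proj1 tocc_cocc_ren M k n S idr); [destruct k; reflexivity|congruence|auto].
Qed.

Lemma tocc_shiftn k n M : tocc k (bindn k n) (shiftn M) <-> tocc k n M.
Proof.
  rewrite <- (proj1 tocc_cocc_ren M k n idr S); [destruct k; reflexivity|auto|congruence].
Qed.

Lemma not_tocc_ren :
  (forall M (k : bool) n (f g : nat -> nat), (if k then forall a, f a <> n else forall a, g a <> n) ->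
     ~ tocc k n (ren f g M)) /\
  (forall C (k : bool) n (f g : nat -> nat), (if k then forall a, f a <> n else forall a, g a <> n) ->
     ~ cocc k n (cren f g C) /\ (k = false -> chn (cren f g C) <> Some n)).
Proof.
  assert (U : forall (f : nat -> nat) n, (forall a : nat, f a <> n) -> forall a, upr f a <> S n).
  { intros f n F [|a]; simpl; [discriminate|]. intros E; injection E; apply F. }
  assert (BV : forall (k : bool) n (f g : nat -> nat), (if k then forall a, f a <> n else forall a, g a <> n) ->
    if k then forall a, upr f a <> bindv k n else forall a, g a <> bindv k n)
    by (intros [] *; simpl; auto).
  assert (BN : forall (k : bool) n (f g : nat -> nat), (if k then forall a, f a <> n else forall a, g a <> n) ->
    if k then forall a, f a <> bindn k n else forall a, upr g a <> bindn k n)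
    by (intros [] *; simpl; auto).
  apply tm_cmd_ind; simpl.
  - intros x k n f g F [-> E]. eapply F; eauto.
  - intros P IP k n f g F. apply IP, (BV k n f g F).
  - intros P IP Q IQ k n f g F [O|O]; [eapply IP|eapply IQ]; eauto.
  - intros C IC k n f g F. pose proof (IC _ _ _ _ (BN _ _ _ _ F)) as [F1 F2].
    intros [[-> E]|O]; [apply F2|apply F1]; auto.
  - intros P IP N IN k n f g F [O|O]; [eapply IP, O; apply (BV k n f g F)|eapply IN; eauto].
  - intros P IP N IN c k n f g F [O|[O|[-> E]]];
      [eapply IP, O; apply (BN k n f g F)|eapply IN; eauto|eapply F; eauto].
  - intros b P IP k n f g F. split; [apply IP; auto|].
    intros -> E. inversion E. eapply F; eauto.
  - intros C IC N IN k n f g F. pose proof (IC _ _ _ _ (BV _ _ _ _ F)) as [F1 F2].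
    split; [intros [O|O]; [auto|eapply IN; eauto]|]. intros ->; auto.
  - intros C IC N IN c k n f g F. pose proof (IC _ _ _ _ (BN _ _ _ _ F)) as [F1 F2].
    split; [intros [O|[O|[-> E]]]; [auto|eapply IN; eauto|eapply F; eauto]|].
    intros -> E. apply F2; auto. simpl.
    destruct (chn (cren f (upr g) C)) as [[|a]|]; inversion E; auto.
Qed.

Lemma not_tocc_shiftv M : ~ tocc true 0 (shiftv M).
Proof. apply not_tocc_ren. discriminate. Qed.

Lemma not_tocc_shiftn M : ~ tocc false 0 (shiftn M).
Proof. apply not_tocc_ren. discriminate. Qed.

(** * Normal forms, up to collecting substitutions *)

Inductive hkind := KVar | KLam | KMu.

(** The search stops at a mu because substitutions are not collected past it; [core] continues
    below. *)
Fixpoint kind (M : tm) : hkind :=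
  match M with
  | Var _ => KVar
  | Lam _ => KLam
  | Mu _ => KMu
  | App P _ | TSub P _ | NSub P _ _ => kind P
  end.

Definition bare (M : tm) : Prop := match M with Lam _ => True | _ => False end.
Definition cbare (C : cmd) : Prop := match C with Nam _ M => bare M | _ => False end.

(* There is no rule that moves a substitution for the head variable into an
   abstraction, hence [bare]. *)
Fixpoint NF (M : tm) : Prop :=
  match M with
  | Var _ | Lam _ => True
  | App P _ => NF P /\ kind P = KVar
  | Mu C => cNF C /\ ~ (chn C = Some 0 /\ ~ cocc false 0 C)
  | TSub P _ => NF P /\ tocc true 0 P /\ (hv P <> Some 0 \/ bare P)
  | NSub P _ _ => NF P /\ tocc false 0 P /\ hn P <> Some 0
  end
with cNF (C : cmd) : Prop :=
  match C with
  | Nam _ P => NF P /\ kind P <> KMu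
  | CTSub D _ => cNF D /\ cocc true 0 D /\ (chv D <> Some 0 \/ cbare D)
  | CNSub D _ _ => cNF D /\ cocc false 0 D /\ chn D <> Some 0
  end.

Lemma hn_kind M : kind M <> KMu -> hn M = None.
Proof.
  induction M; simpl; intros K; auto; [congruence|].
  rewrite IHM1; auto.
Qed.

Lemma bare_kind M : bare M -> kind M = KLam.
Proof. destruct M; simpl; tauto. Qed.

Lemma attr_scong :
  (forall M N, scong M N -> kind M = kind N /\ hv M = hv N /\ hn M = hn N /\
     (bare M <-> bare N) /\ forall k n, tocc k n M <-> tocc k n N) /\
  (forall C D, cscong C D -> chv C = chv D /\ chn C = chn D /\
     (cbare C <-> cbare D) /\ forall k n, cocc k n C <-> cocc k n D).
Proof.
  apply scong_cscong_ind; simpl; try (intros; repeat split; auto; try tauto; fail).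
  - intros M N L. repeat split; auto; rewrite ?tocc_shiftv; tauto.
  - intros M N g L. repeat split; auto; rewrite ?tocc_shiftn; tauto.
  - intros M N _ (K&V&A&B&O). repeat split; auto; try apply B; apply O.
  - intros M N L _ (K&V&A&B&O) _ (K'&V'&A'&B'&O').
    repeat split; try congruence; try tauto; rewrite O; apply O'.
  - intros M M' L _ (K&V&A&B&O). repeat split; auto; rewrite O; auto.
  - intros C C' _ (V&A&B&O). rewrite A. repeat split; auto; rewrite O; auto.
  - intros M M' L _ (K&V&A&B&O). rewrite V. repeat split; auto; rewrite O; auto.
  - intros M M' L g _ (K&V&A&B&O). rewrite A. repeat split; auto; rewrite O; auto.
  - intros M N _ (V&A&B&O). repeat split; auto; try apply B; apply O.
  - intros M N L _ (V&A&B&O) _ (V'&A'&B'&O').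
    repeat split; try congruence; try tauto; rewrite O; apply O'.
  - intros b M M' _ (K&V&A&B&O). repeat split; auto; try apply B; apply O.
  - intros C C' L _ (V&A&B&O). rewrite V. repeat split; auto; rewrite O; auto.
  - intros C C' L g _ (V&A&B&O). rewrite A. repeat split; auto; rewrite O; auto.
Qed.

Lemma NF_scong_cscong :
  (forall M N, scong M N -> (NF M <-> NF N)) /\
  (forall C D, cscong C D -> (cNF C <-> cNF D)).
Proof.
  apply scong_cscong_ind; simpl; try (intros; tauto).
  - intros M N L. pose proof (not_tocc_shiftv L). pose proof (bare_kind M).
    intuition congruence.
  - intros M N g L. pose proof (not_tocc_shiftn L).
    pose proof (hn_kind M). intuition congruence.
  - intros M M' L S IH. destruct (proj1 attr_scong _ _ S) as (K&V&A&B&O).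
    rewrite IH, K. tauto.
  - intros C C' S IH. destruct (proj2 attr_scong _ _ S) as (V&A&B&O).
    rewrite IH, A, O. tauto.
  - intros M M' L S IH. destruct (proj1 attr_scong _ _ S) as (K&V&A&B&O).
    rewrite IH, V, B, O. tauto.
  - intros M M' L g S IH. destruct (proj1 attr_scong _ _ S) as (K&V&A&B&O).
    rewrite IH, A, O. tauto.
  - intros b M N g. pose proof (hn_kind M). intuition congruence.
  - intros b M M' S IH. destruct (proj1 attr_scong _ _ S) as (K&V&A&B&O).
    rewrite IH, K. tauto.
  - intros C C' L S IH. destruct (proj2 attr_scong _ _ S) as (V&A&B&O).
    rewrite IH, V, B, O. tauto.
  - intros C C' L g S IH. destruct (proj2 attr_scong _ _ S) as (V&A&B&O).
    rewrite IH, A, O. tauto.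
Qed.

Lemma NF_scong M N : scong M N -> NF M <-> NF N.
Proof. apply NF_scong_cscong. Qed.

Lemma cNF_cscong C D : cscong C D -> cNF C <-> cNF D.
Proof. apply NF_scong_cscong. Qed.

Lemma NF_no_step :
  (forall M N, step M N -> ~ NF M) /\ (forall C D, cstep C D -> ~ cNF C).
Proof.
  apply step_cstep_ind; simpl; intros; try tauto; try (intuition congruence).
  - pose proof (not_tocc_shiftn M). tauto.
  - pose proof (not_tocc_shiftv M). tauto.
  - pose proof (not_tocc_shiftn M). tauto.
  - rewrite H; simpl. intuition congruence.
  - rewrite H; simpl. intuition congruence.
Qed.

Lemma NF_normal M : NF M -> wxh_normal M.
Proof.
  intros N M' (P&Q&S&T&_). apply (NF_scong _ _ S) in N.
  exact (proj1 NF_no_step _ _ T N).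
Qed.

(** * Progress: a term outside [NF] has a reduct *)

Definition cwxh (C D : cmd) : Prop :=
  exists C' D', cscong C C' /\ cstep C' D' /\ cscong D' D.

Lemma wxh_step M N : step M N -> wxh M N.
Proof. intros S; exists M, N; repeat split; auto; constructor. Qed.
Lemma wxh_scong M M' N : scong M M' -> wxh M' N -> wxh M N.
Proof.
  intros S (P&Q&S1&T&S2). exists P, Q; repeat split; auto. eapply sc_trans; eauto.
Qed.
Lemma wxh_app M N L : wxh M N -> wxh (App M L) (App N L).
Proof.
  intros (P&Q&S1&T&S2). exists (App P L), (App Q L). auto using sc_appl, st_appl.
Qed.
Lemma wxh_tsub M N L : wxh M N -> wxh (TSub M L) (TSub N L).
Proof.
  intros (P&Q&S1&T&S2). exists (TSub P L), (TSub Q L). auto using sc_tsub, st_tsub.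
Qed.
Lemma wxh_nsub M N L g : wxh M N -> wxh (NSub M L g) (NSub N L g).
Proof.
  intros (P&Q&S1&T&S2). exists (NSub P L g), (NSub Q L g). auto using sc_nsub, st_nsub.
Qed.
Lemma wxh_mu C D : cwxh C D -> wxh (Mu C) (Mu D).
Proof.
  intros (P&Q&S1&T&S2). exists (Mu P), (Mu Q). auto using sc_mu, st_mubody.
Qed.
Lemma cwxh_nam b C D : wxh C D -> cwxh (Nam b C) (Nam b D).
Proof.
  intros (P&Q&S1&T&S2). exists (Nam b P), (Nam b Q). auto using csc_nam, cst_nam.
Qed.
Lemma cwxh_tsub M N L : cwxh M N -> cwxh (CTSub M L) (CTSub N L).
Proof.
  intros (P&Q&S1&T&S2). exists (CTSub P L), (CTSub Q L). auto using csc_tsub, cst_tsub.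
Qed.
Lemma cwxh_nsub M N L g : cwxh M N -> cwxh (CNSub M L g) (CNSub N L g).
Proof.
  intros (P&Q&S1&T&S2). exists (CNSub P L g), (CNSub Q L g). auto using csc_nsub, cst_nsub.
Qed.
Lemma cwxh_step M N : cstep M N -> cwxh M N.
Proof. intros S; exists M, N; repeat split; auto; constructor. Qed.
Lemma cwxh_cscong M M' N : cscong M M' -> cwxh M' N -> cwxh M N.
Proof.
  intros S (P&Q&S1&T&S2). exists P, Q; repeat split; auto. eapply csc_trans; eauto.
Qed.

(** In a normal command no substitution is for the name of the command, so each of them can be
    collected below the naming. *)
Lemma cNF_nam C : cNF C -> exists b P, cscong C (Nam b P).
Proof.
  induction C as [b P|C IH N|C IH N g]; simpl; intros F.
  - exists b, P. constructor.
  - destruct IH as (b&P&S); [tauto|]. exists b, (TSub P N).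
    eapply csc_trans; [apply csc_tsub; eauto|]. apply csc_sym, csc_t.
  - destruct IH as (b&P&S); [tauto|].
    destruct (proj2 attr_scong _ _ S) as (V&A&_). simpl in A.
    destruct b as [|b]; [tauto|]. exists b, (NSub P N g).
    eapply csc_trans; [apply csc_nsub; eauto|]. apply csc_sym, csc_n.
Qed.

(** Collecting moves the argument inward until it meets the abstraction or the mu. [nam_mu] does the
    same for a naming that meets a mu. *)
Lemma app_not_var M : forall L, kind M <> KVar -> exists N, wxh (App M L) N.
Proof.
  induction M; simpl; intros L K; try congruence.
  - eexists; apply wxh_step, st_beta.
  - destruct (IHM1 M2 K) as [N S]. eexists; apply wxh_app; eauto.
  - eexists; apply wxh_step, st_mu.
  - destruct (IHM1 (shiftv L) K) as [N S]. eexists.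
    eapply wxh_scong; [apply sc_app_t|]. apply wxh_tsub; eauto.
  - destruct (IHM1 (shiftn L) K) as [N S]. eexists.
    eapply wxh_scong; [apply sc_app_n|]. apply wxh_nsub; eauto.
Qed.

Lemma nam_mu M : forall b, NF M -> kind M = KMu -> exists D, cwxh (Nam b M) D.
Proof.
  induction M; simpl; intros b F K; try congruence.
  - intuition congruence.
  - eexists; apply cwxh_step, cst_ren.
  - destruct (IHM1 b) as [D S]; try tauto. eexists.
    eapply cwxh_cscong; [apply csc_t|]. apply cwxh_tsub; eauto.
  - destruct (IHM1 (S b)) as [D S]; try tauto. eexists.
    eapply cwxh_cscong; [apply csc_n|]. apply cwxh_nsub; eauto.
Qed.

(** Either the substitution is garbage, or it is for the head variable, and then every shape of [M]
    except a bare abstraction has its own rule. *)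
Lemma tsub_step M N : NF M -> ~ NF (TSub M N) -> exists L, wxh (TSub M N) L.
Proof.
  intros F NF'.
  destruct (classic (tocc true 0 M)) as [O|O].
  2:{ exists (ren pred idr M). rewrite <- (unshift_v M O) at 1. apply wxh_step, st_gc_t. }
  destruct (classic (hv M = Some 0)) as [V|V]; [|simpl in NF'; tauto].
  destruct M as [x|P|P Q|C|P L|P L g]; simpl in V.
  - injection V as ->. eexists; apply wxh_step, st_var.
  - simpl in NF'; tauto.
  - eexists; apply wxh_step, st_app_t; auto.
  - destruct F as [F _]. destruct (cNF_nam C F) as (b&P&S).
    eexists. eapply wxh_scong; [apply sc_tsub, sc_mu; eauto|].
    apply wxh_step, st_mu_t. simpl. rewrite <- V.
    symmetry. apply (proj2 attr_scong _ _ S).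
  - eexists; apply wxh_step, st_tt. destruct (hv P) as [[|n]|]; inversion V; auto.
  - eexists; apply wxh_step, st_nt; auto.
Qed.

Lemma nsub_step M N g : NF M -> ~ NF (NSub M N g) -> exists L, wxh (NSub M N g) L.
Proof.
  intros F NF'.
  destruct (classic (tocc false 0 M)) as [O|O].
  2:{ exists (ren idr pred M). rewrite <- (unshift_n M O) at 1. apply wxh_step, st_gc_n. }
  destruct (classic (hn M = Some 0)) as [V|V]; [|simpl in NF'; tauto].
  destruct M as [x|P|P Q|C|P L|P L h]; simpl in V; try discriminate.
  - destruct F as [F _]. destruct (cNF_nam C F) as (b&P&S).
    destruct (proj2 attr_scong _ _ S) as (_&A&_). rewrite A in V; simpl in V.
    destruct b as [|b]; inversion V; subst.
    eexists. eapply wxh_scong; [apply sc_nsub, sc_mu; eauto|].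
    apply wxh_step, st_mu_n.
  - eexists; apply wxh_step, st_tn; auto.
  - eexists; apply wxh_step, st_nn. destruct (hn P) as [[|n]|]; inversion V; auto.
Qed.

Lemma progress :
  (forall M, NF M \/ exists N, wxh M N) /\ (forall C, cNF C \/ exists D, cwxh C D).
Proof.
  apply tm_cmd_ind.
  - left; exact I.
  - left; exact I.
  - intros P [F|[P' S]] Q _; [|right; eexists; apply wxh_app; eauto].
    destruct (classic (kind P = KVar)) as [K|K]; [left; split; auto|].
    right. apply app_not_var; auto.
  - intros C [F|[D S]]; [|right; eexists; apply wxh_mu; eauto].
    destruct (classic (chn C = Some 0 /\ ~ cocc false 0 C)) as [[E O]|E].
    2:{ left; split; auto. }
    right. destruct (cNF_nam C F) as (b&P&S).
    destruct (proj2 attr_scong _ _ S) as (_&A&_&OO). rewrite A in E; simpl in E.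
    injection E as ->. rewrite OO in O; simpl in O.
    exists (ren idr pred P). eapply wxh_scong; [apply sc_mu; eauto|].
    rewrite <- (unshift_n P O) at 1. apply wxh_step, st_eta.
  - intros P [F|[P' S]] Q _; [|right; eexists; apply wxh_tsub; eauto].
    destruct (classic (NF (TSub P Q))); [left; auto|].
    right. apply tsub_step; auto.
  - intros P [F|[P' S]] Q _ g; [|right; eexists; apply wxh_nsub; eauto].
    destruct (classic (NF (NSub P Q g))); [left; auto|].
    right. apply nsub_step; auto.
  - intros b P [F|[P' S]]; [|right; eexists; apply cwxh_nam; eauto].
    destruct (classic (kind P = KMu)) as [K|K]; [|left; split; auto].
    right. apply nam_mu; auto.
  - intros C [F|[D S]] N _; [|right; eexists; apply cwxh_tsub; eauto].
    destruct (classic (cNF (CTSub C N))) as [F'|F']; [left; auto|right].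
    destruct (cNF_nam C F) as (b&P&S).
    assert (S' : cscong (CTSub C N) (Nam b (TSub P N))).
    { eapply csc_trans; [apply csc_tsub; eauto|]. apply csc_sym, csc_t. }
    apply (cNF_cscong _ _ S) in F. rewrite (cNF_cscong _ _ S') in F'.
    destruct F as [F K]. destruct (tsub_step P N F) as [L T].
    { intros F2; apply F'; split; auto. }
    eexists. eapply cwxh_cscong; [apply S'|]. apply cwxh_nam; eauto.
  - intros C [F|[D S]] N _ g; [|right; eexists; apply cwxh_nsub; eauto].
    destruct (classic (cNF (CNSub C N g))) as [F'|F']; [left; auto|right].
    destruct (cNF_nam C F) as (b&P&S).
    destruct b as [|b].
    { eexists. eapply cwxh_cscong; [apply csc_nsub; eauto|]. apply cwxh_step, cst_n. }
    assert (S' : cscong (CNSub C N g) (Nam b (NSub P N g))).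
    { eapply csc_trans; [apply csc_nsub; eauto|]. apply csc_sym, csc_n. }
    apply (cNF_cscong _ _ S) in F. rewrite (cNF_cscong _ _ S') in F'.
    destruct F as [F K]. destruct (nsub_step P N g F) as [L T].
    { intros F2; apply F'; split; auto. }
    eexists. eapply cwxh_cscong; [apply S'|]. apply cwxh_nam; eauto.
Qed.

Lemma normal_NF M : wxh_normal M -> NF M.
Proof.
  intros N. destruct (proj1 progress M) as [|[L S]]; auto. destruct (N _ S).
Qed.

(** * Normal forms unfold to weak head normal forms *)

Lemma tocc_emb M : forall k n, tocc k n (emb M) <-> locc k n M.
Proof.
  induction M; simpl; intros k n.
  - tauto.
  - apply IHM.
  - rewrite IHM1, IHM2; tauto.
  - rewrite IHM. split; intros [[-> E]|O]; auto; left; split; auto; congruence.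
Qed.

Lemma tocc_pure N k n : pure N -> tocc k n N -> locc k n (tr N).
Proof. intros P O. rewrite (pure_tr N P) in O. apply tocc_emb; auto. Qed.

Lemma cNF_name C : cNF C -> chn C = Some (fst (ctr C)).
Proof.
  induction C as [b P|C IH N|C IH N g]; simpl; intros F; auto.
  - rewrite IH by tauto. destruct (ctr C); reflexivity.
  - destruct F as (F&_&E). rewrite (IH F) in *. destruct (ctr C) as [[|b] P]; simpl in *;
      [congruence|reflexivity].
Qed.

Lemma locc_tsb k n N P : locc k (bindv k n) P -> locc k n (tsb N P).
Proof.
  intros O. apply locc_gs. destruct k.
  - left. exists (S n); simpl; auto.
  - right. exists n; simpl; auto.
Qed.

Lemma locc_tsb_arg k n N P : locc true 0 P -> locc k n N -> locc k n (tsb N P).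
Proof. intros O ON. apply locc_gs. left. exists 0; simpl; auto. Qed.

Lemma locc_nsb k n N g P : locc k (bindn k n) P -> locc k n (nsb N g P).
Proof.
  intros O. apply locc_gs. destruct k.
  - left. exists n; simpl; auto.
  - right. exists (S n); simpl; auto.
Qed.

Lemma locc_nsb_arg k n N g P :
  locc false 0 P -> locc k n N \/ k = false /\ g = n -> locc k n (nsb N g P).
Proof.
  intros O [ON|[-> ->]]; apply locc_gs; right; exists 0; simpl; split; auto.
  right; eauto.
Qed.

(* All substitutions of a normal form are used, so an occurrence survives
   unfolding; hence eta-redexes are not created by unfolding. *)
Lemma NF_locc :
  (forall M, sp M -> NF M -> forall k n, tocc k n M -> locc k n (tr M)) /\
  (forall C, csp C -> cNF C -> forall k n, cocc k n C -> locc k n (snd (ctr C))).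
Proof.
  apply tm_cmd_ind; simpl.
  - auto.
  - intros P IP SP _ k n O. apply tocc_pure; auto.
  - intros P IP Q IQ [SP SQ] [FP K] k n [O|O]; [left; auto|right].
    apply tocc_pure; auto.
  - intros C IC SP [F _] k n O. specialize (IC SP F). apply cNF_name in F.
    destruct (ctr C) as [b P]; simpl in *. destruct O as [[-> E]|O]; auto.
    left; split; auto; congruence.
  - intros P IP N IN [SP SN] (F&O0&V) k n [O|O].
    + apply locc_tsb; auto.
    + apply locc_tsb_arg; auto. apply tocc_pure; auto.
  - intros P IP N IN g [SP SN] (F&O0&V) k n [O|O].
    + apply locc_nsb; auto.
    + apply locc_nsb_arg; auto. destruct O; auto. left; apply tocc_pure; auto.
  - intros b P IP SP [F K]. auto.
  - intros C IC N IN [SP SN] (F&O0&V) k n O. specialize (IC SP F).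
    destruct (ctr C) as [b P]; simpl in *. destruct O as [O|O].
    + apply locc_tsb; auto.
    + apply locc_tsb_arg; auto. apply tocc_pure; auto.
  - intros C IC N IN g [SP SN] (F&O0&V) k n O. specialize (IC SP F).
    destruct (ctr C) as [b P]; simpl in *. apply locc_lapps_hd. destruct O as [O|O].
    + apply locc_nsb; auto.
    + apply locc_nsb_arg; auto. destruct O; auto. left; apply tocc_pure; auto.
Qed.

(** Here [o] stands for the head variable of the explicit term. It is left open for an abstraction,
    on which a substitution for the head variable may be stuck. *)
Definition nfb (o : option nat) (W : lm) : Prop :=
  (exists x l, W = lapps (LVar x) l /\ o = Some x) \/ (exists P, W = LLam P).

Lemma nfb_nfbody o W : nfb o W -> nfbody W.
Proof. intros [(x&l&->&_)|(P&->)]; [left|right]; eauto. Qed.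

Lemma nfb_tsb o N W : nfb o W -> o <> Some 0 \/ (exists P, W = LLam P) ->
  nfb (unbind o) (tsb N W).
Proof.
  intros [(x&l&->&->)|(P&->)] V.
  - destruct V as [V|[P V]]; [|destruct (lapps_var_not_lam _ _ _ V)].
    destruct x as [|x]; [congruence|]. left. unfold tsb. rewrite gs_lapps. simpl. eauto.
  - right. rewrite tsb_lam. eauto.
Qed.

Lemma nfb_nsb o N g W : nfb o W -> nfb o (nsb N g W).
Proof.
  intros [(x&l&->&->)|(P&->)].
  - left. unfold nsb. rewrite gs_lapps. simpl. eauto.
  - right. rewrite nsb_lam. eauto.
Qed.

Lemma nfb_lren_names o g W : nfb o W -> nfb o (lren idr g W).
Proof.
  intros [(x&l&->&->)|(P&->)].
  - left. rewrite lren_lapps. simpl. eauto.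
  - right. simpl. eauto.
Qed.

(** The side conditions of [NF] say that no substitution is for the head variable of a
    variable-headed term or for the head name. Tracking both through the unfolding shows that it
    alters only arguments and bodies of abstractions, and the [KVar] equivalence keeps the two
    shapes apart. *)
Lemma NF_tr :
  (forall M, sp M -> NF M ->
    match kind M with
    | KVar | KLam => nfb (hv M) (tr M) /\ (kind M = KVar <-> exists x l, tr M = lapps (LVar x) l)
    | KMu => exists b W, tr M = LMu b W /\ nfb (hv M) W /\ hn M = unbind (Some b) /\
               (b <> 0 \/ locc false 0 W)
    end) /\
  (forall C, csp C -> cNF C -> nfb (chv C) (snd (ctr C)) /\
     (cbare C -> exists P, snd (ctr C) = LLam P)).
Proof.
  apply tm_cmd_ind; simpl.
  - intros x _ _. split; [left; exists x, []; auto|]. split; auto. exists x, []; auto.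
  - intros P _ _ _. split; [right; eauto|]. split; [discriminate|].
    intros (x&l&E). symmetry in E. destruct (lapps_var_not_lam _ _ _ E).
  - intros P IP Q _ [SP SQ] [F K]. specialize (IP SP F). rewrite K in *.
    destruct IP as [[(x&l&E&V)|(R&E)] I].
    + rewrite E. assert (X : LApp (lapps (LVar x) l) (tr Q) = lapps (LVar x) (l ++ [tr Q])).
      { rewrite lapps_app; reflexivity. }
      rewrite X. split; [left; eauto|]. split; eauto.
    + destruct (proj1 I eq_refl) as (x&l&E'). rewrite E in E'. symmetry in E'.
      destruct (lapps_var_not_lam _ _ _ E').
  - intros C IC SP [F E]. destruct (IC SP F) as [B _].
    pose proof (proj2 NF_locc C SP F false 0) as O. apply cNF_name in F.
    destruct (ctr C) as [b P]; simpl in *. exists b, P. rewrite F in *.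
    repeat split; auto. destruct b; auto. right. apply O.
    destruct (classic (cocc false 0 C)); tauto.
  - intros P IP N _ [SP SN] (F&O&V). specialize (IP SP F).
    assert (Lm : forall W, kind P = KVar \/ kind P = KLam -> W = tr P -> nfb (hv P) W /\ (kind P = KVar <-> (exists (x : nat) (l : list lm), W = lapps (LVar x) l)) ->
       nfb (unbind (hv P)) (tsb (tr N) W) /\ (kind P = KVar <-> (exists (x : nat) (l : list lm), tsb (tr N) W = lapps (LVar x) l))).
    { intros W K EW [B I]. split.
      - apply nfb_tsb; auto. destruct V as [V|V]; auto. right.
        destruct P; try contradiction. subst W; simpl; eauto.
      - rewrite I. destruct B as [(x&l&->&E)|(R&->)].
        + split; intros _; eauto. destruct x as [|x].
          * destruct V as [V|V]; [congruence|].
            destruct P; try contradiction. simpl in EW.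
            destruct (lapps_var_not_lam _ _ _ EW).
          * unfold tsb. rewrite gs_lapps; simpl; eauto.
        + rewrite tsb_lam. split; intros (x&l&E); symmetry in E;
            destruct (lapps_var_not_lam _ _ _ E). }
    destruct (kind P) eqn:K.
    + rewrite <- K in *. apply Lm; auto.
    + rewrite <- K in *. apply Lm; auto.
    + destruct IP as (b&W&E&B&A&L). rewrite E, tsb_mu. exists b, (tsb (lshiftn (tr N)) W).
      repeat split; auto.
      * apply nfb_tsb; auto. destruct V as [V|V]; auto.
        apply bare_kind in V. congruence.
      * destruct L; auto. right. apply locc_tsb; auto.
  - intros P IP N _ g [SP SN] (F&O&V). specialize (IP SP F).
    assert (Lm : forall W, nfb (hv P) W /\ (kind P = KVar <-> (exists (x : nat) (l : list lm), W = lapps (LVar x) l)) ->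
       nfb (hv P) (nsb (tr N) g W) /\ (kind P = KVar <-> (exists (x : nat) (l : list lm), nsb (tr N) g W = lapps (LVar x) l))).
    { intros W [B I]. split; [apply nfb_nsb; auto|].
      rewrite I. destruct B as [(x&l&->&E)|(R&->)].
        + split; intros _; eauto. unfold nsb. rewrite gs_lapps; simpl; eauto.
        + rewrite nsb_lam. split; intros (x&l&E); symmetry in E;
            destruct (lapps_var_not_lam _ _ _ E). }
    destruct (kind P) eqn:K.
    + rewrite <- K in *. apply Lm; auto.
    + rewrite <- K in *. apply Lm; auto.
    + destruct IP as (b&W&E&B&A&L). rewrite E, nsb_mu.
      (* The name bound by the substitution has index 1 below the mu; the condition on [hn] excludes
         it, so no argument is appended. *)
      assert (b = 0 \/ exists a, b = S (S a)) as [->|[a ->]].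
      { destruct b as [|[|a]]; eauto. rewrite A in V. simpl in V. congruence. }
      * exists 0. simpl. eexists; repeat split; [apply nfb_nsb, nfb_lren_names; auto|rewrite A; auto|].
        destruct L as [L|L]; [congruence|]. right.
        apply locc_nsb. apply (locc_ren _ _ _ idr swap01) in L. auto.
      * exists (S a). simpl. eexists; repeat split; [apply nfb_nsb, nfb_lren_names; auto|rewrite A; auto|].
        left; discriminate.
  - intros b P IP SP [F K]. specialize (IP SP F).
    split; [destruct (kind P); tauto|]. intros B. destruct P; try contradiction.
    simpl; eauto.
  - intros C IC N _ [SP SN] (F&O&V). destruct (IC SP F) as [B L].
    destruct (ctr C) as [b P]; simpl in *. split; [|tauto].
    apply nfb_tsb; tauto.
  - intros C IC N _ g [SP SN] (F&O&V). destruct (IC SP F) as [B L].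
    apply cNF_name in F.
    destruct (ctr C) as [b P]; simpl in *. rewrite F in V. destruct b; [congruence|].
    simpl. split; [|tauto]. apply nfb_nsb; auto.
Qed.

Lemma NF_nform M : sp M -> NF M -> nform (tr M).
Proof.
  intros SP F. pose proof (proj1 NF_tr M SP F) as T. destruct (kind M).
  - left. eapply nfb_nfbody; apply T.
  - left. eapply nfb_nfbody; apply T.
  - destruct T as (b&W&E&B&_&L). right. exists b, W. rewrite lfn_locc.
    eauto using nfb_nfbody.
Qed.

(** * The shape of normal forms *)

Lemma subs_app s : forall M s', subs M (s ++ s') = subs (subs M s) s'.
Proof. induction s as [|[N|N g] s IH]; simpl; intros; auto. Qed.

Lemma tr_subs s : forall M M', tr M = tr M' -> tr (subs M s) = tr (subs M' s).
Proof.
  induction s as [|[N|N g] s IH]; simpl; intros; auto; apply IH; simpl; congruence.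
Qed.

Lemma sp_subs s : forall M, sp (subs M s) <->
  sp M /\ Forall (fun e => match e with ET N | EN N _ => pure N end) s.
Proof.
  induction s as [|[N|N g] s IH]; simpl; intros.
  - intuition.
  - rewrite IH; simpl. rewrite Forall_cons_iff. tauto.
  - rewrite IH; simpl. rewrite Forall_cons_iff. tauto.
Qed.

Lemma outv_app s s' x : outv (s ++ s') x = outv s (outv s' x).
Proof. induction s as [|[N|N g] s IH]; simpl; auto. Qed.

Lemma outn_app s s' x : outn (s ++ s') x = outn s (outn s' x).
Proof. induction s as [|[N|N g] s IH]; simpl; auto. Qed.

Lemma apps_snoc M l Q : apps M (l ++ [Q]) = App (apps M l) Q.
Proof. unfold apps. rewrite fold_left_app. reflexivity. Qed.

Lemma app_subs s : forall M Q, exists Q', scong (App (subs M s) Q) (subs (App M Q') s).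
Proof.
  induction s as [|[N|N g] s IH] using rev_ind; intros M Q.
  - exists Q. constructor.
  - destruct (IH M (shiftv Q)) as [Q' S]. exists Q'. rewrite !subs_app. simpl.
    eapply sc_trans; [apply sc_app_t|]. apply sc_tsub; auto.
  - destruct (IH M (shiftn Q)) as [Q' S]. exists Q'. rewrite !subs_app. simpl.
    eapply sc_trans; [apply sc_app_n|]. apply sc_nsub; auto.
Qed.

(** Brings a normal form into the shape required by [wxh_clause]. The conditions on [hv] and [hn]
    guarantee that the head variable or name comes from outside the collected substitutions, which
    is what [outv] and [mu_outn] express. *)
Lemma NF_shape M : NF M -> exists P s, scong M (subs P s) /\
  match kind M with
  | KVar => exists x l, hv M = Some x /\ P = apps (Var (outv s x)) l
  | KLam => exists Q, P = Lam Q
  | KMu => exists b Q, hn M = unbind (Some b) /\ P = Mu (Nam (mu_outn s b) Q)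
  end.
Proof.
  induction M as [x|P _|P IP Q _|C|P IP N _|P IP N _ g]; simpl.
  - intros _. exists (Var x), []. split; [constructor|]. exists x, []; auto.
  - intros _. exists (Lam P), []. split; [constructor|eauto].
  - intros [F K]. rewrite K. destruct (IP F) as (R&s&SC&T). rewrite K in T.
    destruct T as (x&l&V&->). destruct (app_subs s (apps (Var (outv s x)) l) Q) as [Q' S'].
    exists (apps (Var (outv s x)) (l ++ [Q'])), s. split.
    + rewrite apps_snoc. eapply sc_trans; [apply sc_appl; eauto|]. auto.
    + eauto.
  - intros [F _]. destruct (cNF_nam C F) as (b&P&S).
    exists (Mu (Nam b P)), []. split; [apply sc_mu; auto|].
    exists b, P. destruct (proj2 attr_scong _ _ S) as (_&->&_).
    split; auto. destruct b; reflexivity.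
  - intros (F&_&V). destruct (IP F) as (R&s&SC&T).
    exists R, (s ++ [ET N]). split.
    { rewrite subs_app; simpl. apply sc_tsub; auto. }
    destruct (kind P) eqn:K.
    + destruct T as (x&l&E&->). destruct x as [|x].
      * destruct V as [V|V]; [congruence|]. apply bare_kind in V; congruence.
      * exists x, l. rewrite E, outv_app. auto.
    + auto.
    + destruct T as (b&Q&E&->). exists b, Q. split; auto.
      destruct b; auto. simpl. rewrite outn_app. reflexivity.
  - intros (F&_&V). destruct (IP F) as (R&s&SC&T).
    exists R, (s ++ [EN N g]). split.
    { rewrite subs_app; simpl. apply sc_nsub; auto. }
    destruct (kind P) eqn:K.
    + destruct T as (x&l&E&->).
      exists x, l. rewrite E, outv_app. auto.
    + auto.
    + destruct T as (b&Q&E&->). rewrite E in *. destruct b as [|[|b]]; simpl in *.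
      * exists 0, Q. split; auto.
      * congruence.
      * exists (S b), Q. split; auto. simpl. rewrite outn_app. reflexivity.
Qed.

(** This equation and the two that follow match the three shapes in [wxh_clause] with those in
    [wh_clause]: moving a binder across the substitutions is invisible after unfolding. *)
Lemma tr_subs_lam s : forall M, tr (subs (Lam M) s) = LLam (tr (lam_subs M s)).
Proof.
  induction s as [|[N|N g] s IH]; simpl; intros M; auto; rewrite <- IH;
    apply tr_subs; simpl; rewrite tr_shiftv.
  - rewrite tr_ren. apply tsb_lam.
  - apply nsb_lam.
Qed.

Lemma tr_subs_apps s x l :
  tr (subs (apps (Var (outv s x)) l) s) = lapps (LVar x) (map (fun M => tr (subs M s)) l).
Proof.
  assert (A : forall M l, tr (subs (apps M l) s) =
             lapps (tr (subs M s)) (map (fun M => tr (subs M s)) l)).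
  { clear. intros M l. revert M. induction l as [|Q l IH]; simpl; intros M; auto.
    rewrite IH. f_equal. revert M Q. clear.
    induction s as [|[N|N g] s IH]; simpl; intros M Q; auto.
    - rewrite <- IH. apply tr_subs. reflexivity.
    - rewrite <- IH. apply tr_subs. reflexivity. }
  rewrite A. f_equal. clear. induction s as [|[N|N g] s IH]; simpl; auto.
  - rewrite <- IH. apply tr_subs. reflexivity.
  - rewrite <- IH. apply tr_subs. reflexivity.
Qed.

Lemma tr_subs_mu s : forall b M,
  tr (subs (Mu (Nam (mu_outn s b) M)) s) = LMu b (tr (mu_subs M s)).
Proof.
  induction s as [|[N|N g] s IH]; simpl; intros b M.
  - destruct b; reflexivity.
  - rewrite <- IH. apply tr_subs. simpl. rewrite tsb_mu, tr_shiftn. reflexivity.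
  - rewrite <- IH. apply tr_subs. simpl. rewrite nsb_mu, tr_shiftn, tr_ren.
    destruct b; reflexivity.
Qed.

Lemma sp_lam_subs s : forall M, sp (lam_subs M s) <->
  sp M /\ Forall (fun e => match e with ET N | EN N _ => pure N end) s.
Proof.
  induction s as [|[N|N g] s IH]; simpl; intros.
  - intuition.
  - rewrite IH, Forall_cons_iff; simpl. rewrite sp_ren, pure_shiftv. tauto.
  - rewrite IH, Forall_cons_iff; simpl. rewrite pure_shiftv. tauto.
Qed.

Lemma sp_mu_subs s : forall M, sp (mu_subs M s) <->
  sp M /\ Forall (fun e => match e with ET N | EN N _ => pure N end) s.
Proof.
  induction s as [|[N|N g] s IH]; simpl; intros.
  - intuition.
  - rewrite IH, Forall_cons_iff; simpl. rewrite pure_shiftn. tauto.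
  - rewrite IH, Forall_cons_iff; simpl. rewrite sp_ren, pure_shiftn. tauto.
Qed.

Lemma sp_apps l : forall M, sp (apps M l) <-> sp M /\ Forall pure l.
Proof.
  induction l as [|Q l IH]; simpl; intros.
  - intuition.
  - rewrite IH, Forall_cons_iff; simpl. tauto.
Qed.

(** * Existence of normal forms *)

(** With [scong] and [step] as separate generators, sequences are easily built frame by frame;
    [ws_wxhs] returns to [wxhs], up to a final [scong]. *)
Definition ws : relation tm := clos_refl_trans tm (fun M N => scong M N \/ step M N).
Definition cws : relation cmd := clos_refl_trans cmd (fun C D => cscong C D \/ cstep C D).

Lemma ws_scong M N : scong M N -> ws M N.
Proof. intros; apply rt_step; auto. Qed.
Lemma ws_step M N : step M N -> ws M N.
Proof. intros; apply rt_step; auto. Qed.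
Lemma ws_refl M : ws M M.
Proof. apply rt_refl. Qed.
Lemma ws_trans M N P : ws M N -> ws N P -> ws M P.
Proof. apply rt_trans. Qed.
Lemma cws_scong M N : cscong M N -> cws M N.
Proof. intros; apply rt_step; auto. Qed.
Lemma cws_step M N : cstep M N -> cws M N.
Proof. intros; apply rt_step; auto. Qed.
Lemma cws_refl M : cws M M.
Proof. apply rt_refl. Qed.
Lemma cws_trans M N P : cws M N -> cws N P -> cws M P.
Proof. apply rt_trans. Qed.

Lemma ws_app M N L : ws M N -> ws (App M L) (App N L).
Proof.
  induction 1 as [? ? [?|?]| |]; [apply ws_scong, sc_appl; auto
    |apply ws_step, st_appl; auto|apply ws_refl|eapply ws_trans; eauto].
Qed.
Lemma ws_tsub M N L : ws M N -> ws (TSub M L) (TSub N L).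
Proof.
  induction 1 as [? ? [?|?]| |]; [apply ws_scong, sc_tsub; auto
    |apply ws_step, st_tsub; auto|apply ws_refl|eapply ws_trans; eauto].
Qed.
Lemma ws_nsub M N L g : ws M N -> ws (NSub M L g) (NSub N L g).
Proof.
  induction 1 as [? ? [?|?]| |]; [apply ws_scong, sc_nsub; auto
    |apply ws_step, st_nsub; auto|apply ws_refl|eapply ws_trans; eauto].
Qed.
Lemma ws_mu C D : cws C D -> ws (Mu C) (Mu D).
Proof.
  induction 1 as [? ? [?|?]| |]; [apply ws_scong, sc_mu; auto
    |apply ws_step, st_mubody; auto|apply ws_refl|eapply ws_trans; eauto].
Qed.
Lemma cws_nam b M N : ws M N -> cws (Nam b M) (Nam b N).
Proof.
  induction 1 as [? ? [?|?]| |]; [apply cws_scong, csc_nam; auto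
    |apply cws_step, cst_nam; auto|apply cws_refl|eapply cws_trans; eauto].
Qed.
Lemma cws_tsub M N L : cws M N -> cws (CTSub M L) (CTSub N L).
Proof.
  induction 1 as [? ? [?|?]| |]; [apply cws_scong, csc_tsub; auto
    |apply cws_step, cst_tsub; auto|apply cws_refl|eapply cws_trans; eauto].
Qed.
Lemma cws_nsub M N L g : cws M N -> cws (CNSub M L g) (CNSub N L g).
Proof.
  induction 1 as [? ? [?|?]| |]; [apply cws_scong, csc_nsub; auto
    |apply cws_step, cst_nsub; auto|apply cws_refl|eapply cws_trans; eauto].
Qed.

Lemma sp_ws M N : ws M N -> sp M -> sp N.
Proof.
  induction 1 as [M N [S|S]| |]; auto.
  - apply (sp_scong _ _ S).
  - apply (proj1 sp_step_cstep _ _ S).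
Qed.

Lemma ws_bts M N : ws M N -> bts (hdt (tr M)) (hdt (tr N)).
Proof.
  induction 1 as [M N [S|S]| |].
  - rewrite (tr_scong _ _ S). apply rt_refl.
  - destruct (proj1 step_bt0 _ _ S) as [->|]; [apply rt_refl|apply rt_step; auto].
  - apply rt_refl.
  - eapply rt_trans; eauto.
Qed.

Lemma ws_wxhs M N : ws M N -> exists N', wxhs M N' /\ scong N' N.
Proof.
  intros R. apply clos_rt_rtn1 in R. induction R as [|N P [S|S] _ (N'&R&C)].
  - exists M. split; [apply rt_refl|apply sc_refl].
  - exists N'. split; auto. eapply sc_trans; eauto.
  - exists P. split; [|apply sc_refl]. eapply rt_trans; [exact R|].
    apply rt_step. eapply wxh_scong; [exact C|]. apply wxh_step; auto.
Qed.

(** The head beta steps in isolation: each is a genuine [bt] step on triples, while [step_bt0] only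
    gives a [bt] step or an equality. *)
Inductive bstep : tm -> tm -> Prop :=
| bs_beta M N : bstep (App (Lam M) N) (TSub M N)
| bs_app M M' L : bstep M M' -> bstep (App M L) (App M' L)
| bs_mu C C' : cbstep C C' -> bstep (Mu C) (Mu C')
| bs_tsub M M' L : bstep M M' -> bstep (TSub M L) (TSub M' L)
| bs_nsub M M' L g : bstep M M' -> bstep (NSub M L g) (NSub M' L g)
with cbstep : cmd -> cmd -> Prop :=
| cbs_nam b M M' : bstep M M' -> cbstep (Nam b M) (Nam b M')
| cbs_tsub C C' L : cbstep C C' -> cbstep (CTSub C L) (CTSub C' L)
| cbs_nsub C C' L g : cbstep C C' -> cbstep (CNSub C L g) (CNSub C' L g).

Scheme bstep_mind := Minimality for bstep Sort Prop
  with cbstep_mind := Minimality for cbstep Sort Prop.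
Combined Scheme bstep_cbstep_ind from bstep_mind, cbstep_mind.

Lemma bstep_step :
  (forall M N, bstep M N -> step M N) /\ (forall C D, cbstep C D -> cstep C D).
Proof. apply bstep_cbstep_ind; intros; constructor; auto. Qed.

Lemma bstep_bt :
  (forall M N, bstep M N -> bt (hdt (tr M)) (hdt (tr N))) /\
  (forall C D, cbstep C D -> bt (hdc (ctr C)) (hdc (ctr D))).
Proof.
  apply bstep_cbstep_ind; intros.
  - apply bt_hdt_beta.
  - apply bt_tact; auto.
  - rewrite !hdt_mu; auto.
  - rewrite !hdt_tsub. apply bt_sact; auto.
  - rewrite !hdt_nsub. apply bt_tact; auto.
  - rewrite !hdc_nam. apply bt_tact; auto.
  - rewrite !hdc_tsub. apply bt_sact; auto.
  - rewrite !hdc_nsub. apply bt_tact; auto.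
Qed.

(* A beta step can be reached; this decreases the head triple along [bt]. *)
Definition breach (M : tm) : Prop := exists N N', ws M N /\ bstep N N'.
Definition cbreach (C : cmd) : Prop := exists D D', cws C D /\ cbstep D D'.

Lemma breach_ws M N : ws M N -> breach N -> breach M.
Proof. intros R (P&P'&R'&B). exists P, P'. split; auto. eapply ws_trans; eauto. Qed.
Lemma cbreach_ws M N : cws M N -> cbreach N -> cbreach M.
Proof. intros R (P&P'&R'&B). exists P, P'. split; auto. eapply cws_trans; eauto. Qed.
Lemma breach_app M L : breach M -> breach (App M L).
Proof. intros (P&P'&R&B). exists (App P L), (App P' L). split; [apply ws_app; auto|constructor; auto]. Qed.
Lemma breach_tsub M L : breach M -> breach (TSub M L).
Proof. intros (P&P'&R&B). exists (TSub P L), (TSub P' L). split; [apply ws_tsub; auto|constructor; auto]. Qed.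
Lemma breach_nsub M L g : breach M -> breach (NSub M L g).
Proof. intros (P&P'&R&B). exists (NSub P L g), (NSub P' L g). split; [apply ws_nsub; auto|constructor; auto]. Qed.
Lemma breach_mu C : cbreach C -> breach (Mu C).
Proof. intros (P&P'&R&B). exists (Mu P), (Mu P'). split; [apply ws_mu; auto|constructor; auto]. Qed.
Lemma cbreach_nam b M : breach M -> cbreach (Nam b M).
Proof. intros (P&P'&R&B). exists (Nam b P), (Nam b P'). split; [apply cws_nam; auto|constructor; auto]. Qed.
Lemma cbreach_tsub M L : cbreach M -> cbreach (CTSub M L).
Proof. intros (P&P'&R&B). exists (CTSub P L), (CTSub P' L). split; [apply cws_tsub; auto|constructor; auto]. Qed.
Lemma cbreach_nsub M L g : cbreach M -> cbreach (CNSub M L g).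
Proof. intros (P&P'&R&B). exists (CNSub P L g), (CNSub P' L g). split; [apply cws_nsub; auto|constructor; auto]. Qed.

(** ** Normal forms except for garbage collection and eta *)

(* The kind of the term below all frames, including the mu. *)
Fixpoint core (M : tm) : hkind :=
  match M with
  | Var _ => KVar
  | Lam _ => KLam
  | Mu C => ccore C
  | App P _ | TSub P _ | NSub P _ _ => core P
  end
with ccore (C : cmd) : hkind :=
  match C with Nam _ M => core M | CTSub D _ | CNSub D _ _ => ccore D end.

(* As [NF], but unused substitutions and eta-redexes are allowed. Removing these
   does not leave [NF0] and decreases the size. *)
Inductive NF0 : tm -> Prop :=
| n0_var x : NF0 (Var x)
| n0_lam P : NF0 (Lam P)
| n0_app P Q : NF0 P -> kind P = KVar -> NF0 (App P Q)
| n0_tsub P N : NF0 P -> hv P <> Some 0 \/ bare P -> NF0 (TSub P N)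
| n0_nsub P N g : NF0 P -> hn P <> Some 0 -> NF0 (NSub P N g)
| n0_mu b P : NF0 P -> kind P <> KMu -> NF0 (Mu (Nam b P)).

Lemma kind_ren M : forall f g, kind (ren f g M) = kind M.
Proof. induction M; simpl; auto. Qed.

Lemma core_ren : (forall M f g, core (ren f g M) = core M) /\
  (forall C f g, ccore (cren f g C) = ccore C).
Proof. apply tm_cmd_ind; simpl; auto. Qed.

Lemma option_map_idr (o : option nat) : option_map idr o = o.
Proof. destruct o; reflexivity. Qed.

Lemma option_map_upr f (o : option nat) : option_map (upr f) o = Some 0 -> o = Some 0.
Proof. destruct o as [[|n]|]; simpl; congruence. Qed.

Lemma NF0_ren M : NF0 M -> forall f g, NF0 (ren f g M).
Proof.
  induction 1 as [x|P|P Q F IH K|P N F IH V|P N g F IH V|b P F IH K]; simpl; intros.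
  - constructor.
  - constructor.
  - constructor; auto. rewrite kind_ren; auto.
  - constructor; auto. destruct V as [V|V]; [left|right].
    + rewrite hv_ren. intros E; apply V. eapply option_map_upr; eauto.
    + destruct P; simpl in *; tauto.
  - constructor; auto. rewrite hn_ren. intros E; apply V. eapply option_map_upr; eauto.
  - constructor; auto. rewrite kind_ren; auto.
Qed.

Lemma core_kind M : kind M <> KMu -> core M = kind M.
Proof. induction M; simpl; auto. congruence. Qed.

Lemma core_cases : (forall M, core M = KVar \/ core M = KLam) /\
  (forall C, ccore C = KVar \/ ccore C = KLam).
Proof. apply tm_cmd_ind; simpl; auto. Qed.

Fixpoint tsize (M : tm) : nat :=
  match M with
  | Var _ => 0
  | Lam P => S (tsize P)
  | App P Q => S (tsize P + tsize Q)
  | Mu C => S (csize C)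
  | TSub P _ => S (tsize P)
  | NSub P _ _ => S (tsize P)
  end
with csize (C : cmd) : nat :=
  match C with
  | Nam _ P => S (tsize P)
  | CTSub D _ => S (csize D)
  | CNSub D _ _ => S (csize D)
  end.

Lemma tsize_ren : (forall M f g, tsize (ren f g M) = tsize M) /\
  (forall C f g, csize (cren f g C) = csize C).
Proof. apply tm_cmd_ind; simpl; auto. Qed.

(* By the side conditions on [hv], the substitution for the head variable of an
   abstraction is copied once, to the innermost position, where it is stuck. *)
Lemma push_lam n : forall P N, tsize P <= n -> NF0 P -> hv P = Some 0 -> core P = KLam ->
  exists P', ws (TSub P N) P' /\ NF0 P' /\ hv P' = None /\ core P' = KLam /\
    hn P' = hn P /\ kind P' = kind P.
Proof.
  induction n as [|n IH]; intros P N Sz F V K.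
  { destruct P; simpl in *; try lia. discriminate. }
  destruct F as [x|P|P Q F Kd|P L F W|P L g F W|b P F Kd]; simpl in *.
  - discriminate.
  - exists (TSub (Lam P) N). simpl. rewrite V. repeat split; auto using ws_refl.
    constructor; [constructor|right; exact I].
  - rewrite core_kind in K; congruence.
  - assert (V' : hv P = Some 1) by (destruct (hv P) as [[|m]|]; inversion V; auto).
    destruct (IH (ren pull1 idr P) (shiftv (shiftv N))) as (P'&R&F'&Vn&Kc&A&Kd).
    + rewrite (proj1 tsize_ren); lia.
    + apply NF0_ren; auto.
    + rewrite hv_ren, V'; auto.
    + rewrite (proj1 core_ren); auto.
    + exists (TSub (TSub P' L) N). rewrite hn_ren, option_map_idr in A.
      rewrite kind_ren in Kd. simpl. rewrite Vn. repeat split; auto.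
      * eapply ws_trans; [apply ws_step, st_tt; auto|]. apply ws_tsub, ws_tsub; auto.
      * constructor; [constructor; auto|]; left; simpl; rewrite Vn; discriminate.
  - destruct (IH (ren (upr S) idr P) (shiftv (shiftn N))) as (P'&R&F'&Vn&Kc&A&Kd).
    + rewrite (proj1 tsize_ren); lia.
    + apply NF0_ren; auto.
    + rewrite hv_ren, V; auto.
    + rewrite (proj1 core_ren); auto.
    + exists (TSub (NSub P' L g) N). rewrite hn_ren, option_map_idr in A.
      rewrite kind_ren in Kd. simpl. rewrite Vn, A. repeat split; auto.
      * eapply ws_trans; [apply ws_step, st_nt; auto|]. apply ws_tsub, ws_nsub; auto.
      * constructor; [constructor; auto; congruence|]. left; simpl; rewrite Vn; discriminate.
  - destruct (IH P (shiftn N)) as (P'&R&F'&Vn&Kc&A&Kd'); auto; try lia.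
    exists (Mu (Nam b P')). simpl. repeat split; auto.
    + eapply ws_trans; [apply ws_step, st_mu_t; auto|]. apply ws_mu, cws_nam; auto.
    + constructor; auto. congruence.
Qed.

(** With [nsub_out], [app_out] and [nam_out], this adds one frame around an [NF0] term. The
    attributes that are tracked ([core], [hv], [hn], [kind]) are those on which the side conditions
    for the next frame depend. *)
Lemma tsub_out Q N : NF0 Q -> (core Q = KVar -> hv Q <> Some 0) ->
  exists P', ws (TSub Q N) P' /\ NF0 P' /\ core P' = core Q /\
    (core Q = KVar -> hv P' = unbind (hv Q)) /\ hn P' = hn Q /\ kind P' = kind Q.
Proof.
  intros F V. destruct (classic (hv Q = Some 0)) as [E|E].
  - destruct (proj1 core_cases Q) as [K|K]; [destruct (V K E)|].
    destruct (push_lam _ Q N (le_n _) F E K) as (P'&R&F'&_&Kc&A&Kd).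
    exists P'. repeat split; auto; congruence.
  - exists (TSub Q N). repeat split; auto using ws_refl. constructor; auto.
Qed.

Lemma lam_breach Q : forall A, NF0 Q -> kind Q = KLam -> breach (App Q A).
Proof.
  induction Q as [x|P _|P IP L _|C|P IP L _|P IP L _ g]; simpl; intros A F K;
    try discriminate; inversion F; subst.
  - exists (App (Lam P) A), (TSub P A). split; [apply ws_refl|constructor].
  - congruence.
  - eapply breach_ws; [apply ws_scong, sc_app_t|]. apply breach_tsub; auto.
  - eapply breach_ws; [apply ws_scong, sc_app_n|]. apply breach_nsub; auto.
Qed.

Lemma app_simple Q A : NF0 Q -> kind Q <> KMu -> NF0 (App Q A) \/ breach (App Q A).
Proof.
  intros F K. destruct (kind Q) eqn:E.
  - left. constructor; auto.
  - right. apply lam_breach; auto.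
  - congruence.
Qed.

Definition nsubn (g : nat) (o : option nat) : option nat :=
  match o with Some 0 => Some g | _ => unbind o end.

(** A substitution for the head name is copied inward up to the mu, where it supplies its argument.
    If the body there has an abstraction at its head, the new application leads to a beta step,
    whence the first alternative. The induction is on the size because the rules rename the term
    they enter. *)
Lemma nsub_out n : forall Q N g, tsize Q <= n -> NF0 Q ->
  breach (NSub Q N g) \/
  exists P', ws (NSub Q N g) P' /\ NF0 P' /\ core P' = core Q /\
    (core Q = KVar -> hv P' = hv Q) /\ hn P' = nsubn g (hn Q) /\ kind P' = kind Q.
Proof.
  induction n as [|n IH]; intros Q N g Sz F.
  { right. exists (NSub Q N g). destruct Q; simpl in Sz; try lia.
    repeat split; auto using ws_refl. constructor; auto. simpl; discriminate. }
  destruct (classic (hn Q = Some 0)) as [E|E].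
  2:{ right. exists (NSub Q N g). repeat split; auto using ws_refl.
      - constructor; auto.
      - simpl. destruct (hn Q) as [[|m]|]; auto. congruence. }
  rewrite E. destruct F as [x|P|P Q F Kd|P L F W|P L h F W|b P F Kd]; simpl in *;
    try discriminate.
  - destruct (IH (ren idr (upr S) P) (shiftv (shiftn N)) (S g)) as [B|(P1&R&F'&Kc&V&A&Kd)].
    + rewrite (proj1 tsize_ren); lia.
    + apply NF0_ren; auto.
    + left. eapply breach_ws; [apply ws_step, st_tn; auto|].
      apply breach_nsub, breach_tsub; auto.
    + rewrite (proj1 core_ren), hv_ren, option_map_idr, hn_ren, kind_ren, E in *.
      simpl in A. destruct (tsub_out P1 L F') as (P2&R2&F2&Kc2&V2&A2&Kd2).
      { intros K. rewrite V by congruence. destruct W as [W|W]; auto.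
        apply bare_kind in W. rewrite Kc, core_kind in K; congruence. }
      right. exists (NSub P2 N g). simpl. rewrite A2, A. repeat split; try congruence.
      * eapply ws_trans; [apply ws_step, st_tn; auto|]. apply ws_nsub.
        eapply ws_trans; [apply ws_tsub; eauto|]. auto.
      * constructor; auto. congruence.
      * intros K. rewrite V2, V; congruence.
  - assert (E' : hn P = Some 1) by (destruct (hn P) as [[|m]|]; inversion E; auto).
    destruct (IH (ren idr pull1 P) (shiftn (shiftn N)) (S (S g))) as [B|(P1&R&F'&Kc&V&A&Kd)].
    + rewrite (proj1 tsize_ren); lia.
    + apply NF0_ren; auto.
    + left. eapply breach_ws; [apply ws_step, st_nn; auto|].
      apply breach_nsub, breach_nsub; auto.
    + rewrite (proj1 core_ren), hv_ren, option_map_idr, hn_ren, kind_ren, E' in *.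
      simpl in A. right. exists (NSub (NSub P1 L h) N g). simpl. rewrite A. simpl.
      repeat split; auto.
      * eapply ws_trans; [apply ws_step, st_nn; auto|]. apply ws_nsub, ws_nsub; auto.
      * constructor; [constructor; auto; congruence|]. simpl. rewrite A. discriminate.
  - destruct b as [|b]; [discriminate|]. injection E as ->.
    assert (F' : NF0 (NSub (ren idr swap01 P) (shiftn N) (S g))).
    { constructor; [apply NF0_ren; auto|]. rewrite hn_kind; [discriminate|].
      rewrite kind_ren; auto. }
    destruct (app_simple _ (shiftn N) F') as [F2|B].
    + simpl. rewrite kind_ren; auto.
    + right. eexists. split; [apply ws_step, st_mu_n|].
      simpl. rewrite (proj1 core_ren), hv_ren, option_map_idr. repeat split; auto.
      constructor; auto. simpl. rewrite kind_ren; auto.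
    + left. eapply breach_ws; [apply ws_step, st_mu_n|]. apply breach_mu, cbreach_nam; auto.
Qed.

Lemma app_out Q : forall A, NF0 Q ->
  breach (App Q A) \/
  exists P', ws (App Q A) P' /\ NF0 P' /\ core P' = core Q /\
    (core Q = KVar -> hv P' = hv Q) /\ hn P' = hn Q /\ kind P' = kind Q.
Proof.
  induction Q as [x|P _|P IP L _|C|P IP L _|P IP L _ g]; intros A F;
    match goal with |- context [App ?Q A] => destruct (classic (kind Q = KMu)) as [K|K];
    [|destruct (app_simple _ A F K); [right; exists (App Q A);
      rewrite (hn_kind Q K); repeat split; auto using ws_refl|left; auto]] end;
    simpl in K; try discriminate.
  - inversion F; congruence.
  - inversion F as [| | | | |b P F' Kd]; subst.
    assert (F2 : forall f g, NF0 (NSub (ren f g P) (shiftn A) 0)).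
    { intros. constructor; [apply NF0_ren; auto|]. rewrite hn_kind; [discriminate|].
      rewrite kind_ren; auto. }
    (* For [b = 0] the command is named by the bound name of the mu, so [cst_n] supplies the
       argument; otherwise the new substitution is merely collected below the naming. *)
    destruct b as [|b].
    + destruct (app_simple _ (shiftn A) (F2 idr (upr S))) as [F3|B].
      * simpl. rewrite kind_ren; auto.
      * right. eexists. split.
        { eapply ws_trans; [apply ws_step, st_mu|]. apply ws_mu, cws_step, cst_n. }
        simpl. rewrite (proj1 core_ren), hv_ren, option_map_idr. repeat split; auto.
        constructor; auto. simpl. rewrite kind_ren; auto.
      * left. eapply breach_ws.
        { eapply ws_trans; [apply ws_step, st_mu|]. apply ws_mu, cws_step, cst_n. }
        apply breach_mu, cbreach_nam; auto.
    + right. eexists. split.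
      { eapply ws_trans; [apply ws_step, st_mu|].
        apply ws_mu, cws_scong, csc_sym, csc_n. }
      simpl. rewrite (proj1 core_ren), hv_ren, option_map_idr. repeat split; auto.
      constructor; auto. simpl. rewrite kind_ren; auto.
  - inversion F as [| | |P' L' F' W| |]; subst.
    destruct (IP (shiftv A) F') as [B|(P1&R&F1&Kc&V&A1&Kd)].
    + left. eapply breach_ws; [apply ws_scong, sc_app_t|]. apply breach_tsub; auto.
    + destruct (tsub_out P1 L F1) as (P2&R2&F2&Kc2&V2&A2&Kd2).
      { intros K'. rewrite V by congruence. destruct W as [W|W]; auto.
        apply bare_kind in W. congruence. }
      right. exists P2. simpl. repeat split; try congruence.
      * eapply ws_trans; [apply ws_scong, sc_app_t|].
        eapply ws_trans; [apply ws_tsub; eauto|auto].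
      * intros K'. rewrite V2, V; congruence.
  - inversion F as [| | | |P' L' g' F' W|]; subst.
    destruct (IP (shiftn A) F') as [B|(P1&R&F1&Kc&V&A1&Kd)].
    + left. eapply breach_ws; [apply ws_scong, sc_app_n|]. apply breach_nsub; auto.
    + right. exists (NSub P1 L g). simpl. repeat split; auto; try congruence.
      * eapply ws_trans; [apply ws_scong, sc_app_n|]. apply ws_nsub; auto.
      * constructor; congruence.
Qed.

Lemma nam_out Q : forall b, NF0 Q ->
  cbreach (Nam b Q) \/
  exists c P, cws (Nam b Q) (Nam c P) /\ NF0 P /\ kind P <> KMu /\ core P = core Q /\
    (core Q = KVar -> hv P = hv Q).
Proof.
  induction Q as [x|P _|P IP L _|C|P IP L _|P IP L _ g]; intros b F;
    match goal with |- context [Nam b ?Q] => destruct (classic (kind Q = KMu)) as [K|K];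
    [|right; exists b, Q; repeat split; auto using cws_refl] end;
    simpl in K; try discriminate.
  - inversion F; congruence.
  - inversion F as [| | | | |c P F' Kd]; subst.
    right. exists (scons b idr c), (ren idr (scons b idr) P).
    split; [apply cws_step, (cst_ren b (Nam c P))|].
    simpl. rewrite kind_ren, (proj1 core_ren), hv_ren, option_map_idr.
    repeat split; auto using NF0_ren.
  - inversion F as [| | |P' L' F' W| |]; subst.
    destruct (IP b F') as [B|(c&P1&R&F1&Kd&Kc&V)].
    + left. eapply cbreach_ws; [apply cws_scong, csc_t|]. apply cbreach_tsub; auto.
    + destruct (tsub_out P1 L F1) as (P2&R2&F2&Kc2&V2&A2&Kd2).
      { intros K'. rewrite V by congruence. destruct W as [W|W]; auto.
        apply bare_kind in W. congruence. }
      right. exists c, P2. simpl. repeat split; try congruence.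
      * eapply cws_trans; [apply cws_scong, csc_t|].
        eapply cws_trans; [apply cws_tsub; eauto|].
        eapply cws_trans; [apply cws_scong, csc_sym, csc_t|]. apply cws_nam; auto.
      * intros K'. rewrite V2, V; congruence.
  - inversion F as [| | | |P' L' g' F' W|]; subst.
    destruct (IP (S b) F') as [B|(c&P1&R&F1&Kd&Kc&V)].
    + left. eapply cbreach_ws; [apply cws_scong, csc_n|]. apply cbreach_nsub; auto.
    + assert (F2 : NF0 (NSub P1 L g)).
      { constructor; auto. rewrite hn_kind; auto. discriminate. }
      assert (R2 : cws (Nam b (NSub P L g)) (CNSub (Nam c P1) L g)).
      { eapply cws_trans; [apply cws_scong, csc_n|]. apply cws_nsub; auto. }
      destruct c as [|c].
      * assert (R3 : cws (Nam b (NSub P L g)) (Nam g (App (NSub P1 L g) L))).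
        { eapply cws_trans; [exact R2|]. apply cws_step, cst_n. }
        destruct (app_simple _ L F2) as [F3|B]; auto.
        -- right. exists g, (App (NSub P1 L g) L). repeat split; auto.
        -- left. eapply cbreach_ws; [exact R3|]. apply cbreach_nam; auto.
      * right. exists c, (NSub P1 L g). repeat split; auto.
        eapply cws_trans; [exact R2|]. apply cws_scong, csc_sym, csc_n.
Qed.

(** ** Evaluation contexts *)

Inductive frame :=
| FA (Q : tm)
| FT (N : tm)
| FN (N : tm) (g : nat)
| FM (b : nat).

Definition fill1 (M : tm) (f : frame) : tm :=
  match f with
  | FA Q => App M Q
  | FT N => TSub M N
  | FN N g => NSub M N g
  | FM b => Mu (Nam b M)
  end.

(* The head of the list is the innermost frame. *)
Definition fill (M : tm) (E : list frame) : tm := fold_left fill1 E M.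

Fixpoint nv (E : list frame) : nat :=
  match E with
  | [] => 0
  | FT _ :: E => S (nv E)
  | _ :: E => nv E
  end.

Lemma fill_app M E E' : fill M (E ++ E') = fill (fill M E) E'.
Proof. apply fold_left_app. Qed.

Lemma nv_app E E' : nv (E ++ E') = nv E + nv E'.
Proof. induction E as [|[] E IH]; simpl; auto. Qed.

Lemma ws_fill E : forall M N, ws M N -> ws (fill M E) (fill N E).
Proof.
  induction E as [|[] E IH]; simpl; intros; auto; apply IH; simpl;
    auto using ws_app, ws_tsub, ws_nsub, ws_mu, cws_nam.
Qed.

(** The frames are added from the inside out. For a variable, [hv] being defined says that no frame
    binds it, so no substitution is ever for the head variable; an abstraction is covered by
    [push_lam]. *)
Lemma fill_out E : forall M,
  (exists B, M = Lam B) \/ (exists x, M = Var x) /\ hv (fill M E) <> None ->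
  breach (fill M E) \/
  exists Q, ws (fill M E) Q /\ NF0 Q /\ core Q = core M /\
    (core M = KVar -> hv Q = hv (fill M E)).
Proof.
  induction E as [|f E IH] using rev_ind; intros M HM.
  - right. exists M. repeat split; auto using ws_refl.
    destruct HM as [[B ->]|[[x ->] _]]; constructor.
  - rewrite fill_app in *. simpl in *.
    destruct (IH M) as [B|(Q&R&F&K&V)].
    { destruct HM as [?|[? V]]; auto. right; split; auto. intros E0; apply V.
      destruct f; simpl; rewrite E0; auto. }
    { left. destruct f; simpl; auto using breach_app, breach_tsub, breach_nsub,
        breach_mu, cbreach_nam. }
    assert (U : core M = KVar -> hv (fill1 (fill M E) f) <> None).
    { intros KM. destruct HM as [[B ->]|[_ ?]]; auto; discriminate. }
    destruct f as [L|N|N g|b]; simpl in *.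
    + destruct (app_out Q L F) as [B|(P&R2&F2&K2&V2&_)].
      * left. eapply breach_ws; [apply ws_app; eauto|auto].
      * right. exists P. repeat split; try congruence.
        -- eapply ws_trans; [apply ws_app; eauto|auto].
        -- intros KM. rewrite V2, V; congruence.
    + destruct (tsub_out Q N F) as (P&R2&F2&K2&V2&_).
      { intros KM E0. rewrite K in KM. specialize (U KM). rewrite <- V, E0 in U; auto. }
      right. exists P. repeat split; try congruence.
      * eapply ws_trans; [apply ws_tsub; eauto|auto].
      * intros KM. rewrite V2, V; congruence.
    + destruct (nsub_out _ Q N g (le_n _) F) as [B|(P&R2&F2&K2&V2&_)].
      * left. eapply breach_ws; [apply ws_nsub; eauto|auto].
      * right. exists P. repeat split; try congruence.
        -- eapply ws_trans; [apply ws_nsub; eauto|auto].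
        -- intros KM. rewrite V2, V; congruence.
    + destruct (nam_out Q b F) as [B|(c&P&R2&F2&Kd&K2&V2)].
      * left. eapply breach_ws; [apply ws_mu, cws_nam; eauto|]. apply breach_mu; auto.
      * right. exists (Mu (Nam c P)). simpl. repeat split; try congruence.
        -- eapply ws_trans; [apply ws_mu, cws_nam; eauto|]. apply ws_mu; auto.
        -- constructor; auto.
        -- intros KM. rewrite V2, V; congruence.
Qed.

Lemma unbind_S o : unbind (option_map S o) = o.
Proof. destruct o; reflexivity. Qed.

(** Removing a substitution keeps kind and head name. Eta may turn a mu into a term of another kind,
    whose head name is undefined. In both cases the side conditions of the enclosing frames
    survive. *)
Lemma clean_step P : NF0 P -> NF P \/
  exists P', ws P P' /\ NF0 P' /\ tsize P' < tsize P /\ hv P' = hv P /\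
    (kind P' = kind P /\ hn P' = hn P \/ kind P = KMu /\ kind P' <> KMu).
Proof.
  induction 1 as [x|P|P Q F IH K|P N F IH V|P N g F IH V|b P F IH K]; simpl.
  - auto.
  - auto.
  - destruct IH as [IH|(P'&R&F'&Sz&V&A)]; [left; auto|right].
    assert (kind P' = KVar) by (destruct A as [[A _]|[A _]]; congruence).
    exists (App P' Q). simpl. repeat split; auto using ws_app; try lia.
    + constructor; auto.
    + left; split; congruence.
  (* An abstraction is already in [NF]; it is set apart because the induction hypothesis does not
     record [bare]. *)
  - destruct (classic (bare P)) as [B|B].
    { assert (NF P) by (destruct P; simpl in *; tauto).
      destruct (classic (tocc true 0 P)) as [O|O]; auto. right.
      rewrite <- (unshift_v P O). exists (ren pred idr P).
      rewrite (unshift_v P O) at 2 3. rewrite (proj1 tsize_ren).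
      repeat split; auto.
      - apply ws_step, st_gc_t.
      - apply NF0_ren; auto.
      - rewrite <- (unshift_v P O) at 2. unfold shiftv. rewrite (hv_ren (ren pred idr P)).
        symmetry; apply unbind_S.
      - left. rewrite <- (unshift_v P O) at 2 4. unfold shiftv.
        rewrite !kind_ren, !hn_ren, !option_map_idr. auto. }
    destruct IH as [IH|(P'&R&F'&Sz&V'&A)].
    + destruct (classic (tocc true 0 P)) as [O|O]; auto. right.
      exists (ren pred idr P).
      rewrite (proj1 tsize_ren).
      repeat split; auto.
      * rewrite <- (unshift_v P O) at 1. apply ws_step, st_gc_t.
      * apply NF0_ren; auto.
      * rewrite <- (unshift_v P O) at 2. unfold shiftv. rewrite (hv_ren (ren pred idr P)).
        symmetry; apply unbind_S.
      * left. rewrite kind_ren, hn_ren, option_map_idr. auto.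
    + right. exists (TSub P' N). simpl. repeat split; auto using ws_tsub; try lia.
      * constructor; auto. left. rewrite V'. tauto.
      * congruence.
  - destruct IH as [IH|(P'&R&F'&Sz&V'&A)].
    + destruct (classic (tocc false 0 P)) as [O|O]; auto. right.
      exists (ren idr pred P).
      rewrite (proj1 tsize_ren).
      repeat split; auto.
      * rewrite <- (unshift_n P O) at 1. apply ws_step, st_gc_n.
      * apply NF0_ren; auto.
      * rewrite hv_ren, option_map_idr. auto.
      * left. rewrite kind_ren. split; auto. rewrite <- (unshift_n P O) at 2.
        unfold shiftn. rewrite (hn_ren (ren idr pred P)). symmetry; apply unbind_S.
    + right. exists (NSub P' N g). simpl. repeat split; auto using ws_nsub; try lia.
      * constructor; auto. destruct A as [[_ A]|[_ A]]; [congruence|].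
        rewrite hn_kind; auto. discriminate.
      * destruct A as [[A1 A2]|A]; [left|right]; auto. rewrite A2; auto.
  - destruct IH as [IH|(P'&R&F'&Sz&V'&A)].
    + destruct (classic (b = 0 /\ ~ tocc false 0 P)) as [[-> O]|O].
      * right. exists (ren idr pred P). rewrite (proj1 tsize_ren).
        repeat split; auto.
        -- rewrite <- (unshift_n P O) at 1. apply ws_step, st_eta.
        -- apply NF0_ren; auto.
        -- rewrite hv_ren, option_map_idr. auto.
        -- right. rewrite kind_ren. auto.
      * left. repeat split; auto. intros [E O']; apply O; split; congruence.
    + right. assert (kind P' <> KMu) by (destruct A as [[A _]|[A _]]; congruence).
      exists (Mu (Nam b P')). simpl. repeat split; auto using ws_mu, cws_nam; try lia.
      constructor; auto.
Qed.

Lemma clean n : forall P, tsize P <= n -> NF0 P -> exists Q, ws P Q /\ NF Q.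
Proof.
  induction n as [|n IH]; intros P Sz F;
    (destruct (clean_step P F) as [?|(P'&R&F'&Sz'&_)];
     [exists P; split; auto using ws_refl|]); try lia.
  destruct (IH P') as (Q&R'&N); auto; try lia.
  exists Q; split; auto. eapply ws_trans; eauto.
Qed.

Lemma ren_fill E : forall f g M, exists f' g' E', length E' = length E /\
  ren f g (fill M E) = fill (ren f' g' M) E'.
Proof.
  induction E as [|fr E IH] using rev_ind; intros f g M.
  - exists f, g, []; auto.
  - rewrite fill_app. destruct fr as [Q|N|N c|b]; simpl.
    + destruct (IH f g M) as (f'&g'&E'&L&->).
      exists f', g', (E' ++ [FA (ren f g Q)]). rewrite !length_app, fill_app; simpl. auto.
    + destruct (IH (upr f) g M) as (f'&g'&E'&L&->).
      exists f', g', (E' ++ [FT (ren f g N)]). rewrite !length_app, fill_app; simpl. auto.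
    + destruct (IH f (upr g) M) as (f'&g'&E'&L&->).
      exists f', g', (E' ++ [FN (ren f g N) (g c)]). rewrite !length_app, fill_app; simpl. auto.
    + destruct (IH f (upr g) M) as (f'&g'&E'&L&->).
      exists f', g', (E' ++ [FM (upr g b)]). rewrite !length_app, fill_app; simpl. auto.
Qed.

(* A substitution for the head variable is pushed down to the head and replaces
   it; the shift shows that the new head only depends on the substitutions to
   the right of the one for the old head variable. *)
Lemma lookup n : forall E x N, length E = n -> hv (fill (Var x) E) = Some 0 ->
  exists E' g, ws (TSub (fill (Var x) E) N) (fill (ren (fun i => nv E' + i) g N) E').
Proof.
  induction n as [|n IH]; intros E x N L V.
  - destruct E; [|discriminate]. simpl in *. injection V as ->.
    exists [], idr. simpl. change (ws (TSub (Var 0) N) (ren (fun i => i) (fun i => i) N)).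
    rewrite ren_id. apply ws_step, st_var.
  - destruct E as [|fr E _] using rev_ind; [discriminate|].
    rewrite length_app in L; simpl in L.
    assert (LE : length E = n) by lia. clear L.
    rewrite fill_app in *. simpl in *.
    (* The rules rename the term they enter, which alters the frames but not their number; hence the
       induction on the length. *)
    assert (G : forall f g N', hv (ren f g (fill (Var x) E)) = Some 0 ->
      exists E' g', ws (TSub (ren f g (fill (Var x) E)) N') (fill (ren (fun i => nv E' + i) g' N') E')).
    { intros f g N' V'. destruct (ren_fill E f g (Var x)) as (f'&g'&E1&L1&R1).
      rewrite R1 in *. apply IH; auto. lia. }
    destruct fr as [Q|L|L c|b]; simpl in *.
    + destruct (G (upr S) idr (shiftv N)) as (E'&g&R); [rewrite hv_ren, V; auto|].
      exists (E' ++ [FA Q; FT N]), g. rewrite fill_app, nv_app; simpl.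
      eapply ws_trans; [apply ws_step, st_app_t; auto|].
      unfold shiftv in R at 2. rewrite ren_comp in R.
      replace (fun i => nv E' + 1 + i) with (fun n => nv E' + S n) by (fext; lia).
      apply ws_tsub, ws_app. exact R.
    + assert (V' : hv (fill (Var x) E) = Some 1)
        by (destruct (hv (fill (Var x) E)) as [[|m]|]; inversion V; auto).
      destruct (G pull1 idr (shiftv (shiftv N))) as (E'&g&R); [rewrite hv_ren, V'; auto|].
      exists (E' ++ [FT L; FT N]), g. rewrite fill_app, nv_app; simpl.
      eapply ws_trans; [apply ws_step, st_tt; auto|].
      unfold shiftv in R at 3 4. rewrite !ren_comp in R.
      replace (fun i => nv E' + 2 + i) with (fun n => nv E' + S (S n)) by (fext; lia).
      apply ws_tsub, ws_tsub. exact R.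
    + destruct (G (upr S) idr (shiftv (shiftn N))) as (E'&g&R); [rewrite hv_ren, V; auto|].
      exists (E' ++ [FN L c; FT N]), (fun i => g (idr (S i))).
      rewrite fill_app, nv_app; simpl.
      eapply ws_trans; [apply ws_step, st_nt; auto|].
      unfold shiftv in R at 2. unfold shiftn in R at 2. rewrite !ren_comp in R.
      replace (fun i => nv E' + 1 + i) with (fun n => nv E' + S (idr n))
        by (fext; unfold idr; lia).
      apply ws_tsub, ws_nsub. exact R.
    + destruct (G (fun n => n) (fun n => n) (shiftn N)) as (E'&g&R);
        [rewrite ren_id; auto|]. rewrite ren_id in R.
      exists (E' ++ [FM b]), (fun i => g (S i)).
      rewrite fill_app, nv_app; simpl.
      eapply ws_trans; [apply ws_step, st_mu_t; auto|].
      unfold shiftn in R at 2. rewrite !ren_comp in R.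
      replace (fun i => nv E' + 0 + i) with (fun n => nv E' + (idr n))
        by (fext; unfold idr; lia).
      apply ws_mu, cws_nam. exact R.
Qed.

Lemma hv_fill E : forall y,
  hv (fill (Var y) E) = if y <? nv E then None else Some (y - nv E).
Proof.
  induction E as [|fr E IH] using rev_ind; intros y.
  - simpl. f_equal. lia.
  - rewrite fill_app, nv_app. destruct fr; simpl; rewrite IH;
      rewrite ?Nat.add_0_r; auto.
    destruct (Nat.ltb_spec y (nv E)); destruct (Nat.ltb_spec y (nv E + 1)); simpl; auto;
      try lia.
    + replace (y - nv E) with 0 by lia. reflexivity.
    + replace (y - nv E) with (S (y - (nv E + 1))) by lia. reflexivity.
Qed.

Lemma split_ft E : forall y, y < nv E ->
  exists E1 N E2, E = E1 ++ FT N :: E2 /\ nv E1 = y.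
Proof.
  induction E as [|fr E IH]; simpl; intros y L; [lia|].
  assert (D : (exists N, fr = FT N /\ y = 0) \/
              (nv [fr] <= y /\ y - nv [fr] < nv E)).
  { destruct fr; simpl in *; try (right; lia). destruct y; [left; eauto|right; lia]. }
  destruct D as [(N&->&->)|[D1 D2]].
  - exists [], N, E. auto.
  - destruct (IH _ D2) as (E1&N&E2&->&V). exists (fr :: E1), N, E2. split; auto.
    change (fr :: E1) with ([fr] ++ E1). rewrite nv_app. lia.
Qed.

Definition pframe (fr : frame) : Prop :=
  match fr with FA N | FT N | FN N _ => pure N | FM _ => True end.

Lemma sp_fill E : forall M, sp (fill M E) <-> sp M /\ Forall pframe E.
Proof.
  induction E as [|fr E IH]; simpl; intros M.
  - intuition.
  - rewrite IH, Forall_cons_iff. destruct fr; simpl; tauto.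
Qed.

Lemma sp_csp_fill :
  (forall M, sp M -> exists P E, pure P /\ ws M (fill P E)) /\
  (forall C, csp C -> exists b P E, pure P /\ cws C (Nam b (fill P E))).
Proof.
  apply tm_cmd_ind; simpl.
  - intros x _. exists (Var x), []. split; [exact I|apply ws_refl].
  - intros P _ A. exists (Lam P), []. split; [exact A|apply ws_refl].
  - intros P IP Q _ [SP _]. destruct (IP SP) as (R&E&A&W).
    exists R, (E ++ [FA Q]). rewrite fill_app. split; auto. apply ws_app; auto.
  - intros C IC SC. destruct (IC SC) as (b&R&E&A&W).
    exists R, (E ++ [FM b]). rewrite fill_app. split; auto. apply ws_mu; auto.
  - intros P IP Q _ [SP _]. destruct (IP SP) as (R&E&A&W).
    exists R, (E ++ [FT Q]). rewrite fill_app. split; auto. apply ws_tsub; auto.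
  - intros P IP Q _ g [SP _]. destruct (IP SP) as (R&E&A&W).
    exists R, (E ++ [FN Q g]). rewrite fill_app. split; auto. apply ws_nsub; auto.
  - intros b P IP SP. destruct (IP SP) as (R&E&A&W).
    exists b, R, E. split; auto. apply cws_nam; auto.
  - intros C IC N _ [SC _]. destruct (IC SC) as (b&R&E&A&W).
    exists b, R, (E ++ [FT N]). rewrite fill_app. split; auto.
    eapply cws_trans; [apply cws_tsub; eauto|]. apply cws_scong, csc_sym, csc_t.
  - intros C IC N _ g [SC _]. destruct (IC SC) as ([|b]&R&E&A&W).
    (* The name of the command is bound by this substitution, which therefore cannot be collected
       below the naming; [cst_n] is applied and leaves its argument as a frame. *)
    + exists g, R, (E ++ [FN N g; FA N]). rewrite fill_app. split; auto.
      eapply cws_trans; [apply cws_nsub; eauto|]. apply cws_step, cst_n.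
    + exists b, R, (E ++ [FN N g]). rewrite fill_app. split; auto.
      eapply cws_trans; [apply cws_nsub; eauto|]. apply cws_scong, csc_sym, csc_n.
Qed.

Lemma bts_bt T T1 T2 : bts T T1 -> bt T1 T2 -> exists T', bt T T' /\ bts T' T2.
Proof.
  intros R B. apply clos_rt_rt1n in R. destruct R as [|T' T1 B' R].
  - exists T2. split; auto. apply rt_refl.
  - exists T'. split; auto. eapply rt_trans; [apply clos_rt1n_rt; eauto|].
    apply rt_step; auto.
Qed.

(* In the head position is a pure [M] in scope of the substitutions of [E] beyond
   the first [k] only. An App or Mu of [M] is absorbed into [E]; looking up a
   variable decreases [nv E - k]. *)
Lemma NF_of_fill T
  (Beta : forall T', bt T T' -> forall P, sp P -> bts T' (hdt (tr P)) -> exists Q, ws P Q /\ NF Q) :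
  forall d sz E k g M, pure M -> nv E - k <= d -> tsize M <= sz ->
    let P := fill (ren (fun i => k + i) g M) E in
    sp P -> bts T (hdt (tr P)) -> exists Q, ws P Q /\ NF Q.
Proof.
  (* When no variable remains to be looked up, either a beta step is reachable and [Beta] applies to
     its result, or only garbage collection and eta remain. *)
  assert (Final : forall M E, (exists B, M = Lam B) \/ (exists x, M = Var x) /\ hv (fill M E) <> None ->
    sp (fill M E) -> bts T (hdt (tr (fill M E))) -> exists Q, ws (fill M E) Q /\ NF Q).
  { intros M E HM SP R. destruct (fill_out E M HM) as [(Q&Q'&W&B)|(Q&W&F&_)].
    - pose proof (sp_ws _ _ W SP) as SQ.
      destruct (bts_bt T (hdt (tr Q)) (hdt (tr Q'))) as (T'&B'&R').
      { eapply rt_trans; [exact R|]. apply ws_bts; auto. }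
      { apply bstep_bt; auto. }
      assert (S1 : step Q Q') by (apply bstep_step; auto).
      destruct (Beta T' B' Q') as (N&W'&F); auto.
      { apply (proj1 sp_step_cstep _ _ S1); auto. }
      exists N. split; auto. eapply ws_trans; [exact W|].
      eapply ws_trans; [apply ws_step, S1|auto].
    - destruct (clean _ Q (le_n _) F) as (N&W'&F').
      exists N. split; auto. eapply ws_trans; eauto. }
  induction d as [d IHd] using lt_wf_ind. induction sz as [sz IHs] using lt_wf_ind.
  intros E k g M PM D Sz. destruct M as [x|B|P Q|[b P| |]| |]; simpl in PM; try tauto;
    simpl ren; intros P0 SP R; subst P0.
  - destruct (Nat.ltb_spec (k + x) (nv E)) as [L|L].
    + destruct (split_ft E _ L) as (E1&N&E2&->&V).
      rewrite fill_app in *. simpl in *.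
      destruct (lookup _ E1 (k + x) N eq_refl) as (E'&g'&W).
      { rewrite hv_fill. destruct (Nat.ltb_spec (k + x) (nv E1)); [lia|].
        f_equal; lia. }
      apply (ws_fill E2) in W. rewrite <- fill_app in W.
      (* [N] lies in the scope of [E2] only, so the measure drops to [nv E2], even though [E'] may
         be longer than [E1]. *)
      destruct (IHd (nv E2)) with (sz := tsize N) (E := E' ++ E2) (k := nv E')
        (g := g') (M := N) as (Q&W'&F); auto.
      * rewrite nv_app in D. simpl in D. lia.
      * apply sp_fill in SP. simpl in SP. tauto.
      * rewrite nv_app. lia.
      * eapply sp_ws; eauto.
      * eapply rt_trans; [exact R|]. apply ws_bts; auto.
      * exists Q. split; auto. eapply ws_trans; eauto.
    + apply Final; auto. right. split; eauto. rewrite hv_fill.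
      destruct (Nat.ltb_spec (k + x) (nv E)); [lia|discriminate].
  - apply Final; eauto.
  - simpl in Sz.
    apply (IHs (tsize P)) with (E := FA (ren (fun i => k + i) g Q) :: E)
      (k := k) (g := g) (M := P); simpl; auto; try lia; tauto.
  - simpl in Sz.
    apply (IHs (tsize P)) with (E := FM (upr g b) :: E)
      (k := k) (g := upr g) (M := P); simpl; auto; try lia.
Qed.

(** Stated for every [P] whose triple is a reduct of [T], because [ws] only guarantees [bts] between
    triples and not equality. *)
Lemma bacc_NF_of T : bacc T ->
  forall P, bts T (hdt (tr P)) -> sp P -> exists Q, ws P Q /\ NF Q.
Proof.
  induction 1 as [T _ IH].
  intros P R SP. destruct (proj1 sp_csp_fill P SP) as (M&E&PM&W).
  (* The identity renaming is the instance [k = 0] of the invariant: at the start [M] is in the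
     scope of all frames. *)
  rewrite <- (ren_id M) in W.
  destruct (NF_of_fill T (fun T' B P SP R => IH T' B P R SP) _ _ E 0 (fun n => n) M PM
    (le_n _) (le_n _)) as (Q&W'&F).
  - eapply sp_ws; eauto.
  - eapply rt_trans; [exact R|]. apply ws_bts; auto.
  - exists Q. split; auto. eapply ws_trans; eauto.
Qed.

Lemma bacc_NF P : bacc (hdt (tr P)) -> sp P -> exists Q, ws P Q /\ NF Q.
Proof. intros A. apply (bacc_NF_of _ A). apply rt_refl. Qed.

(** * The equivalences *)

Lemma has_wxhnf_bacc P : sp P -> has_wxhnf P <-> bacc (hdt (tr P)).
Proof.
  intros SP. split.
  - intros (Q&R&N). pose proof (sp_wxhs _ _ R SP) as SQ.
    eapply bts_bacc; [apply wxhs_bts; eauto|].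
    apply nform_tnormal, NF_nform, normal_NF; auto.
  - intros A. destruct (bacc_NF P A SP) as (Q&W&F).
    destruct (ws_wxhs _ _ W) as (Q'&R&S). exists Q'. split; auto.
    apply NF_normal, (NF_scong _ _ S); auto.
Qed.

Lemma has_wxhnf_whnf P : sp P -> has_wxhnf P <-> has_whnf (tr P).
Proof. intros SP. rewrite has_wxhnf_bacc, has_whnf_bacc; tauto. Qed.

Lemma wxhs_normal P Q : sp P -> wxhs P Q -> wxh_normal Q ->
  whs (tr P) (tr Q) /\ wh_normal (tr Q).
Proof.
  intros SP R N. pose proof (sp_wxhs _ _ R SP) as SQ.
  assert (W : wh_normal (tr Q)) by (apply nform_normal, NF_nform, normal_NF; auto).
  split; auto. apply bts_whs_normal; auto. apply wxhs_bts; auto.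
Qed.

Lemma nf_of_tr P M s : sp P -> wxh_nf_of P M s ->
  whs (tr P) (tr (subs M s)) /\ wh_normal (tr (subs M s)) /\ sp (subs M s).
Proof.
  intros SP (Q&R&N&S). rewrite <- (tr_scong _ _ S).
  destruct (wxhs_normal P Q) as [R' N']; auto. repeat split; auto.
  apply (sp_scong _ _ S). eapply sp_wxhs; eauto.
Qed.

Lemma Forall2_impl_in {A B} (R R' : A -> B -> Prop) l l' :
  Forall2 R l l' -> (forall a b, In a l -> In b l' -> R a b -> R' a b) -> Forall2 R' l l'.
Proof.
  induction 1; intros I; constructor; [apply I; simpl; auto|].
  apply IHForall2. intros; apply I; simpl; auto.
Qed.

Lemma Forall2_maps {A B C D} (f : A -> C) (g : B -> D) (R : C -> D -> Prop) l : forall l',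
  Forall2 R (map f l) (map g l') <-> Forall2 (fun a b => R (f a) (g b)) l l'.
Proof.
  induction l as [|a l IH]; intros [|b l']; simpl; split; intros F; inversion F;
    subst; constructor; auto; apply IH; auto.
Qed.

Lemma wh_clause_mono R R' M N :
  (forall M N, R M N -> R' M N) -> wh_clause R M N -> wh_clause R' M N.
Proof.
  intros I [?|(M'&N'&A1&A2&A3&A4&C)]; [left; auto|right].
  exists M', N'. repeat split; auto.
  destruct C as [(x&Ms&Ns&E1&E2&F)|[(P&Q&E1&E2&F)|(b&P&Q&E1&E2&F)]].
  - left. exists x, Ms, Ns. repeat split; auto. eapply Forall2_impl; eauto.
  - right; left. eauto 7.
  - right; right. eauto 8.
Qed.

Lemma wxh_clause_mono R R' M N :
  (forall M N, R M N -> R' M N) -> wxh_clause R M N -> wxh_clause R' M N.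
Proof.
  intros I [?|(M'&s&N'&s'&A1&A2&C)]; [left; auto|right].
  exists M', s, N', s'. repeat split; auto.
  destruct C as [(x&Ms&Ns&E1&E2&F)|[(P&Q&E1&E2&F)|(b&P&Q&E1&E2&F)]].
  - left. exists x, Ms, Ns. repeat split; auto. eapply Forall2_impl; [|eauto].
    intros; simpl in *; auto.
  - right; left. eauto 7.
  - right; right. eauto 8.
Qed.

Lemma wh_clause_sym R M N : symmetric lm R -> wh_clause R M N -> wh_clause R N M.
Proof.
  intros Sy [[? ?]|(M'&N'&A1&A2&A3&A4&C)]; [left; auto|right].
  exists N', M'. repeat split; auto.
  destruct C as [(x&Ms&Ns&E1&E2&F)|[(P&Q&E1&E2&F)|(b&P&Q&E1&E2&F)]].
  - left. exists x, Ns, Ms. repeat split; auto. apply Forall2_flip.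
    eapply Forall2_impl; eauto.
  - right; left. eauto 7.
  - right; right. eauto 8.
Qed.

Lemma wxh_clause_sym R M N : symmetric tm R -> wxh_clause R M N -> wxh_clause R N M.
Proof.
  intros Sy [[? ?]|(M'&s&N'&s'&A1&A2&C)]; [left; auto|right].
  exists N', s', M', s. repeat split; auto.
  destruct C as [(x&Ms&Ns&E1&E2&F)|[(P&Q&E1&E2&F)|(b&P&Q&E1&E2&F)]].
  - left. exists x, Ns, Ms. repeat split; auto. apply Forall2_flip.
    eapply Forall2_impl; [|eauto]. intros; simpl in *; auto.
  - right; left. eauto 7.
  - right; right. eauto 8.
Qed.

(* Knaster-Tarski: the fixed point condition may be weakened to a
   post-fixed point. *)
Lemma largest_symmetric_post {A} (F : relation A -> relation A) (R : relation A) a b :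
  (forall R R' c d, (forall x y, R x y -> R' x y) -> F R c d -> F R' c d) ->
  (forall R c d, symmetric A R -> F R c d -> F R d c) ->
  symmetric A R -> (forall c d, R c d -> F R c d) -> R a b -> largest_symmetric F a b.
Proof.
  intros Mono Sym SR Post Rab.
  set (G := fun c d => exists R, symmetric A R /\ (forall x y, R x y -> F R x y) /\ R c d).
  assert (SG : symmetric A G).
  { intros c d (R'&S'&P'&I). exists R'; auto. }
  assert (PG : forall c d, G c d -> F G c d).
  { intros c d (R'&S'&P'&I). apply (Mono R'); auto.
    intros x y I'. exists R'; auto. }
  exists G. repeat split; auto.
  (* By monotonicity [F G] is itself a symmetric post-fixed point, so it is contained in the union
     [G]. *)
  - intros I. exists (F G). repeat split; auto.
    + intros x y; apply Sym; auto.
    + intros x y; apply Mono; auto.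
  - exists R; auto.
Qed.

(** The relation is pushed forward along [tr], because many explicit terms unfold to the same pure
    term. Purity of the arguments and of the substitutions in a normal form shows that the terms
    compared next are again in [sp]. *)
Lemma wxh_to_wh (R : relation tm) P Q : sp P -> sp Q -> wxh_clause R P Q ->
  wh_clause (fun M N => exists P Q, sp P /\ sp Q /\ tr P = M /\ tr Q = N /\ R P Q) (tr P) (tr Q).
Proof.
  intros SP SQ [[A B]|(M'&s&N'&s'&A&B&C)].
  { left. rewrite <- !has_wxhnf_whnf; auto. }
  right. apply nf_of_tr in A, B; auto.
  destruct A as (RA&NA&SA), B as (RB&NB&SB).
  exists (tr (subs M' s)), (tr (subs N' s')). repeat split; auto.
  destruct C as [(x&Ms&Ns&->&->&F)|[(M1&N1&->&->&F)|(b&M1&N1&->&->&F)]].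
  - left. rewrite !tr_subs_apps. eexists x, _, _. repeat split.
    apply Forall2_maps. eapply Forall2_impl_in; [exact F|]. simpl.
    apply sp_subs in SA as [SA Ps]. apply sp_subs in SB as [SB Ps'].
    apply sp_apps in SA as [_ SA]. apply sp_apps in SB as [_ SB].
    rewrite Forall_forall in SA, SB.
    intros Mi Ni IM IN I. exists (subs Mi s), (subs Ni s').
    rewrite !sp_subs. repeat split; auto using pure_sp.
  - right; left. rewrite !tr_subs_lam. eexists _, _. repeat split.
    apply sp_subs in SA as [SA Ps]. apply sp_subs in SB as [SB Ps'].
    exists (lam_subs M1 s), (lam_subs N1 s').
    rewrite !sp_lam_subs. repeat split; auto; apply pure_sp; auto.
  - right; right. rewrite !tr_subs_mu. eexists b, _, _. repeat split.
    apply sp_subs in SA as [SA Ps]. apply sp_subs in SB as [SB Ps'].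
    exists (mu_subs M1 s), (mu_subs N1 s').
    rewrite !sp_mu_subs. repeat split; auto.
Qed.

(** Any explicit normal form will do: it unfolds to a wh-normal reduct of [tr P], which is [W] by
    uniqueness. *)
Lemma nf_of_ex P W : sp P -> whs (tr P) W -> wh_normal W ->
  exists M s, wxh_nf_of P M s /\ tr (subs M s) = W /\ sp (subs M s) /\
   ((exists x l, M = apps (Var (outv s x)) l) \/ (exists Q, M = Lam Q) \/
    (exists b Q, M = Mu (Nam (mu_outn s b) Q))).
Proof.
  intros SP R N.
  assert (A : has_whnf (tr P)).
  { exists W; split; auto. apply nform_whnf, wh_normal_nform; auto. }
  apply has_wxhnf_whnf in A; auto. destruct A as (Q&R'&N').
  destruct (NF_shape Q (normal_NF Q N')) as (M&s&S&T).
  assert (K : wxh_nf_of P M s) by (exists Q; auto).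
  destruct (nf_of_tr P M s SP K) as (R2&N2&SM).
  exists M, s. repeat split; auto.
  - eapply whs_normal_unique; eauto.
  - destruct (kind Q).
    + left. destruct T as (x&l&_&->); eauto.
    + right; left; auto.
    + right; right. destruct T as (b&L&_&->); eauto.
Qed.

Lemma lapps_var_inj l : forall x l' x',
  lapps (LVar x) l = lapps (LVar x') l' -> x = x' /\ l = l'.
Proof.
  induction l as [|Q l IH] using rev_ind; intros x l' x' E;
    destruct l' as [|Q' l' _] using rev_ind; rewrite ?lapps_app in E; simpl in E;
    try discriminate.
  - injection E; auto.
  - injection E as E ->. apply IH in E as [-> ->]. auto.
Qed.

(** Variable-headed applications, abstractions and mus stay distinct after unfolding, so the shape
    of the pure normal form dictates that of the explicit one; the other combinations are
    contradictory. *)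
Lemma wh_to_wxh (R : relation lm) P Q : sp P -> sp Q -> wh_clause R (tr P) (tr Q) ->
  wxh_clause (fun P Q => sp P /\ sp Q /\ R (tr P) (tr Q)) P Q.
Proof.
  intros SP SQ [[A B]|(M'&N'&RM&NM&RN&NN&C)].
  { left. rewrite !has_wxhnf_whnf; auto. }
  right. destruct (nf_of_ex P M' SP RM NM) as (M&s&A&EM&SM&HM).
  destruct (nf_of_ex Q N' SQ RN NN) as (N&s'&B&EN&SN&HN).
  exists M, s, N, s'. repeat split; auto.
  apply sp_subs in SM as [SM Ps]. apply sp_subs in SN as [SN Ps'].
  destruct C as [(x&Ms&Ns&EM'&EN'&F)|[(M1&N1&EM'&EN'&F)|(b&M1&N1&EM'&EN'&F)]];
  rewrite EM' in EM; rewrite EN' in EN.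
  - left.
    destruct HM as [(y&l&->)|[(L&->)|(c&L&->)]];
      rewrite ?tr_subs_apps, ?tr_subs_lam, ?tr_subs_mu in EM;
      try (exfalso; symmetry in EM; eapply lapps_var_not_lam; exact EM);
      try (exfalso; symmetry in EM; eapply lapps_var_not_mu; exact EM).
    destruct HN as [(y'&l'&->)|[(L&->)|(c&L&->)]];
      rewrite ?tr_subs_apps, ?tr_subs_lam, ?tr_subs_mu in EN;
      try (exfalso; symmetry in EN; eapply lapps_var_not_lam; exact EN);
      try (exfalso; symmetry in EN; eapply lapps_var_not_mu; exact EN).
    apply lapps_var_inj in EM as [-> <-]. apply lapps_var_inj in EN as [-> <-].
    apply sp_apps in SM as [_ SM]. apply sp_apps in SN as [_ SN].
    rewrite Forall_forall in SM, SN.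
    exists x, l, l'. repeat split; auto. apply (proj1 (Forall2_maps _ _ _ _ _)) in F.
    eapply Forall2_impl_in; [exact F|]. simpl. intros Mi Ni IM IN I.
    rewrite !sp_subs. repeat split; auto using pure_sp.
  - right; left.
    destruct HM as [(y&l&->)|[(L&->)|(c&L&->)]];
      rewrite ?tr_subs_apps, ?tr_subs_lam, ?tr_subs_mu in EM;
      try (exfalso; eapply lapps_var_not_lam; exact EM); try discriminate.
    destruct HN as [(y'&l'&->)|[(L'&->)|(c&L'&->)]];
      rewrite ?tr_subs_apps, ?tr_subs_lam, ?tr_subs_mu in EN;
      try (exfalso; eapply lapps_var_not_lam; exact EN); try discriminate.
    injection EM as <-. injection EN as <-.
    exists L, L'. rewrite !sp_lam_subs. repeat split; auto; apply pure_sp; auto.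
  - right; right.
    destruct HM as [(y&l&->)|[(L&->)|(c&L&->)]];
      rewrite ?tr_subs_apps, ?tr_subs_lam, ?tr_subs_mu in EM;
      try (exfalso; eapply lapps_var_not_mu; exact EM); try discriminate.
    destruct HN as [(y'&l'&->)|[(L'&->)|(c'&L'&->)]];
      rewrite ?tr_subs_apps, ?tr_subs_lam, ?tr_subs_mu in EN;
      try (exfalso; eapply lapps_var_not_mu; exact EN); try discriminate.
    injection EM as -> <-. injection EN as -> <-.
    exists b, L, L'. rewrite !sp_mu_subs. repeat split; auto.
Qed.

Theorem theorem5p13 (M N : lm) :
  wxh_equiv (emb M) (emb N) <-> wh_equiv M N.
Proof.
  split.
  - intros (R&Sy&Fix&I).
    apply (largest_symmetric_post _
      (fun M N => exists P Q, sp P /\ sp Q /\ tr P = M /\ tr Q = N /\ R P Q)).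
    + intros; eapply wh_clause_mono; eauto.
    + intros; apply wh_clause_sym; auto.
    + intros M' N' (P&Q&SP&SQ&E&E'&I'). exists Q, P. repeat split; auto.
    + intros M' N' (P&Q&SP&SQ&<-&<-&I'). apply wxh_to_wh; auto. apply Fix; auto.
    + exists (emb M), (emb N). rewrite !tr_emb. repeat split; auto using pure_sp, pure_emb.
  - intros (R&Sy&Fix&I).
    apply (largest_symmetric_post _ (fun P Q => sp P /\ sp Q /\ R (tr P) (tr Q))).
    + intros; eapply wxh_clause_mono; eauto.
    + intros; apply wxh_clause_sym; auto.
    + intros P Q (SP&SQ&I'). auto.
    + intros P Q (SP&SQ&I'). apply wh_to_wxh; auto. apply Fix; auto.
    + rewrite !tr_emb. repeat split; auto using pure_sp, pure_emb.
Qed.
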